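(* Let $\mathbf K^{\jmath}$ be the free $\mathcal A$-module with basis the symbols $[A]$, $A\in\tilde\Xi$. The formula $[A_1]\cdot[A_2]\cdots[A_f]=\sum_{i=1}^mG_i(v,1)[Z_i]$ (with $G_i$, $Z_i$ the stabilization data of $A_1,\dots,A_f$ described in the context) endows $\mathbf K^{\jmath}$ with a structure of associative $\mathcal A$-algebra (without unit). Moreover, this algebra structure is characterized by the following multiplication formulas (together with $[B]\cdot[A]=0$ if $\mathrm{co}(B)\ne\mathrm{ro}(A)$), for $A,B,C\in\tilde\Xi$, $h\in[1,n]$, $R\in\mathbb N$: (1) If $\mathrm{ro}(A)=\mathrm{co}(B)$ and $B-RE^\theta_{h,h+1}$ is diagonal, then $$[B]\cdot[A]=\sum_tv^{\beta(t)}\prod_{u=1}^N\overline{\begin{bmatrix}a_{hu}+t_u \\ t_u\end{bmatrix}}\Big[A+\sum_ut_u(E^\theta_{hu}-E^\theta_{h+1,u})\Big],$$ over $t\in\mathbb N^N$ with $\sum_ut_u=R$ and $t_u\le a_{h+1,u}$ for $u\ne h+1$ if $h<n$, respectively $t_u+t_{N+1-u}\le a_{n+1,u}$ for $u\ne n+1$ if $h=n$, where $$\beta(t)=\sum_{j\le l}a_{hl}t_j-\sum_{j<l}a_{h+1,l}t_j+\sum_{j<l}t_jt_l+\delta_{h,n}\Big(\sum_{j<l,\,j+l<N+1}t_jt_l+\sum_{j<n+1}\tfrac{t_j(t_j+1)}2\Big).$$ (2) If $h<n$, $\mathrm{ro}(A)=\mathrm{co}(C)$ and $C-RE^\theta_{h+1,h}$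 is diagonal, then $$[C]\cdot[A]=\sum_tv^{\beta'(t)}\prod_{u=1}^N\overline{\begin{bmatrix}a_{h+1,u}+t_u \\ t_u\end{bmatrix}}\Big[A-\sum_ut_u(E^\theta_{hu}-E^\theta_{h+1,u})\Big],$$ over $t\in\mathbb N^N$ with $\sum_ut_u=R$ and $t_u\le a_{hu}$ for $u\ne h$, where $\beta'(t)=\sum_{j\ge l}a_{h+1,l}t_j-\sum_{j>l}a_{hl}t_j+\sum_{j>l}t_jt_l$. (3) If $\mathrm{ro}(A)=\mathrm{co}(C)$ and $C-RE^\theta_{n+1,n}$ is diagonal, then $$[C]\cdot[A]=\sum_tv^{\beta''(t)}\prod_{u<n+1}\overline{\begin{bmatrix}a_{n+1,u}+t_u+t_{N+1-u} \\ t_u\end{bmatrix}}\prod_{u>n+1}\overline{\begin{bmatrix}a_{n+1,u}+t_u \\ t_u\end{bmatrix}}\prod_{i=0}^{t_{n+1}-1}\frac{\overline{[a_{n+1,n+1}+1+2i]}}{\overline{[i+1]}}\Big[A-\sum_ut_u(E^\theta_{nu}-E^\theta_{n+1,u})\Big],$$ over $t\in\mathbb N^N$ with $\sum_ut_u=R$ and $t_u\le a_{nu}$ for $u\ne n$, where $$\beta''(t)=\sum_{j\ge l}a_{n+1,l}t_j-\sum_{j>l}a_{nl}t_j+\sum_{j>l}t_jt_l-\sum_{j<l,\,j+l<N+1}t_jt_l-\sum_{j<n+1}\tfrac{t_j(t_j-1)}2+\tfrac{R(R-1)}2 .$$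
   Context: Let $\mathcal A=\mathbb Z[v,v^{-1}]$, $n\ge1$, $N=2n+1$; $\mathbb N=\{0,1,2,\dots\}$, $|U|=\dim U$. For $d\ge0$ put $D=2d+1$. For an odd prime power $q$ equip $\mathbb F_q^D$ with a nondegenerate symmetric bilinear form with isometry group $O(D)$, and let $X$ be the set of flags $V=(0=V_0\subseteq V_1\subseteq\cdots\subseteq V_N=\mathbb F_q^D)$ with $V_i=V_{N-i}^\perp$ for all $i$. Let $\Xi_d$ be the set of $N\times N$ matrices $A=(a_{ij})$ over $\mathbb N$ with $\sum a_{ij}=D$ and $a_{ij}=a_{N+1-i,N+1-j}$. The $O(D)$-orbits $\mathcal O_A$ on $X\times X$ are indexed by $A\in\Xi_d$: $(V,V')\in\mathcal O_A$ iff $a_{ij}=|(V_{i-1}+V_i\cap V'_j)/(V_{i-1}+V_i\cap V'_{j-1})|$ for all $i,j$. The Schur algebra $\mathbf S^{\jmath}$ (depending on $d$) is the free $\mathcal A$-module with basis the characteristic functions $e_A$ ($A\in\Xi_d$) with convolution product $e_A*e_{A'}=\sum_{A''}g_{A,A',A''}e_{A''}$, where $g_{A,A',A''}\in\mathbb Z[v^2]$ is the polynomial whose value at $v=\sqrt q$, for all odd prime powers $q$, is the number of $V\in X$ with $(V_1,V)\in\mathcal O_A$, $(V,V_2)\in\mathcal O_{A'}$ for fixed $(V_1,V_2)\in\mathcal O_{A''}$. Its standard basis is $[A]=v^{-d_A}e_A$, where $$d_A=\sum_{i>k,\,j<l,\,i+k<N+1}a_{ij}a_{kl}+\sum_{j<l,\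 (i<n+1\text{ or }j<N+1-l)}a_{ij}a_{il}+\sum_{i\ge n+1>j}\frac{a_{ij}(a_{ij}-1)}2$$ (the dimension of $\mathcal O_A$ minus the dimension of its image under the first projection). $\mathrm{ro}(A)$, $\mathrm{co}(A)$: vectors of row sums, column sums. $E^\theta_{ij}=E_{ij}+E_{N+1-i,N+1-j}$. $\begin{bmatrix} a \\ b \end{bmatrix}=\prod_{i=1}^b\frac{v^{2(a-i+1)}-1}{v^{2i}-1}$ for $a\in\mathbb Z,b\in\mathbb N$, $[a]=\begin{bmatrix} a \\ 1 \end{bmatrix}$ for an integer $a$; overline on scalars: $v\mapsto v^{-1}$. $\tilde\Xi$ is the set of $N\times N$ integer matrices $A=(a_{ij})$ with $a_{ij}\ge0$ for $i\ne j$, $a_{n+1,n+1}$ odd, and $a_{ij}=a_{N+1-i,N+1-j}$. For $A\in\tilde\Xi$ put ${}_{2p}A=A+2pI$; it lies in some $\Xi_d$ for $p\gg0$. Stabilization data: given $A_1,\dots,A_f\in\tilde\Xi$ with $\mathrm{co}(A_i)=\mathrm{ro}(A_{i+1})$ for all $i$, there exist $Z_1,\dots,Z_m\in\tilde\Xi$ and $G_i(v,v')\in\mathbb Q(v)[v']$ such that $[{}_{2p}A_1]*\cdots*[{}_{2p}A_f]=\sum_{i=1}^mG_i(v,v^{-2p})[{}_{2p}Z_i]$ in the appropriate Schur algebra for all $p\gg0$. If $\mathrm{co}(A_i)\ne\mathrm{ro}(A_{i+1})$ for some $i$, the product $[A_1]\cdots[A_f]$ is $0$. *)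

(* Defs.v *)
From HB Require Import structures.
From mathcomp Require Import all_boot all_order all_algebra.
From mathcomp Require Import boolp.
From mathcomp.multinomials Require Import freeg.

Set Implicit Arguments.
Unset Strict Implicit.
Unset Printing Implicit Defensive.

Import GRing.Theory Num.Theory.
Local Open Scope ring_scope.

(* Indices are 0-based: with N = 2n+1, the index i of the
   mathematics (1 <= i <= N) is the ordinal i-1 : 'I_N.  Hence N+1-i is
   [rev_ord], n+1 is the ordinal n, and the condition i+k < N+1 reads
   i + k < 2n on ordinals.  Matrices have size n.*2.+1 and D = d.*2.+1. *)

(* ---- Scalars: Q(v) and its subring Z[v, v^-1] ---- *)

Notation Qv := {fraction {poly rat}}.

Definition v : Qv := FracField.tofrac 'X.

Definition is_laurent : {pred Qv} :=
  fun x => `[< exists (p : {poly int}) (k : nat),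
                 x = (map_poly intr p).[v] / v ^+ k >].

Lemma v_neq0 : v != 0.
Proof. by rewrite /v tofrac_eq0 polyX_eq0. Qed.

Lemma is_laurentP (x : Qv) :
  reflect (exists (p : {poly int}) (k : nat), x = (map_poly intr p).[v] / v ^+ k)
          (x \in is_laurent).
Proof. exact: asboolP. Qed.

Lemma is_laurent_subring : subring_closed is_laurent.
Proof.
have v0 k : v ^+ k != 0 by rewrite expf_neq0 // v_neq0.
split.
- by apply/is_laurentP; exists 1, 0%N; rewrite rmorph1 hornerC expr0 divr1.
- move=> _ _ /is_laurentP[p [k ->]] /is_laurentP[q [l ->]].
  apply/is_laurentP; exists (p * 'X^l - q * 'X^k), (k + l)%N.
  rewrite rmorphB !rmorphM /= !map_polyXn hornerD hornerN !hornerM !hornerXn.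
  by rewrite -mulNr addf_div // exprD mulNr.
- move=> _ _ /is_laurentP[p [k ->]] /is_laurentP[q [l ->]].
  apply/is_laurentP; exists (p * q), (k + l)%N.
  by rewrite rmorphM hornerM exprD mulf_div.
Qed.

HB.instance Definition _ :=
  GRing.isSubringClosed.Build Qv is_laurent is_laurent_subring.

Record laurent := Laurent {
  laurent_val : Qv;
  laurent_valP : laurent_val \in is_laurent }.

HB.instance Definition _ := [isSub for laurent_val].
HB.instance Definition _ := [Choice of laurent by <:].
HB.instance Definition _ := [SubChoice_isSubComNzRing of laurent by <:].

Lemma is_laurent_vpow (k : int) : v ^ k \in is_laurent.
Proof.
apply/is_laurentP; case: k => k.
- by exists 'X^k, 0%N; rewrite map_polyXn hornerXn expr0 divr1.
- by exists 1, k.+1; rewrite rmorph1 hornerC div1r NegzE -exprnN.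
Qed.

Definition vpow (k : int) : laurent := Laurent (is_laurent_vpow k).

(* [qbin w a b] is the v-binomial [a; b] with w substituted for v; the bar
   involution v |-> v^-1 turns [qbin v a b] into [qbin v^-1 a b]. *)
Definition qbin (w : Qv) (a : int) (b : nat) : Qv :=
  \prod_(1 <= i < b.+1)
     ((w ^ (2 * (a - i%:Z + 1)) - 1) / (w ^ (2 * i%:Z) - 1)).

Definition qbin_bar (a : int) (b : nat) : Qv := qbin v^-1 a b.
Definition qint_bar (a : int) : Qv := qbin_bar a 1.

(* ---- Matrices ---- *)

Definition centrosymmetric (T : eqType) m (A : 'M[T]_m) : bool :=
  [forall i, forall j, A i j == A (rev_ord i) (rev_ord j)].

(* Xi_d; a matrix over N with entry sum D has all its entries at most D, and
   bounding them in the type makes Xi_d a finType. *)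
Definition Xi (n d : nat) :=
  {A : 'M['I_(d.*2.+2)]_(n.*2.+1) |
    (\sum_i \sum_j A i j == d.*2.+1)%N && centrosymmetric A}.

Definition Xi_mx n d (A : Xi n d) : 'M[int]_(n.*2.+1) :=
  \matrix_(i, j) (val A i j : nat)%:Z.

Definition in_Xit n (A : 'M[int]_(n.*2.+1)) : bool :=
  [&& [forall i, forall j, (i != j) ==> (0 <= A i j)],
      ~~ (2 %| A (inord n) (inord n))%Z & centrosymmetric A].

Definition Xit (n : nat) := {A : 'M[int]_(n.*2.+1) | in_Xit A}.

Definition ro m (A : 'M[int]_m) : 'cV[int]_m := \col_i \sum_j A i j.
Definition co m (A : 'M[int]_m) : 'cV[int]_m := \col_j \sum_i A i j.

Definition Etheta m (i j : 'I_m) : 'M[int]_m :=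
  delta_mx i j + delta_mx (rev_ord i) (rev_ord j).

(* ---- Flags over a finite field and relative positions ---- *)

Section Flags.
Variables (F : finFieldType) (n D : nat).

(* A subspace of F^D is encoded by the unique matrix U with <<U>> = U whose
   row space it is.  J is the Gram matrix of the form on row vectors. *)
Definition perp (J U : 'M[F]_D) : 'M[F]_D := <<kermx (J *m U^T)>>%MS.

Definition flag := {ffun 'I_(n.*2.+2) -> 'M[F]_D}.

Definition isotropic_flags (J : 'M[F]_D) : {set flag} :=
  [set V : flag |
    [&& [forall i, <<V i>>%MS == V i],
        V ord0 == 0,
        V ord_max == <<1%:M>>%MS,
        [forall i : 'I_(n.*2.+2), forall j : 'I_(n.*2.+2),
           (i <= j)%N ==> (V i <= V j)%MS] &
        [forall i, V i == perp J (V (rev_ord i))]]].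

(* For the ordinal i, V_{i-1} and V_i of the mathematics are [V (inord i)] and
   [V (inord i.+1)]. *)
Definition in_orbit d (A : Xi n d) (V V' : flag) : bool :=
  [forall i : 'I_(n.*2.+1), forall j : 'I_(n.*2.+1),
     val A i j ==
       (\rank (V (inord i) + (V (inord i.+1) :&: V' (inord j.+1)))%MS
        - \rank (V (inord i) + (V (inord i.+1) :&: V' (inord j)))%MS)%N :> nat].

End Flags.

(* [g d A A' A''] is a polynomial in one variable u standing for v^2, so that
   its value at v = sqrt q is its value at u = q. *)
Definition structure_polynomials n
    (g : forall d, Xi n d -> Xi n d -> Xi n d -> {poly int}) : Prop :=
  forall (d : nat) (F : finFieldType) (J : 'M[F]_(d.*2.+1)),
    odd #|F| -> J^T = J -> J \in unitmx ->
  forall (A A' A'' : Xi n d) (V1 V2 : flag F n d.*2.+1),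
    V1 \in isotropic_flags n J -> V2 \in isotropic_flags n J ->
    in_orbit A'' V1 V2 ->
  (g d A A' A'').[#|F|%:R] =
    #|[set V in isotropic_flags n J | in_orbit A V1 V && in_orbit A' V V2]|%:R.

(* ---- The Schur algebra and stabilization ---- *)

Section Schur.
Variables (n d : nat) (g : Xi n d -> Xi n d -> Xi n d -> {poly int}).

Definition schur := {ffun Xi n d -> laurent}.

Definition schur_e (A : Xi n d) : schur := [ffun C => (C == A)%:R].

Definition schur_mul (x y : schur) : schur :=
  [ffun C => \sum_A \sum_B
     x A * y B * (map_poly intr (g A B C)).[vpow 1 ^+ 2]].

Definition dimA (A : Xi n d) : nat :=
  (\sum_(i < n.*2.+1) \sum_(j < n.*2.+1) \sum_(k < n.*2.+1) \sum_(l < n.*2.+1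
       | [&& k < i, j < l & i + k < n.*2]) val A i j * val A k l
   + \sum_(i < n.*2.+1) \sum_(j < n.*2.+1) \sum_(l < n.*2.+1
       | (j < l) && ((i < n) || (j + l < n.*2))) val A i j * val A i l
   + \sum_(i < n.*2.+1) \sum_(j < n.*2.+1 | (n <= i) && (j < n))
       (val A i j * (val A i j).-1)./2)%N.

(* The standard basis element [M] for M in Xi_d; only used for such M. *)
Definition schur_std (M : 'M[int]_(n.*2.+1)) : schur :=
  if [pick A : Xi n d | Xi_mx A == M] is Some A
  then [ffun C => vpow (- (dimA A)%:Z) * schur_e A C] else 0.

End Schur.

Definition in_Xi n d (M : 'M[int]_(n.*2.+1)) : bool :=
  [exists A : Xi n d, Xi_mx A == M].

Definition shift2p n (p : nat) (A : Xit n) : 'M[int]_(n.*2.+1) :=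
  val A + (p.*2%:Z)%:M.

Definition composable n (A1 : Xit n) (As : seq (Xit n)) : bool :=
  path (fun A B => co (val A) == ro (val B)) A1 As.

(* The nonempty sequence A_1, ..., A_f is [A1 :: As].  The expansion of the
   product is an identity in the extension of scalars of the Schur algebra to
   Q(v), compared on the coefficients of all e_C. *)
Definition stabilization_data n
    (g : forall d, Xi n d -> Xi n d -> Xi n d -> {poly int})
    (A1 : Xit n) (As : seq (Xit n))
    (m : nat) (Z : 'I_m -> Xit n) (G : 'I_m -> {poly Qv}) : Prop :=
  exists p0 : nat, forall p : nat, (p0 <= p)%N -> exists d : nat,
    [/\ all (fun A => in_Xi d (shift2p p A)) (A1 :: As),
        forall i, in_Xi d (shift2p p (Z i)) &
        forall C : Xi n d,
          laurent_val
            (foldl (@schur_mul n d (g d)) (schur_std d (shift2p p A1))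
               [seq schur_std d (shift2p p A) | A <- As] C)
          = \sum_(i < m) (G i).[v ^- p.*2]
                         * laurent_val (schur_std d (shift2p p (Z i)) C)].

(* ---- The module K and its candidate multiplications ---- *)

Section KAlgebra.
Variable n : nat.

Definition K := {freeg (Xit n) / laurent}.
Definition KQ := {freeg (Xit n) / Qv}.

Definition K_to_KQ (x : K) : KQ :=
  \sum_(A <- dom x) << laurent_val (coeff A x) *g A >>.

(* The basis element [M] for M in Xi~; only used for such M. *)
Definition KQ_basis (M : 'M[int]_(n.*2.+1)) : KQ :=
  if insub M is Some A then << (A : Xit n) >> else 0.

Definition K_basis (A : Xit n) : K := << A >>.

Definition is_associative_algebra (mul : K -> K -> K) : Prop :=
  [/\ forall (c : laurent) x y z, mul (c *: x + y) z = c *: mul x z + mul y z,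
      forall (c : laurent) x y z, mul x (c *: y + z) = c *: mul x y + mul x z &
      forall x y z, mul x (mul y z) = mul (mul x y) z].

Definition K_prod (mul : K -> K -> K) (A1 : Xit n) (As : seq (Xit n)) : K :=
  foldl mul (K_basis A1) [seq K_basis A | A <- As].

Definition given_by_stabilization
    (g : forall d, Xi n d -> Xi n d -> Xi n d -> {poly int})
    (mul : K -> K -> K) : Prop :=
  forall (A1 : Xit n) (As : seq (Xit n)),
    if composable A1 As then
      (exists (m : nat) (Z : 'I_m -> Xit n) (G : 'I_m -> {poly Qv}),
         stabilization_data g A1 As Z G) /\
      (forall (m : nat) (Z : 'I_m -> Xit n) (G : 'I_m -> {poly Qv}),
         stabilization_data g A1 As Z G ->
         K_to_KQ (K_prod mul A1 As) =
           \sum_(i < m) (G i).[1] *: (<< Z i >> : KQ))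
    else K_prod mul A1 As = 0.

(* For h : 'I_n, the rows h and h+1 of the mathematics. *)
Definition row_h (h : 'I_n) : 'I_(n.*2.+1) := inord h.
Definition row_h1 (h : 'I_n) : 'I_(n.*2.+1) := inord h.+1.

(* t ranges over the vectors in N^N with entry sum R; their entries are
   bounded by R. *)
Definition tvec (R : nat) := {ffun 'I_(n.*2.+1) -> 'I_R.+1}.

Section Terms.
Variables (A : 'M[int]_(n.*2.+1)) (h : 'I_n) (R : nat) (t : tvec R).

Local Notation a_h u := (A (row_h h) u).
Local Notation a_h1 u := (A (row_h1 h) u).
Local Notation T u := ((t u : nat)%:Z).

Definition tsum : bool := (\sum_u t u == R)%N.

Definition tdiff : 'M[int]_(n.*2.+1) :=
  \sum_u (Etheta (row_h h) u - Etheta (row_h1 h) u) *+ t u.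

Definition adm1 : bool :=
  if (h.+1 < n)%N then
    [forall u, (u != row_h1 h) ==> (T u <= a_h1 u)]
  else
    [forall u, (u != row_h1 h) ==> (T u + T (rev_ord u) <= a_h1 u)].

Definition adm2 : bool := [forall u, (u != row_h h) ==> (T u <= a_h u)].

Definition beta1 : int :=
  \sum_(j < n.*2.+1) \sum_(l < n.*2.+1 | (j <= l)%N) a_h l * T j
  - \sum_(j < n.*2.+1) \sum_(l < n.*2.+1 | (j < l)%N) a_h1 l * T j
  + \sum_(j < n.*2.+1) \sum_(l < n.*2.+1 | (j < l)%N) T j * T l
  + (if h.+1 == n then
       \sum_(j < n.*2.+1) \sum_(l < n.*2.+1
           | (j < l)%N && (j + l < n.*2)%N) T j * T l
       + \sum_(j < n.*2.+1 | (j < n)%N) ((t j * (t j).+1)./2)%:Z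
     else 0).

Definition beta2 : int :=
  \sum_(j < n.*2.+1) \sum_(l < n.*2.+1 | (l <= j)%N) a_h1 l * T j
  - \sum_(j < n.*2.+1) \sum_(l < n.*2.+1 | (l < j)%N) a_h l * T j
  + \sum_(j < n.*2.+1) \sum_(l < n.*2.+1 | (l < j)%N) T j * T l.

Definition beta3 : int :=
  beta2
  - \sum_(j < n.*2.+1) \sum_(l < n.*2.+1
        | (j < l)%N && (j + l < n.*2)%N) T j * T l
  - \sum_(j < n.*2.+1 | (j < n)%N) ((t j * (t j).-1)./2)%:Z
  + ((R * R.-1)./2)%:Z.

Definition coef1 : Qv := v ^ beta1 * \prod_u qbin_bar (a_h u + T u) (t u).

Definition coef2 : Qv := v ^ beta2 * \prod_u qbin_bar (a_h1 u + T u) (t u).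

Definition coef3 : Qv :=
  v ^ beta3
  * (\prod_(u < n.*2.+1 | (u < n)%N)
        qbin_bar (a_h1 u + T u + T (rev_ord u)) (t u))
  * (\prod_(u < n.*2.+1 | (n < u)%N) qbin_bar (a_h1 u + T u) (t u))
  * (\prod_(0 <= i < t (inord n))
        (qint_bar (A (inord n) (inord n) + 1 + 2 * i%:Z)
         / qint_bar (i%:Z + 1))).

End Terms.

Definition formula1 (mul : K -> K -> K) : Prop :=
  forall (A B : Xit n) (h : 'I_n) (R : nat),
    ro (val A) = co (val B) ->
    is_diag_mx (val B - Etheta (row_h h) (row_h1 h) *+ R) ->
    K_to_KQ (mul (K_basis B) (K_basis A)) =
      \sum_(t : tvec R | tsum t && adm1 (val A) h t)
         coef1 (val A) h t *: KQ_basis (val A + tdiff h t).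

Definition formula2 (mul : K -> K -> K) : Prop :=
  forall (A C : Xit n) (h : 'I_n) (R : nat),
    (h.+1 < n)%N ->
    ro (val A) = co (val C) ->
    is_diag_mx (val C - Etheta (row_h1 h) (row_h h) *+ R) ->
    K_to_KQ (mul (K_basis C) (K_basis A)) =
      \sum_(t : tvec R | tsum t && adm2 (val A) h t)
         coef2 (val A) h t *: KQ_basis (val A - tdiff h t).

Definition formula3 (mul : K -> K -> K) : Prop :=
  forall (A C : Xit n) (h : 'I_n) (R : nat),
    h.+1 = n ->
    ro (val A) = co (val C) ->
    is_diag_mx (val C - Etheta (row_h1 h) (row_h h) *+ R) ->
    K_to_KQ (mul (K_basis C) (K_basis A)) =
      \sum_(t : tvec R | tsum t && adm2 (val A) h t)
         coef3 (val A) h t *: KQ_basis (val A - tdiff h t).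

Definition formula0 (mul : K -> K -> K) : Prop :=
  forall A B : Xit n, co (val B) <> ro (val A) ->
    mul (K_basis B) (K_basis A) = 0.

Definition multiplication_formulas (mul : K -> K -> K) : Prop :=
  [/\ formula0 mul, formula1 mul, formula2 mul & formula3 mul].

End KAlgebra.

(* Main.v *)
Require Import Defs.
From HB Require Import structures.
From mathcomp Require Import all_boot all_order all_fingroup all_algebra all_solvable all_field.
From mathcomp Require Import mxrepresentation mxabelem.
From mathcomp Require Import zify ring lra.
From mathcomp Require Import boolp.
From mathcomp.multinomials Require Import freeg.
Require Import Defs.

Set Implicit Arguments.
Unset Strict Implicit.
Unset Printing Implicit Defensive.

Import Order.TTheory GRing.Theory Num.Theory.
Local Open Scope ring_scope.

(* Let C be a generator, i.e. C - E^theta_{b,a} is diagonal with b = a+1. The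
   structure polynomials for products by e_C count the lines by which a member of
   a flag may be enlarged; they are computed on pairs of coordinate flags, and
   give
     [C][A] = sum_u v^(..) [a_bu + 1] [A + E^theta_{b,u} - E^theta_{a,u}]
   in every Schur algebra, with coefficients that become polynomials in v^(-2p)
   after the shift by 2pI. By induction on sum a_ij (i-j)^2 every [A] is a
   combination of products of generators, so all products stabilize; evaluation at
   large p is injective, so associativity passes from the Schur algebras to the
   limit and then to v' = 1. Coefficients G(v, v^(-2p)) are Laurent polynomials
   for large p, hence for all p by running a linear recurrence backwards, and
   p = 0 is the specialization v' = 1. The formulas for general R follow by
   writing [C_R] as a multiple of [C_1]^R, and uniqueness holds because the
   generators and the diagonal matrices determine all products. *)

(** * Isotropic flags *)

(** Counting is needed only for generators with a single unit just below the diagonal: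
    E^theta_{h,h+1} equals E^theta_{N+1-h,N-h}, so formula (1) describes downward moves in the lower
    half of the rows, and the three formulas are one recursion with different middle-row
    corrections. A structure polynomial is determined by its values, so over each finite field of
    odd order one symmetric form and one pair of flags in each position suffice; this allows a split
    form and coordinate flags. The middle row causes all corrections: there a unit and its mirror
    image lie in the same row, and the added line must be isotropic. The induction divides by a
    leading coefficient in Q(v)[v'], where only constants are invertible; the leading entry is
    therefore chosen off the diagonal, because the shift by 2pI makes only diagonal entries depend
    on v'. Division also leaves Z[v,v^-1], so integrality of the limit needs its own argument,
    whereas uniqueness only cancels nonzero scalars and stays inside K. *)

Section Perp.
Variables (F : finFieldType) (D : nat) (J : 'M[F]_D).
Implicit Types (U W : 'M[F]_D).

Lemma sub_perp m (x : 'M[F]_(m, D)) U :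
  (x <= perp J U)%MS = (x *m J *m U^T == 0).
Proof. by rewrite /perp genmxE; apply/sub_kermxP/eqP; rewrite mulmxA. Qed.

Lemma perp_gen U : <<perp J U>>%MS = perp J U.
Proof. exact: genmx_id. Qed.

Lemma perpS U W : (U <= W)%MS -> (perp J W <= perp J U)%MS.
Proof.
move=> /submxP[X ->]; rewrite sub_perp trmx_mul mulmxA.
by have := submx_refl (perp J W); rewrite {2}/perp sub_perp => /eqP ->; rewrite mul0mx.
Qed.

Lemma perp_eqmx U W : (U :=: W)%MS -> perp J U = perp J W.
Proof.
move=> e; rewrite -perp_gen -(perp_gen W); apply/eq_genmx/eqmxP.
by rewrite !perpS // e.
Qed.

Hypothesis (J_sym : J^T = J) (J_unit : J \in unitmx).

Lemma rank_perp U : \rank (perp J U) = (D - \rank U)%N.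
Proof.
rewrite /perp mxrank_gen mxrank_ker -mxrank_tr trmx_mul trmxK mxrankMfree //.
by rewrite row_free_unit unitmx_tr.
Qed.

Lemma perpK U : perp J (perp J U) = <<U>>%MS.
Proof.
rewrite -perp_gen; apply/esym/eq_genmx/eqmxP/andP.
have sU : (U <= perp J (perp J U))%MS.
  rewrite sub_perp -(inj_eq (@trmx_inj _ _ _)) trmx0 !trmx_mul trmxK J_sym.
  by rewrite mulmxA -sub_perp.
split=> //; rewrite -(geq_leqif (mxrank_leqif_sup sU)) !rank_perp.
by have := rank_leq_col U; lia.
Qed.

(** One inclusion is monotonicity. The other is monotonicity applied to the orthogonal of U^perp +
    W^perp, which lies in both U and W by [perpK]. *)
Lemma perp_cap U W : (perp J (U :&: W)%MS :=: perp J U + perp J W)%MS.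
Proof.
apply/eqmxP/andP; split; last first.
  by rewrite addsmx_sub !perpS // ?capmxSl ?capmxSr.
have h : (perp J (perp J U + perp J W)%MS <= U :&: W)%MS.
  rewrite sub_capmx; apply/andP; split.
    have := perpS (addsmxSl (perp J U) (perp J W)).
    by rewrite perpK (genmxE U).
  have := perpS (addsmxSr (perp J U) (perp J W)).
  by rewrite perpK (genmxE W).
by have := perpS h; rewrite perpK genmxE.
Qed.

End Perp.

Section Flags.
Variables (F : finFieldType) (n D : nat) (J : 'M[F]_D).
Implicit Types (V W : flag F n D).
Local Notation N := (n.*2.+1).

(** Natural-number indices avoid casts between ordinals. Past N the default of [inord] is index 0,
    hence the bounds i <= N below. *)
Definition fl V (i : nat) : 'M[F]_D := V (inord i).

Lemma isotropic_flagP V :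
  reflect [/\ forall i, <<fl V i>>%MS = fl V i, fl V 0 = 0, fl V N = <<1%:M>>%MS,
             forall i j, (i <= j <= N)%N -> (fl V i <= fl V j)%MS &
             forall i, (i <= N)%N -> fl V i = perp J (fl V (N - i))]
          (V \in isotropic_flags n J).
Proof.
have i0 : (inord 0 : 'I_(n.*2.+2)) = ord0 by apply: val_inj; rewrite /= inordK.
have iN : (inord N : 'I_(n.*2.+2)) = ord_max by apply: val_inj; rewrite /= inordK.
rewrite inE; apply: (iffP and5P) => -[h1 h2 h3 h4 h5].
- split.
  + by move=> i; apply/eqP; exact: (forallP h1).
  + by rewrite /fl i0; apply/eqP.
  + by rewrite /fl iN; apply/eqP.
  + move=> i j /andP[ij jN]; have := forallP (forallP h4 (inord i)) (inord j).
    by rewrite !inordK ?ltnS ?(leq_trans ij) // ij.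
  + move=> i iN'; rewrite {1}/fl (eqP (forallP h5 _)); congr (perp J (V _)).
    by apply: val_inj; rewrite /= !inordK; lia.
- split.
  + by apply/forallP=> i; rewrite -[i]inord_val; apply/eqP; exact: h1.
  + by rewrite -i0; apply/eqP.
  + by rewrite -iN; apply/eqP.
  + apply/forallP=> i; apply/forallP=> j; apply/implyP=> ij.
    by rewrite -[i]inord_val -[j]inord_val; apply: h4; rewrite ij -ltnS /=.
  + apply/forallP=> i; rewrite -[X in V X == _]inord_val; apply/eqP.
    rewrite -/(fl V i) h5; last by rewrite -ltnS.
    congr (perp J (V _)); apply: val_inj; rewrite /= !inordK; lia.
Qed.

(** These dimensions carry the same information as the relative position: its entries are their
    second differences. *)
Definition rk V W (i j : nat) : nat := \rank (fl V i :&: fl W j)%MS.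

Variables (V W : flag F n D).
Hypothesis (V_flag : V \in isotropic_flags n J) (W_flag : W \in isotropic_flags n J).

Lemma rk0l j : rk V W 0 j = 0%N.
Proof. by case/isotropic_flagP: V_flag => _ h _ _ _; rewrite /rk h cap0mx mxrank0. Qed.

Lemma rk0r i : rk V W i 0 = 0%N.
Proof. by case/isotropic_flagP: W_flag => _ h _ _ _; rewrite /rk h capmx0 mxrank0. Qed.

Lemma flagS i j : (i <= j <= N)%N -> (fl V i <= fl V j)%MS.
Proof. by case/isotropic_flagP: V_flag => _ _ _ h _; apply: h. Qed.

Lemma rkNr i : rk V W i N = \rank (fl V i).
Proof.
case/isotropic_flagP: W_flag => _ _ h _ _; rewrite /rk h.
by rewrite (cap_eqmx (eqmx_refl _) (genmxE _)) capmx1.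
Qed.

Lemma rkNl j : rk V W N j = \rank (fl W j).
Proof.
case/isotropic_flagP: V_flag => _ _ h _ _; rewrite /rk h.
by rewrite (cap_eqmx (genmxE _) (eqmx_refl _)) cap1mx.
Qed.

(** This is the dimension formula for V_i and V_{i+1} \cap W_j, which meet in V_i \cap W_j. *)
Lemma rank_step i j : (i < N)%N ->
  (\rank (fl V i + (fl V i.+1 :&: fl W j))%MS + rk V W i j
    = \rank (fl V i) + rk V W i.+1 j)%N.
Proof.
move=> iN; rewrite /rk -(mxrank_sum_cap (fl V i)); congr addn; apply/eqP.
rewrite eqn_leq; apply/andP; split; apply: mxrankS.
  rewrite sub_capmx capmxSl sub_capmx capmxSr andbT.
  by apply: submx_trans (capmxSl _ _) _; apply: flagS; rewrite leqnSn.
rewrite sub_capmx capmxSl; apply: submx_trans (capmxSr _ _) _; exact: capmxSr.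
Qed.

Hypothesis (J_sym : J^T = J) (J_unit : J \in unitmx).

(** V_{N-i} + W_{N-j} is the orthogonal of V_i \cap W_j, so the dimension formula relates the two
    intersections. On matrices this becomes centrosymmetry. *)
Lemma rk_dual i j : (i <= N)%N -> (j <= N)%N ->
  (rk V W (N - i) (N - j) + D = \rank (fl V (N - i)) + \rank (fl W (N - j)) + rk V W i j)%N.
Proof.
move=> iN jN.
have /isotropic_flagP[_ _ _ _ hV] := V_flag.
have /isotropic_flagP[_ _ _ _ hW] := W_flag.
have := mxrank_sum_cap (fl V (N - i)) (fl W (N - j)).
have e : (fl V (N - i) + fl W (N - j) :=: perp J (fl V i :&: fl W j))%MS.
  rewrite hV ?leq_subr // hW ?leq_subr // !subKn //.
  by apply/eqmx_sym/perp_cap.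
rewrite e rank_perp // -/(rk V W i j) -/(rk V W _ _).
have := rank_leq_col (fl V i :&: fl W j)%MS; rewrite -/(rk V W i j); lia.
Qed.

Lemma rank_flag_dual i : (i <= N)%N -> (\rank (fl V (N - i)) + \rank (fl V i) = D)%N.
Proof.
move=> iN; have /isotropic_flagP[_ _ _ _ hV] := V_flag.
rewrite hV ?leq_subr // subKn // rank_perp // subnK //; exact: rank_leq_col.
Qed.

End Flags.

(** * Relative positions *)

Section MatrixSums.
Variable m : nat.
Implicit Types M X : 'M[int]_m.

Lemma centrosymmetricE M i j : centrosymmetric M -> M (rev_ord i) (rev_ord j) = M i j.
Proof. by move=> /forallP/(_ i)/forallP/(_ j)/eqP. Qed.

Lemma mxBE M M' i j : (M - M') i j = M i j - M' i j.
Proof. by rewrite !mxE. Qed.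

Lemma mxDE M M' i j : (M + M') i j = M i j + M' i j.
Proof. by rewrite !mxE. Qed.

Lemma centrosymmetricD M M' : centrosymmetric M -> centrosymmetric M' -> centrosymmetric (M + M').
Proof.
move=> cX cY; apply/forallP=> i; apply/forallP=> j.
by rewrite mxE [X in _ == X]mxE !centrosymmetricE.
Qed.

Lemma centrosymmetricN M : centrosymmetric M -> centrosymmetric (- M).
Proof.
move=> cX; apply/forallP=> i; apply/forallP=> j.
by rewrite mxE [X in _ == X]mxE centrosymmetricE.
Qed.

Lemma centrosymmetricMn M k : centrosymmetric M -> centrosymmetric (M *+ k).
Proof.
move=> cX; apply/forallP=> i; apply/forallP=> j.
by rewrite !mulmxnE centrosymmetricE.
Qed.

Lemma centrosymmetric_Etheta (x y : 'I_m) : centrosymmetric (Etheta x y).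
Proof.
apply/forallP=> i; apply/forallP=> j; rewrite /Etheta !mxE.
by rewrite !(can2_eq rev_ordK rev_ordK) !rev_ordK addrC.
Qed.

Lemma roD M M' : ro (M + M') = ro M + ro M'.
Proof.
by apply/matrixP=> i j; rewrite !mxE -big_split; apply: eq_bigr => k _; rewrite !mxE.
Qed.

Lemma roB M M' : ro (M - M') = ro M - ro M'.
Proof. by apply/eqP; rewrite eq_sym subr_eq -roD subrK. Qed.

Lemma coD M M' : co (M + M') = co M + co M'.
Proof.
by apply/matrixP=> i j; rewrite !mxE -big_split; apply: eq_bigr => k _; rewrite !mxE.
Qed.

Lemma coB M M' : co (M - M') = co M - co M'.
Proof. by apply/eqP; rewrite eq_sym subr_eq -coD subrK. Qed.

Lemma coMn M k : co (M *+ k) = co M *+ k.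
Proof.
elim: k => [|k IH]; last by rewrite !mulrS coD IH.
by rewrite !mulr0n; apply/matrixP=> i j; rewrite !mxE big1 // => l _; rewrite mxE.
Qed.

Lemma roMn M k : ro (M *+ k) = ro M *+ k.
Proof.
elim: k => [|k IH]; last by rewrite !mulrS roD IH.
by rewrite !mulr0n; apply/matrixP=> i j; rewrite !mxE big1 // => l _; rewrite mxE.
Qed.

Lemma ro_Etheta (x y : 'I_m) : ro (Etheta x y) = delta_mx x 0 + delta_mx (rev_ord x) 0.
Proof.
have h r s : ro (delta_mx r s : 'M[int]_m) = delta_mx r 0.
  apply/matrixP=> i j; rewrite !mxE (bigD1 s) //= !mxE eqxx (ord1 j) eqxx andbT big1 ?addr0 //.
  by move=> k /negbTE ks; rewrite mxE ks andbF.
by rewrite /Etheta roD !h.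
Qed.

Lemma co_Etheta (x y : 'I_m) : co (Etheta x y) = delta_mx y 0 + delta_mx (rev_ord y) 0.
Proof.
have h r s : co (delta_mx r s : 'M[int]_m) = delta_mx s 0.
  apply/matrixP=> i j; rewrite !mxE (bigD1 r) //= !mxE eqxx (ord1 j) eqxx andbT big1 ?addr0 //.
  by move=> k /negbTE ks; rewrite mxE ks.
by rewrite /Etheta coD !h.
Qed.

Lemma ro_diag X : is_diag_mx X -> ro X = co X.
Proof.
move=> /is_diag_mxP dX; apply/matrixP=> i j; rewrite !mxE.
rewrite (bigD1 i) //= [RHS](bigD1 i) //=; congr (_ + _); rewrite !big1 // => k ki.
  by apply: dX.
by apply: dX; rewrite eq_sym.
Qed.

Lemma ro_offdiag M X : is_diag_mx (M - X) -> ro M = co M + (ro X - co X).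
Proof. by move/ro_diag; rewrite roB coB => /eqP; rewrite subr_eq => /eqP ->; rewrite addrAC addrA. Qed.

Lemma diag_part_uniq M M' X : is_diag_mx (M - X) -> is_diag_mx (M' - X) -> co M = co M' -> M = M'.
Proof.
move=> /is_diag_mxP dM /is_diag_mxP dM' e.
have off i j : i != j -> M i j = M' i j.
  move=> ij; have := dM i j ij; have := dM' i j ij; rewrite !mxBE; lia.
apply/matrixP=> i j; have [ij|] := eqVneq i j; last exact: off.
have := congr1 (fun w : 'cV[int]_m => w j 0) e; rewrite !mxE (bigD1 j) //= [in RHS](bigD1 j) //= ij.
rewrite [X in _ + X = _ -> _](eq_bigr (fun k => M' k j)); first exact: addIr.
by move=> k kj; apply: off.
Qed.

End MatrixSums.

Section Cumulative.
Variable m : nat.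
Implicit Types M : 'M[int]_m.

(** For the relative position of V and W these rectangular sums are the dimensions of V_i \cap W_j,
    so statements about positions become statements about [cum]. *)
Definition cum M (i j : nat) : int :=
  \sum_(a < m | (a < i)%N) \sum_(b < m | (b < j)%N) M a b.

Lemma cumD M M' i j : cum (M + M') i j = cum M i j + cum M' i j.
Proof.
rewrite /cum -big_split; apply: eq_bigr => a _ /=.
by rewrite -big_split; apply: eq_bigr => b _; rewrite !mxE.
Qed.

Lemma cumB M M' i j : cum (M - M') i j = cum M i j - cum M' i j.
Proof.
rewrite /cum -sumrB; apply: eq_bigr => a _.
by rewrite -sumrB; apply: eq_bigr => b _; rewrite !mxE.
Qed.

Lemma cum_delta (a b : 'I_m) i j : cum (delta_mx a b) i j = ((a < i) && (b < j))%N%:R.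
Proof.
rewrite /cum; case: (ltnP a i) => ai; last first.
  apply: big1 => x xi; apply: big1 => y _; rewrite mxE.
  by have -> : (x == a) = false by apply/eqP=> e; move: xi; rewrite e ltnNge ai.
rewrite (bigD1 a) //= [X in _ + X]big1 ?addr0; last first.
  by move=> x /andP[_ /negbTE xa]; apply: big1 => y _; rewrite mxE xa.
case: (ltnP b j) => bj; last first.
  apply: big1 => y yj; rewrite mxE.
  have -> : (y == b) = false by apply/eqP=> e; move: yj; rewrite e ltnNge bj.
  by rewrite andbF.
rewrite (bigD1 b) //= [X in _ + X]big1 ?addr0 ?mxE ?eqxx //.
by move=> y /andP[_ /negbTE yb]; rewrite mxE yb andbF.
Qed.

Lemma cum0l M j : cum M 0 j = 0.
Proof. by rewrite /cum big_pred0. Qed.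

Lemma cum0r M i : cum M i 0 = 0.
Proof. by rewrite /cum big1 // => a _; rewrite big_pred0. Qed.

Lemma cumSl M (i : 'I_m) j : cum M i.+1 j = cum M i j + \sum_(b < m | (b < j)%N) M i b.
Proof.
rewrite /cum (bigD1 i) //= addrC; congr (_ + _); apply: eq_bigl => a.
by rewrite ltnS ltn_neqAle andbC.
Qed.

Lemma cumSS M (i j : 'I_m) :
  M i j = cum M i.+1 j.+1 - cum M i j.+1 - cum M i.+1 j + cum M i j.
Proof.
rewrite !cumSl (bigD1 j) //=.
have -> : \sum_(b < m | (b < j.+1)%N && (b != j)) M i b = \sum_(b < m | (b < j)%N) M i b.
  by apply: eq_bigl => b; rewrite ltnS ltn_neqAle andbC.
ring.
Qed.

Lemma cum_unique M (f : nat -> nat -> int) :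
  (forall j, f 0%N j = 0) -> (forall i, f i 0%N = 0) ->
  (forall i j : 'I_m, M i j = f i.+1 j.+1 - f i j.+1 - f i.+1 j + f i j) ->
  forall i j, (i <= m)%N -> (j <= m)%N -> cum M i j = f i j.
Proof.
move=> f0l f0r fM i j; elim: i j => [|i IHi] j im jm; first by rewrite cum0l f0l.
elim: j jm => [|j IHj] jm; first by rewrite cum0r f0r.
have := cumSS M (Ordinal im) (Ordinal jm).
by rewrite fM /= IHj ?IHi //; lia.
Qed.

Lemma cum_inj M M' :
  (forall i j, (i <= m)%N -> (j <= m)%N -> cum M i j = cum M' i j) -> M = M'.
Proof.
by move=> e; apply/matrixP=> i j; rewrite !cumSS !e // ltnW.
Qed.

Lemma cum_ro M i : cum M i m = \sum_(a < m | (a < i)%N) ro M a 0.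
Proof.
apply: eq_bigr => a _; rewrite mxE; apply: eq_bigl => b; by rewrite ltn_ord.
Qed.

Lemma cum_co M j : cum M m j = \sum_(b < m | (b < j)%N) co M b 0.
Proof.
rewrite /cum exchange_big; apply: eq_bigr => a _; rewrite mxE.
by apply: eq_bigl => b; rewrite ltn_ord.
Qed.

Lemma ro_cumE M i : ro M i 0 = cum M i.+1 m - cum M i m.
Proof. by rewrite cumSl addrC addKr mxE; apply: eq_bigl => b; rewrite ltn_ord. Qed.

Lemma co_cumE M i : co M i 0 = cum M m i.+1 - cum M m i.
Proof.
rewrite !cum_co (bigD1 i) //= [X in _ - X](eq_bigl (fun b : 'I_m => (b < i.+1)%N && (b != i))).
  by rewrite addrK.
by move=> b; rewrite ltnS ltn_neqAle andbC.
Qed.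

Lemma cum_total M : cum M m m = \sum_i \sum_j M i j.
Proof.
apply: eq_big => [i|i _]; first by rewrite ltn_ord.
by apply: eq_bigl => j; rewrite ltn_ord.
Qed.

(** The hypothesis is the form in which [rk_dual] delivers the symmetry; taking second differences
    of it gives the entries. *)
Lemma centrosymmetric_cum M :
  (forall i j, (i <= m)%N -> (j <= m)%N ->
     cum M (m - i) (m - j) + cum M m m = cum M (m - i) m + cum M m (m - j) + cum M i j) ->
  centrosymmetric M.
Proof.
move=> h; apply/forallP=> i; apply/forallP=> j; apply/eqP; rewrite !cumSS /=.
have h4 (a b : nat) : (a <= m)%N -> (b <= m)%N -> cum M a b =
   cum M (m - a) (m - b) + cum M m m - cum M (m - a) m - cum M m (m - b).
  by move=> am bm; rewrite h // ; ring.
rewrite (h4 i.+1 j.+1) // (h4 i j.+1) ?(h4 i.+1 j) ?(h4 i j) ?(ltnW (ltn_ord _)) //.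
have -> : (m - i = (m - i.+1).+1)%N by have := ltn_ord i; lia.
have -> : (m - j = (m - j.+1).+1)%N by have := ltn_ord j; lia.
ring.
Qed.

End Cumulative.

Section RelPos.
Variables (F : finFieldType) (n d : nat) (J : 'M[F]_(d.*2.+1)).
Local Notation N := (n.*2.+1).
Local Notation flagT := (flag F n d.*2.+1).
Implicit Types (V W : flagT) (A : Xi n d).

Lemma rk_second_difference V W (i j : 'I_N) :
  V \in isotropic_flags n J -> W \in isotropic_flags n J ->
  (\rank (fl V i + (fl V i.+1 :&: fl W j.+1))%MS
    - \rank (fl V i + (fl V i.+1 :&: fl W j))%MS)%N%:Z
  = (rk V W i.+1 j.+1)%:Z - (rk V W i j.+1)%:Z - (rk V W i.+1 j)%:Z + (rk V W i j)%:Z.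
Proof.
move=> Vf Wf.
have s1 := rank_step W Vf j.+1 (ltn_ord i).
have s2 := rank_step W Vf j (ltn_ord i).
have jN := ltn_ord j.
have s3 : (\rank (fl V i + (fl V i.+1 :&: fl W j))%MS <=
           \rank (fl V i + (fl V i.+1 :&: fl W j.+1))%MS)%N.
  apply: mxrankS; apply: addsmxS => //; apply: capmxS => //.
  by apply: (flagS Wf); lia.
lia.
Qed.

Lemma in_orbitP V W A : V \in isotropic_flags n J -> W \in isotropic_flags n J ->
  reflect (forall i j, (i <= N)%N -> (j <= N)%N -> (rk V W i j)%:Z = cum (Xi_mx A) i j)
          (in_orbit A V W).
Proof.
move=> Vf Wf; apply: (iffP forallP) => [h i j iN jN|h i].
- apply/esym; apply: (cum_unique (f := fun i j => (rk V W i j)%:Z)) => //.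
  + by move=> ?; rewrite (rk0l _ Vf).
  + by move=> ?; rewrite (rk0r _ Wf).
  + move=> i' j'; rewrite -rk_second_difference // mxE; congr Posz.
    by have /forallP/(_ j')/eqP -> := h i'.
- apply/forallP=> j; rewrite -eqz_nat; apply/eqP.
  rewrite -!/(fl _ _) rk_second_difference // !h;
    try by have := ltn_ord i; have := ltn_ord j; lia.
  by rewrite -cumSS mxE.
Qed.

Lemma rank_flag_ro V W A i : V \in isotropic_flags n J -> W \in isotropic_flags n J ->
  in_orbit A V W -> (i <= N)%N -> (\rank (fl V i))%:Z = cum (Xi_mx A) i N.
Proof. by move=> Vf Wf /(in_orbitP _ Vf Wf) h iN; rewrite -h // (rkNr _ Wf). Qed.

Lemma rank_flag_co V W A i : V \in isotropic_flags n J -> W \in isotropic_flags n J ->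
  in_orbit A V W -> (i <= N)%N -> (\rank (fl W i))%:Z = cum (Xi_mx A) N i.
Proof. by move=> Vf Wf /(in_orbitP _ Vf Wf) h iN; rewrite -h // (rkNl _ Vf). Qed.

Hypothesis (J_sym : J^T = J) (J_unit : J \in unitmx).

Lemma relpos_exists V W : V \in isotropic_flags n J -> W \in isotropic_flags n J ->
  exists A : Xi n d, in_orbit A V W.
Proof.
move=> Vf Wf.
have bnd (i j : 'I_N) :
  (\rank (fl V i + (fl V i.+1 :&: fl W j.+1))%MS
    - \rank (fl V i + (fl V i.+1 :&: fl W j))%MS < d.*2.+2)%N.
  by have := rank_leq_col (fl V i + (fl V i.+1 :&: fl W j.+1))%MS; lia.
pose A := \matrix_(i < N, j < N) Ordinal (bnd i j).
pose M : 'M[int]_N := \matrix_(i, j) (A i j : nat)%:Z.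
have cumM i j : (i <= N)%N -> (j <= N)%N -> cum M i j = (rk V W i j)%:Z.
  apply: (cum_unique (f := fun i j => (rk V W i j)%:Z)) => //.
  + by move=> ?; rewrite (rk0l _ Vf).
  + by move=> ?; rewrite (rk0r _ Wf).
  + by move=> i' j'; rewrite -rk_second_difference // !mxE.
have rkNN : rk V W N N = d.*2.+1.
  rewrite (rkNr _ Wf).
  by case/isotropic_flagP: Vf => _ _ -> _ _; rewrite mxrank_gen mxrank1.
have hA : ((\sum_i \sum_j A i j == d.*2.+1)%N && centrosymmetric A).
  apply/andP; split.
    rewrite -eqz_nat -[X in _ == X%:Z]rkNN -cumM // cum_total (big_morph Posz PoszD (erefl _)).
    apply/eqP/eq_bigr => i _; rewrite (big_morph Posz PoszD (erefl _)).
    by apply: eq_bigr => j _; rewrite [RHS]mxE.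
  suff : centrosymmetric M.
    move=> /forallP h; apply/forallP=> i; apply/forallP=> j.
    have /forallP/(_ j)/eqP := h i; rewrite ![M _ _]mxE => -[e].
    by apply/eqP/val_inj.
  apply: centrosymmetric_cum => i j iN jN; rewrite !cumM ?leq_subr // rkNN.
  have := rk_dual Vf Wf J_sym J_unit iN jN.
  rewrite (rkNr _ Wf) (rkNl _ Vf); lia.
exists (exist _ A hA); apply/(in_orbitP _ Vf Wf) => i j iN jN.
by rewrite -cumM //; congr cum; apply/matrixP=> x y; rewrite !mxE.
Qed.

Lemma in_orbit_inj V W A B : in_orbit A V W -> in_orbit B V W -> A = B.
Proof.
move=> /forallP hA /forallP hB; apply: val_inj; apply/matrixP=> i j.
apply: val_inj; rewrite /=.
by rewrite (eqP (forallP (hA i) j)) (eqP (forallP (hB i) j)).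
Qed.

End RelPos.

Section Adjacent.
Variables (m : nat) (a b : 'I_m).
Hypothesis ab : b = a.+1 :> nat.

(** A unit moved between the adjacent rows a and b is seen only by rectangles ending between them,
    and its mirror image only by those ending at the mirrored place. This is why an adjacent flag
    differs at steps b and N-b alone. *)
Lemma cum_Etheta_diff (u : 'I_m) i j :
  cum (Etheta a u - Etheta b u) i j =
    ((i == b) && (u < j))%N%:R - ((i == m - b) && (m - u.+1 < j))%N%:R.
Proof.
have hb := ltn_ord b; have ha := ltn_ord a.
rewrite cumB /Etheta !cumD !cum_delta /= ab.
have -> : (i == a.+1)%N = (a < i)%N && ~~ (a.+1 < i)%N by lia.
have -> : (i == m - a.+1)%N = (m - a.+2 < i)%N && ~~ (m - a.+1 < i)%N by lia.
have : (a.+1 < i)%N -> (a < i)%N by lia.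
have : (m - a.+1 < i)%N -> (m - a.+2 < i)%N by lia.
generalize (a < i)%N (a.+1 < i)%N (m - a.+2 < i)%N (m - a.+1 < i)%N (u < j)%N (m - u.+1 < j)%N.
by do 6!case=> //=; do ?[move=> /(_ isT) // _ | move=> /(_ isT) // | move=> _].
Qed.

Lemma cum_diag (M : 'M[int]_m) i j : is_diag_mx M -> (i <= m)%N -> (j <= m)%N ->
  cum M i j = cum M (minn i j) m.
Proof.
move=> /is_diag_mxP dM im jm.
have e p q : cum M p q = \sum_(x < m | (x < minn p q)%N) M x x.
  rewrite /cum [RHS](eq_bigl (fun x : 'I_m => (x < p)%N && (x < q)%N)); last first.
    by move=> x; rewrite leq_min.
  rewrite [RHS]big_mkcondr; apply: eq_bigr => x _.
  case: ifP => xq; last first.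
    by apply: big1 => y yq; apply: dM; apply: contraFN xq => /eqP ->.
  rewrite (bigD1 x) //= [X in _ + X]big1 ?addr0 // => y /andP[_ yx].
  by apply: dM; rewrite eq_sym.
by rewrite [LHS]e [RHS]e; apply: eq_bigl => x; rewrite !leq_min ltn_ord andbT.
Qed.

(** For flags in this position, [cum M i j = cum M i m] means that V_i is contained in W_j, and
    [cum M i j = cum M m j] that W_j is contained in V_i. The last clause compares the dimensions of
    W_i and V_i. *)
Lemma cum_Etheta_step i j (M : 'M[int]_m) :
  odd m -> is_diag_mx (M - Etheta b a) -> (i <= m)%N -> (j <= m)%N ->
  [/\ (i <= j)%N -> ~~ ((i == m - b) && (j == m - b))%N -> cum M i j = cum M i m,
      (i == m - b)%N -> (j == m - b)%N -> cum M i j = cum M m j,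
      (j < i)%N -> cum M i j = cum M m j &
      cum M m i = cum M i m + (i == b)%:R - (i == m - b)%N%:R].
Proof.
move=> om dM im jm; have hb := ltn_ord b.
have e p q : (p <= m)%N -> (q <= m)%N -> cum M p q = cum (M - Etheta b a) (minn p q) m
    + (b < p)%N%:R * (a < q)%N%:R + (m - b.+1 < p)%N%:R * (m - b < q)%N%:R.
  move=> pm qm; rewrite -cum_diag // cumB /Etheta cumD !cum_delta /= -ab -!natrM !mulnb; ring.
have mm := leqnn m.
have [ha1 ha2] : ((a < m)%N = true /\ (m - b < m)%N = true) by split; lia.
have [hb1 hb2] : ((b < m)%N = true /\ (m - b.+1 < m)%N = true) by split; lia.
rewrite !e // (minn_idPr im) (minn_idPl im) (minn_idPr jm) ha1 ha2 hb1 hb2.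
(* As m is odd, no step is its own mirror image. *)
have nb : (m - b != b)%N by apply/eqP=> h; move: om; rewrite -(subnK (ltnW hb)) h addnn odd_double.
split.
- move=> ij hn; rewrite (minn_idPl ij); lia.
- move=> i1 j1; rewrite (eqP i1) (eqP j1) minnn; lia.
- move=> ij; rewrite (minn_idPr (ltnW ij)); lia.
- lia.
Qed.

End Adjacent.

(** * Flags differing in one step *)

Section AdjacentFlags.
Variables (F : finFieldType) (n d : nat) (J : 'M[F]_(d.*2.+1)).
Local Notation N := (n.*2.+1).
Local Notation flagT := (flag F n d.*2.+1).
Implicit Types (V W : flagT) (A C : Xi n d).
Hypothesis (J_sym : J^T = J) (J_unit : J \in unitmx).
Variables (a b : 'I_N).
Hypothesis ab : b = a.+1 :> nat.

Lemma capmx_full m1 m2 (A : 'M[F]_(m1, d.*2.+1)) (B : 'M_(m2, d.*2.+1)) :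
  \rank (A :&: B)%MS = \rank A -> (A <= B)%MS.
Proof.
move=> e; apply: submx_trans (capmxSr A B).
by rewrite -(geq_leqif (mxrank_leqif_sup (capmxSl A B))) e.
Qed.

Lemma flag_eq V W i : V \in isotropic_flags n J -> W \in isotropic_flags n J ->
  (fl V i <= fl W i)%MS -> \rank (fl V i) = \rank (fl W i) -> fl V i = fl W i.
Proof.
move=> /isotropic_flagP[gV _ _ _ _] /isotropic_flagP[gW _ _ _ _] s e.
rewrite -gV -gW; apply/eq_genmx/eqmxP.
by rewrite s -(geq_leqif (mxrank_leqif_sup s)) e /=.
Qed.

(** Each partial sum of C equals dim V_i or dim W_j, so being in position C amounts to inclusions
    between members of the two flags. What happens at step N-b follows from step b by duality. *)
Lemma in_orbit_adjacentP V W C :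
  V \in isotropic_flags n J -> W \in isotropic_flags n J ->
  is_diag_mx (Xi_mx C - Etheta b a) ->
  (forall i, (i <= N)%N -> (\rank (fl V i))%:Z = cum (Xi_mx C) i N) ->
  reflect [/\ (fl V b <= fl W b)%MS, \rank (fl W b) = (\rank (fl V b)).+1 &
              forall i, (i <= N)%N -> i != b -> i != (N - b)%N -> fl W i = fl V i]
          (in_orbit C V W).
Proof.
move=> Vf Wf dC rC; have bN := ltn_ord b.
have oN : odd N by rewrite /= odd_double.
have nb : (N - b != b)%N by apply/eqP=> h; move: oN; rewrite -(subnK (ltnW bN)) h addnn odd_double.
apply: (iffP (in_orbitP _ Vf Wf)) => [h|[sb rb hV]].
- have rW i : (i <= N)%N -> (\rank (fl W i))%:Z = cum (Xi_mx C) N i.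
    by move=> iN; rewrite -h // (rkNl _ Vf).
  have rkii i : (i <= N)%N -> i != (N - b)%N -> (fl V i <= fl W i)%MS.
    move=> iN ib; apply: capmx_full; apply/eqP; rewrite -eqz_nat; apply/eqP.
    rewrite -/(rk V W i i) h // rC //.
    by have [-> //] := cum_Etheta_step ab oN dC iN iN; rewrite ?leqnn // (negbTE ib).
  split.
  + by apply: rkii; [exact: ltnW | rewrite eq_sym].
  + have := rW b (ltnW bN).
    have [_ _ _ ->] := cum_Etheta_step ab oN dC (ltnW bN) (leqnn N).
    rewrite -rC ?(ltnW bN) // eqxx eq_sym (negbTE nb); lia.
  + move=> i iN ib iNb; apply/esym/(flag_eq Vf Wf); first exact: rkii.
    apply/eqP; rewrite -eqz_nat; apply/eqP; rewrite rW // rC //.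
    have [_ _ _ ->] := cum_Etheta_step ab oN dC iN iN.
    by rewrite (negbTE ib) (negbTE iNb) addr0 subr0.
- have subVW i : (i <= N)%N -> i != (N - b)%N -> (fl V i <= fl W i)%MS.
    by move=> iN ib; have [->|ib'] := eqVneq i (b : nat); [|rewrite hV].
  have dualb : fl W (N - b) = perp J (fl W b) /\ fl V (N - b) = perp J (fl V b).
    case/isotropic_flagP: Vf => _ _ _ _ ->; rewrite ?leq_subr //.
    case/isotropic_flagP: Wf => _ _ _ _ ->; rewrite ?leq_subr //.
    by rewrite subKn ?(ltnW bN).
  have subWV i : (i <= N)%N -> i != b -> (fl W i <= fl V i)%MS.
    move=> iN ib; have [->|ib'] := eqVneq i (N - b)%N; last by rewrite hV.
    by case: dualb => -> ->; apply: perpS.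
  have rW i : (i <= N)%N -> (\rank (fl W i))%:Z = cum (Xi_mx C) N i.
    move=> iN; have [_ _ _ ->] := cum_Etheta_step ab oN dC iN iN; rewrite -rC //.
    have [->|ib] := eqVneq i b.
      by rewrite rb eq_sym (negbTE nb); lia.
    have [->|ib'] := eqVneq i (N - b)%N; last by rewrite hV // addr0 subr0.
    case: dualb => -> ->; rewrite !rank_perp // rb addr0.
    have := rank_leq_col (fl W b); rewrite rb; lia.
  move=> i j iN jN.
  have [h1 h2 h3 _] := cum_Etheta_step ab oN dC iN jN.
  have [ij|ij] := leqP i j; last first.
    rewrite h3 // -rW //; congr Posz; rewrite /rk; apply/eqP.
    have s : (fl W j <= fl V i)%MS.
      have [jb|jb] := eqVneq j b; last first.
        by apply: submx_trans (subWV _ jN jb) _; apply: (flagS Vf); rewrite iN ltnW.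
      (* At j = b the inclusion of W_j in V_j fails, so the chain passes through index b+1, which is
         still at most i. *)
      have jN' : (j.+1 <= N)%N by rewrite jb.
      have jb1 : j.+1 != b by rewrite jb neq_ltn ltnSn orbT.
      apply: submx_trans (flagS Wf (i := j) (j := j.+1) _) _; first by rewrite leqnSn.
      apply: submx_trans (subWV _ jN' jb1) _.
      by apply: (flagS Vf); rewrite ij iN.
    rewrite eqn_leq mxrankS ?capmxSr //= mxrankS // sub_capmx s submx_refl //.
  have [/andP[i1 j1]|hn] := boolP ((i == (N - b)%N) && (j == (N - b)%N)).
    rewrite h2 // -rW //; congr Posz; rewrite /rk; apply/eqP.
    rewrite eqn_leq mxrankS ?capmxSr //= mxrankS // sub_capmx submx_refl andbT.
    by rewrite (eqP i1) (eqP j1); apply: subWV => //; rewrite leq_subr.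
  rewrite h1 // -rC //; congr Posz; rewrite /rk; apply/eqP.
  have s : (fl V i <= fl W j)%MS.
    have [jb|jb] := eqVneq j (N - b)%N; last first.
      by apply: submx_trans (flagS Vf (j := j) _) (subVW _ jN jb); rewrite ij.
    have lij : (i < j)%N by rewrite ltn_neqAle ij andbT; apply: contra hn => /eqP ->; rewrite jb eqxx.
    have j1N : (j.-1 <= N)%N by lia.
    have jb1 : j.-1 != (N - b)%N by apply/eqP; lia.
    apply: submx_trans (flagS Vf (j := j.-1) _) _; first by lia.
    apply: submx_trans (subVW _ j1N jb1) _.
    by apply: (flagS Wf); lia.
  by rewrite eqn_leq mxrankS ?capmxSl //= mxrankS // sub_capmx s submx_refl.
Qed.

End AdjacentFlags.

Ltac nat_lia := repeat match goal with
  | H : is_true (in_mem _ _) |- _ => clear H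
  | H : is_true (submx _ _) |- _ => clear H
  | H : is_true (~~ submx _ _) |- _ => clear H
  | H : is_true (in_orbit _ _ _) |- _ => clear H
  | H : is_true (is_diag_mx _) |- _ => clear H
  | H : @eq (matrix _ _ _) _ _ |- _ => clear H
  end; lia.

Section AddLine.
Variables (F : finFieldType) (D : nat).
Implicit Types (U W : 'M[F]_D) (x : 'rV[F]_D).

Lemma rank_add_line U x : ~~ (x <= U)%MS -> \rank (U + x)%MS = (\rank U).+1.
Proof.
move=> xU; apply/eqP; rewrite eqn_leq; apply/andP; split.
  apply: leq_trans (mxrank_adds_leqif U x) _.
  by have := rank_leq_row x; lia.
apply: rank_ltmx; rewrite ltmxE addsmxSl /=.
by apply: contra xU; apply: submx_trans; apply: addsmxSr.
Qed.

Lemma card_row_vectors m (U : 'M[F]_(m, D)) :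
  #|[set x : 'rV_D | (x <= U)%MS]| = (#|F| ^ \rank U)%N.
Proof. by rewrite -card_rowg; apply: eq_card => x; rewrite !inE. Qed.

Lemma card_row_vectorsD U W : (U <= W)%MS ->
  #|[set x : 'rV_D | (x <= W)%MS && ~~ (x <= U)%MS]| = (#|F| ^ \rank W - #|F| ^ \rank U)%N.
Proof.
move=> UW; rewrite -!card_row_vectors -cardsDS.
  by apply: eq_card => x; rewrite !inE andbC.
by apply/subsetP=> x; rewrite !inE => /submx_trans; apply.
Qed.

(* Counting the flags adjacent to a given one *)
End AddLine.

Section CountAdjacent.
Variables (F : finFieldType) (n d : nat) (J : 'M[F]_(d.*2.+1)).
Local Notation N := (n.*2.+1).
Local Notation flagT := (flag F n d.*2.+1).
Hypothesis (J_sym : J^T = J) (J_unit : J \in unitmx).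
Variables (a b u : 'I_N) (V W : flagT) (A B C : Xi n d).
Hypothesis ab : b = a.+1 :> nat.
Hypotheses (Vf : V \in isotropic_flags n J) (Wf : W \in isotropic_flags n J).
Hypothesis BVW : in_orbit B V W.
Hypothesis dC : is_diag_mx (Xi_mx C - Etheta b a).
Hypothesis roC : ro (Xi_mx C) = ro (Xi_mx B).
Hypothesis AB : Xi_mx A = Xi_mx B + (Etheta a u - Etheta b u).

(* A flag adjacent to V at step b is [step_flag x] for a line x; its position
   relative to W is decided by the first j with x in [step_space j], and x must
   be an isotropic vector when V_b is the largest isotropic member of V. *)
Definition step_space (j : nat) : 'M[F]_(d.*2.+1) := (fl V b + (fl V b.+1 :&: fl W j))%MS.
Local Notation P := step_space.

Definition step_vectors : {set 'rV[F]_(d.*2.+1)} :=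
  [set x | [&& (x <= P u.+1)%MS, ~~ (x <= P u)%MS & (b == n :> nat) ==> (x *m J *m x^T == 0)]].

Definition step_flag (x : 'rV[F]_(d.*2.+1)) : flagT :=
  [ffun i : 'I_(n.*2.+2) => if i == inord b then <<(fl V b + x)%MS>>%MS
     else if i == inord (N - b) then perp J (fl V b + x)%MS else V i].

Let bN : (b < N)%N := ltn_ord b.

Let nb : (N - b != b)%N.
Proof.
by have := ltn_ord b; nat_lia.
Qed.

Let nbF : (b == N - b :> nat)%N = false.
Proof. by rewrite eq_sym (negbTE nb). Qed.

Let BP : forall i j, (i <= N)%N -> (j <= N)%N -> (rk V W i j)%:Z = cum (Xi_mx B) i j.
Proof. by apply/(in_orbitP _ Vf Wf). Qed.

Lemma fl_step_flag x i : (i <= N)%N -> fl (step_flag x) i =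
  if i == b then <<(fl V b + x)%MS>>%MS
  else if i == (N - b)%N then perp J (fl V b + x)%MS else fl V i.
Proof.
move=> iN; rewrite /fl ffunE -!(inj_eq val_inj) /= !inordK ?ltnS ?leq_subr //; last nat_lia.
Qed.

Lemma rank_step_space j : (\rank (P j) + rk V W b j = \rank (fl V b) + rk V W b.+1 j)%N.
Proof. exact: (rank_step W Vf j bN). Qed.

Let Vb_sub : (fl V b <= fl V b.+1)%MS.
Proof. by apply: (flagS Vf); rewrite leqnSn. Qed.

Lemma step_spaceS i j : (i <= j <= N)%N -> (P i <= P j)%MS.
Proof. by move=> ij; apply: addsmxS => //; apply: capmxS => //; apply: (flagS Wf). Qed.

Lemma step_space_le j : (P j <= fl V b.+1)%MS.
Proof. by rewrite addsmx_sub capmxSl Vb_sub. Qed.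

Lemma dualV i : (i <= N)%N -> fl V (N - i) = perp J (fl V i).
Proof. by move=> iN; case/isotropic_flagP: Vf => _ _ _ _ ->; rewrite ?leq_subr // subKn. Qed.

(** Going from V_b to U, the intersection with W_j grows by at most one dimension. It grows exactly
    when V_b + (U \cap W_j) is all of U, and by the modular law this sum is U \cap P_j. *)
Lemma rank_meet_step (U : 'M[F]_(d.*2.+1)) j :
  (fl V b <= U)%MS -> (U <= fl V b.+1)%MS -> \rank U = (\rank (fl V b)).+1 ->
  \rank (U :&: fl W j)%MS = (rk V W b j + (U <= P j)%MS)%N.
Proof.
move=> VU UV rU; set Q := (fl V b + (U :&: fl W j))%MS.
have QU : (Q <= U)%MS by rewrite addsmx_sub VU capmxSl.
have QP : (Q <= P j)%MS by apply: addsmxS => //; apply: capmxS.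
have rQ : (\rank Q + rk V W b j = \rank (fl V b) + \rank (U :&: fl W j))%N.
  rewrite -mxrank_sum_cap; congr addn; apply/eqP; rewrite eqn_leq; apply/andP.
  split; apply: mxrankS; rewrite sub_capmx capmxSl /=.
    by rewrite sub_capmx capmxSr andbT (submx_trans (capmxSl _ _) VU).
  by rewrite (submx_trans (capmxSr _ _)) // capmxSr.
have [UP|UP] := boolP (U <= P j)%MS; last first.
  have : (\rank Q < \rank U)%N.
    apply: rank_ltmx; rewrite ltmxE QU /=.
    by apply: contra UP => h; apply: submx_trans h QP.
  have : (\rank (fl V b) <= \rank Q)%N by apply/mxrankS/addsmxSl.
  by move: rQ rU; clear; lia.
have UQ : (U <= Q)%MS.
  apply: submx_trans (_ : (U <= U :&: P j)%MS) _; first by rewrite sub_capmx submx_refl.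
  rewrite /step_space capmxC -(matrix_modl _ VU) addsmxS // capmxC.
  by apply: capmxS => //; apply: capmxSr.
have : \rank Q = \rank U by apply/eqP; rewrite eqn_leq !mxrankS.
by move: rQ rU; clear; lia.
Qed.

Lemma step_vectorsP x :
  reflect [/\ (x <= fl V b.+1)%MS, ~~ (x <= fl V b)%MS,
      (b == n :> nat) -> x *m J *m x^T = 0 &
      forall j, (j <= N)%N -> (x <= P j)%MS = (u < j)%N]
   (x \in step_vectors).
Proof.
have uN := ltn_ord u; rewrite inE; apply: (iffP and3P) => [[x1 x0 iso]|[_ _ iso xP]].
  split.
  - exact: submx_trans x1 (step_space_le _).
  - by apply: contra x0 => /submx_trans; apply; apply: addsmxSl.
  - by move/implyP: iso => iso /iso/eqP.
  - move=> j jN; have [uj|ju] := ltnP u j.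
      by apply: submx_trans x1 (step_spaceS _); rewrite uj.
    apply: contraNF x0 => /submx_trans; apply; apply: step_spaceS.
    by rewrite ju ltnW.
rewrite !xP ?ltnn ?ltnSn ?(ltnW uN) //; split=> //.
by apply/implyP=> /iso ->.
Qed.

Lemma sub_perp_add m (x : 'M[F]_(m, d.*2.+1)) (U : 'M[F]_(d.*2.+1)) k (y : 'M[F]_(k, d.*2.+1)) :
  (x <= perp J (U + y)%MS)%MS = (x <= perp J U)%MS && (x *m J *m y^T == 0).
Proof.
rewrite !sub_perp; apply/idP/andP => [/eqP h|[/eqP hU /eqP hy]].
  have /submxP[M eM] := addsmxSl U y; have /submxP[M' eM'] := addsmxSr U y.
  have -> : U^T = (U + y)%MS^T *m M^T by rewrite -trmx_mul -eM.
  have -> : y^T = (U + y)%MS^T *m M'^T by rewrite -trmx_mul -eM'.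
  by rewrite !mulmxA h !mul0mx.
have : (U + y <= col_mx U y)%MS by rewrite addsmxE.
case/submxP=> M ->; rewrite trmx_mul mulmxA tr_col_mx mul_mx_row hU hy row_mx0.
by rewrite mul0mx.
Qed.

Lemma step_isotropic x : x \in step_vectors -> b = n :> nat ->
  (fl V b + x <= perp J (fl V b + x)%MS)%MS.
Proof.
case/step_vectorsP=> xV _ iso _ /eqP bn; have xx := iso bn; move/eqP in bn.
have e : fl V b.+1 = perp J (fl V b).
  by rewrite -dualV ?(ltnW bN) //; congr (fl V _); rewrite bn; nat_lia.
have xV' : (x <= perp J (fl V b))%MS by rewrite -e.
have VxT : fl V b *m J *m x^T = 0.
  move: (xV'); rewrite sub_perp => /eqP/(congr1 trmx).
  by rewrite trmx0 trmx_mul (trmx_mul x J) trmxK J_sym mulmxA.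
rewrite addsmx_sub !(sub_perp_add _ (fl V b) x) xV' xx -e Vb_sub VxT !eqxx.
by [].
Qed.

Lemma step_flag_isotropic x : x \in step_vectors -> step_flag x \in isotropic_flags n J.
Proof.
move=> xX; have [xV xNV _ _] := step_vectorsP _ xX.
have /isotropic_flagP[gV V0 VN sV pV] := Vf.
have VxV : (fl V b + x <= fl V b.+1)%MS by rewrite addsmx_sub Vb_sub.
have mono i : (i < N)%N -> (fl (step_flag x) i <= fl (step_flag x) i.+1)%MS.
  move=> iN; rewrite !fl_step_flag //; last exact: ltnW.
  case: (eqVneq i b) => [ib|ib].
    rewrite ib -[b.+1 == b]/(b.+1 == b)%N eqn_leq ltnn /= genmxE.
    (* The steps b and N-b are consecutive in this order only for b = n, where V_b + x has to lie in
       its own orthogonal. *)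
    case: eqP => [e|_] //; apply: step_isotropic => //; nat_lia.
  case: (eqVneq i (N - b)%N) => [ib'|ib'].
    case: eqP => [e|_].
      rewrite genmxE; apply: submx_trans (_ : perp J (fl V b) <= _)%MS.
        exact/perpS/addsmxSl.
      rewrite -dualV ?(ltnW bN) //; apply: submx_trans (addsmxSl _ _).
      by apply: sV; nat_lia.
    have -> : (i.+1 == N - b)%N = false by nat_lia.
    apply: submx_trans (_ : perp J (fl V b) <= _)%MS; first exact/perpS/addsmxSl.
    by rewrite -dualV ?(ltnW bN) //; apply: sV; nat_lia.
  case: eqP => [e|_].
    by rewrite genmxE; apply: submx_trans (addsmxSl _ _); apply: sV; nat_lia.
  case: eqP => [e|_]; last by apply: sV; nat_lia.
  have -> : i = (N - b.+1)%N by nat_lia.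
  by rewrite dualV //; apply: perpS.
apply/isotropic_flagP; split.
- move=> i; rewrite /fl ffunE; case: ifP => _; first by rewrite genmx_id.
  case: ifP => _; first by rewrite perp_gen.
  exact: gV.
- by rewrite fl_step_flag // V0 ab /=; case: eqP => //; nat_lia.
- rewrite fl_step_flag // VN; case: eqP => [|_]; first nat_lia.
  by case: eqP => //; nat_lia.
- move=> i j /andP[ij jN]; elim: j ij jN => [|j IH] ij jN.
    by have -> : i = 0%N by nat_lia.
  have [->|ij'] := eqVneq i j.+1; first by [].
  by apply: submx_trans (IH _ _) (mono _ _); nat_lia.
- move=> i iN; rewrite !fl_step_flag ?leq_subr //.
  have [->|ib] := eqVneq i b.
    by rewrite (negbTE nb) eqxx perpK.
  have [->|ib'] := eqVneq i (N - b)%N.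
    by rewrite subKn ?(ltnW bN) // eqxx; apply/perp_eqmx/eqmx_sym/genmxE.
  have -> : (N - i == b)%N = false by nat_lia.
  have -> : (N - i == N - b)%N = false by nat_lia.
  exact: pV.
Qed.

Let rankC i : (i <= N)%N -> (\rank (fl V i))%:Z = cum (Xi_mx C) i N.
Proof. by move=> iN; rewrite (rank_flag_ro Vf Wf BVW) // !cum_ro roC. Qed.

Lemma step_flag_orbitC x : x \in step_vectors -> in_orbit C V (step_flag x).
Proof.
move=> xX; have [xV xNV _ _] := step_vectorsP _ xX.
have Sf := step_flag_isotropic xX.
apply/(in_orbit_adjacentP J_unit ab Vf Sf dC rankC).
rewrite fl_step_flag ?(ltnW bN) // eqxx genmxE addsmxSl; split=> //.
  by rewrite mxrank_gen rank_add_line.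
by move=> i iN /negbTE ib /negbTE ib'; rewrite fl_step_flag // ib ib'.
Qed.

Lemma step_flag_orbitA x : x \in step_vectors -> in_orbit A (step_flag x) W.
Proof.
move=> xX; have [xV xNV _ xP] := step_vectorsP _ xX.
have Sf := step_flag_isotropic xX.
have rb j : (j <= N)%N -> rk (step_flag x) W b j = (rk V W b j + (u < j))%N.
  move=> jN; rewrite /rk fl_step_flag ?(ltnW bN) // eqxx.
  rewrite rank_meet_step ?genmxE ?addsmxSl ?addsmx_sub ?Vb_sub ?xV ?rank_add_line //.
  by rewrite xP // addsmxSl.
apply/(in_orbitP _ Sf Wf) => i j iN jN.
rewrite AB cumD (cum_Etheta_diff ab) -BP //.
have [->|ib] := eqVneq i b.
  by rewrite rb // nbF /= subr0 PoszD; case: (u < j)%N.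
have [->|ib'] := eqVneq i (N - b)%N; last first.
  by rewrite /rk fl_step_flag // (negbTE ib) (negbTE ib') /= subrr addr0.
have h1 := rk_dual Sf Wf J_sym J_unit (ltnW bN) (leq_subr j N).
have h2 := rk_dual Vf Wf J_sym J_unit (ltnW bN) (leq_subr j N).
have h3 := rb (N - j)%N (leq_subr _ _).
have h4 := rank_flag_dual Vf J_unit (ltnW bN).
have h5 := rank_flag_dual Sf J_unit (ltnW bN).
have h6 : \rank (fl (step_flag x) b) = (\rank (fl V b)).+1.
  by rewrite fl_step_flag ?(ltnW bN) // eqxx genmxE rank_add_line.
move: h1 h2; rewrite !subKn //; have := ltn_ord u; nat_lia.
Qed.

Lemma step_flagK (S : flagT) x : S \in isotropic_flags n J ->
  in_orbit C V S -> in_orbit A S W -> (x <= fl S b)%MS -> ~~ (x <= fl V b)%MS ->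
  x \in step_vectors /\ step_flag x = S.
Proof.
move=> Sf /(in_orbit_adjacentP J_unit ab Vf Sf dC rankC)[VS rS eS].
move=> /(in_orbitP _ Sf Wf) AS xS xV.
have /isotropic_flagP[gS _ _ _ pS] := Sf.
have SV : (fl S b <= fl V b.+1)%MS.
  have [e|ne] := eqVneq b.+1 (N - b)%N.
    rewrite e dualV ?(ltnW bN) //; apply: submx_trans (perpS J VS).
    have -> : perp J (fl S b) = fl S b.+1 by rewrite (pS b.+1) //; congr (perp J (fl S _)); nat_lia.
    by apply: (flagS Sf); rewrite leqnSn.
  rewrite -(eS b.+1) //; first by apply: (flagS Sf); rewrite leqnSn.
  by rewrite -[b.+1 == b]/(b.+1 == b)%N neq_ltn ltnSn orbT.
have eSx : (fl V b + x :=: fl S b)%MS.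
  have s : (fl V b + x <= fl S b)%MS by rewrite addsmx_sub VS.
  apply/eqmxP; rewrite s -(geq_leqif (mxrank_leqif_sup s)).
  by rewrite rank_add_line // rS leqnn.
have SP j : (j <= N)%N -> (x <= P j)%MS = (u < j)%N.
  move=> jN; have := rank_meet_step j VS SV rS.
  rewrite -/(rk S W b j) -eSx addsmx_sub addsmxSl /= => h.
  have := AS b j (ltnW bN) jN; rewrite h AB cumD (cum_Etheta_diff ab).
  rewrite -BP ?(ltnW bN) // eqxx nbF /= subr0.
  by rewrite PoszD => /addrI; case: (x <= _)%MS; case: (u < j)%N.
split.
  apply/step_vectorsP; split=> //; first exact: submx_trans xS SV.
  move=> bn; have : (fl S b <= perp J (fl S b))%MS.
    have -> : perp J (fl S b) = fl S (N - b) by rewrite (pS (N - b)%N) ?leq_subr // subKn ?(ltnW bN).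
    by apply: (flagS Sf); move/eqP: bn => bn; nat_lia.
  move/(submx_trans xS); rewrite -(perp_eqmx J eSx) sub_perp_add => /andP[_ /eqP ->].
  by [].
apply/ffunP=> i; rewrite ffunE -!(inj_eq val_inj) /= !inordK ?ltnS ?leq_subr ?(ltnW bN) //.
have Si : S i = fl S i by rewrite /fl inord_val.
have iN : (i <= N)%N by rewrite -ltnS.
have [ib|ib] := eqVneq (i : nat) b; first by rewrite Si ib -gS; apply/eq_genmx.
have [ib'|ib'] := eqVneq (i : nat) (N - b)%N; last by rewrite Si eS // /fl inord_val.
rewrite Si ib' (pS (N - b)%N) ?leq_subr // subKn ?(ltnW bN) //.
exact: perp_eqmx.
Qed.

(** Double counting: [step_flag] maps the admissible vectors onto the flags S to be counted, and the
    fibre over S is the set of vectors of S_b outside V_b. *)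
Lemma card_step_flags :
  (#|[set S in isotropic_flags n J | in_orbit C V S && in_orbit A S W]|
    * (#|F| ^ (\rank (fl V b)).+1 - #|F| ^ \rank (fl V b)) = #|step_vectors|)%N.
Proof.
set Z := [set S in _ | _]; rewrite -sum_nat_const -[RHS]sum1_card.
rewrite (partition_big step_flag (mem Z)) /=; last first.
  move=> x xX; rewrite inE step_flag_isotropic //.
  by rewrite step_flag_orbitC // step_flag_orbitA.
apply: eq_bigr => S; rewrite inE => /and3P[Sf CS AS]; rewrite sum1dep_card.
have [VS rS _] := in_orbit_adjacentP J_unit ab Vf Sf dC rankC CS.
rewrite -rS -card_row_vectorsD //; apply: eq_card => x; rewrite !inE.
apply/andP/andP => [[xS xV]|[xX /eqP e]].
  by have [h ->] := step_flagK Sf CS AS xS xV; rewrite eqxx; move: h; rewrite inE.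
have /step_vectorsP[_ xV _ _] : x \in step_vectors by rewrite inE.
by split=> //; rewrite -e fl_step_flag ?(ltnW bN) // eqxx genmxE addsmxSr.
Qed.

End CountAdjacent.

(** * Counting in coordinate spaces *)

Section Coordinate.
Variables (F : finFieldType) (D : nat) (s : 'I_D -> 'I_D).
Hypothesis sK : involutive s.
Implicit Types S T : {set 'I_D}.

Definition coord_mx S : 'M[F]_D := \matrix_(i, j) ((i == j) && (i \in S))%:R.

(** If the involution s has exactly one fixed point, this is the Gram matrix of an orthogonal sum of
    hyperbolic planes and one line. *)
Definition swap_mx : 'M[F]_D := \matrix_(i, j) (j == s i)%:R.

Lemma swap_mx_sym : swap_mx^T = swap_mx.
Proof. by apply/matrixP=> i j; rewrite !mxE -(can_eq sK) sK eq_sym. Qed.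

Lemma mul_swap_mx m (x : 'M[F]_(m, D)) i j : (x *m swap_mx) i j = x i (s j).
Proof.
rewrite mxE (bigD1 (s j)) //= mxE sK eqxx mulr1 big1 ?addr0 // => k kj.
by rewrite mxE -(can_eq sK) sK eq_sym (negbTE kj) mulr0.
Qed.

Lemma swap_mx_unit : swap_mx \in unitmx.
Proof.
have : swap_mx *m swap_mx = 1%:M.
  by apply/matrixP=> i j; rewrite mul_swap_mx !mxE (can_eq sK) eq_sym.
by case/mulmx1_unit.
Qed.

Lemma mul_coord_mx m (x : 'M[F]_(m, D)) S i j :
  (x *m coord_mx S) i j = (if j \in S then x i j else 0).
Proof.
rewrite mxE (bigD1 j) //= mxE eqxx big1 ?addr0 => [|k kj].
  by case: (j \in S); rewrite ?mulr1 ?mulr0.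
by rewrite mxE (negbTE kj) mulr0.
Qed.

Lemma sub_coord_mx m (x : 'M[F]_(m, D)) S :
  reflect (forall i j, j \notin S -> x i j = 0) (x <= coord_mx S)%MS.
Proof.
apply: (iffP idP) => [/submxP[y ->] i j jS|h].
  by rewrite mul_coord_mx (negbTE jS).
apply/submxP; exists x; apply/matrixP=> i j; rewrite mul_coord_mx.
by case: ifP => // /negbT /h.
Qed.

Lemma coord_mx_entry S i j : j \notin S -> coord_mx S i j = 0.
Proof. by move=> jS; rewrite mxE; case: eqP => // -> ; rewrite (negbTE jS). Qed.

Lemma coord_mxS S T : S \subset T -> (coord_mx S <= coord_mx T)%MS.
Proof.
move=> /subsetP ST; apply/sub_coord_mx => i j jT.
by apply: coord_mx_entry; apply: contra jT; apply: ST.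
Qed.

Lemma coord_mxI S T : (coord_mx S :&: coord_mx T :=: coord_mx (S :&: T))%MS.
Proof.
apply/eqmxP/andP; split; last by rewrite sub_capmx !coord_mxS ?subsetIl ?subsetIr.
have /sub_coord_mx hS := capmxSl (coord_mx S) (coord_mx T).
have /sub_coord_mx hT := capmxSr (coord_mx S) (coord_mx T).
apply/sub_coord_mx => i j; rewrite inE negb_and => /orP[]; [exact: hS | exact: hT].
Qed.

Lemma delta_sub_coord_mx i S : ((delta_mx 0 i : 'rV[F]_D) <= coord_mx S)%MS = (i \in S).
Proof.
apply/sub_coord_mx/idP => [h|iS k j jS].
  by apply: contraT => /(h 0)/eqP; rewrite mxE !eqxx oner_eq0.
by rewrite mxE andbC; case: eqP => //= e; move: jS; rewrite e iS.
Qed.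

Lemma coord_mxU S T : (coord_mx S + coord_mx T :=: coord_mx (S :|: T))%MS.
Proof.
apply/eqmxP/andP; split; first by rewrite addsmx_sub !coord_mxS ?subsetUl ?subsetUr.
apply/row_subP => i; have [iST|iST] := boolP (i \in S :|: T); last first.
  rewrite (_ : row i _ = 0) ?sub0mx //; apply/rowP=> j; rewrite !mxE (negbTE iST).
  by rewrite andbF.
have -> : row i (coord_mx (S :|: T)) = delta_mx 0 i.
  by apply/rowP=> j; rewrite !mxE iST andbT eqxx eq_sym.
move: iST; rewrite inE => /orP[iS|iT].
  by apply: submx_trans (addsmxSl _ _); rewrite delta_sub_coord_mx.
by apply: submx_trans (addsmxSr _ _); rewrite delta_sub_coord_mx.
Qed.

Lemma rank_coord_mx S : \rank (coord_mx S) = #|S|.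
Proof.
move: {2}#|S| (erefl #|S|) => k; elim: k S => [|k IH] S cS.
  move/eqP: cS; rewrite cards_eq0 => /eqP ->; rewrite cards0; apply/eqP.
  by rewrite mxrank_eq0; apply/eqP/matrixP=> i j; rewrite !mxE inE andbF.
have /card_gt0P[i iS] : (0 < #|S|)%N by rewrite cS.
have cS' : #|S :\ i| = k by have := cardsD1 i S; rewrite iS cS => -[].
have e : (coord_mx S :=: coord_mx (S :\ i) + (delta_mx 0 i : 'rV[F]_D))%MS.
  apply/eqmxP/andP; split; last first.
    by rewrite addsmx_sub coord_mxS ?subsetDl //= delta_sub_coord_mx.
  rewrite -{1}(setD1K iS) setUC -(coord_mxU (S :\ i) [set i]); apply: addsmxS => //.
  apply/row_subP=> j; have [->|ji] := eqVneq j i.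
    rewrite (_ : row i _ = delta_mx 0 i) //; apply/rowP=> l.
    by rewrite !mxE inE eqxx andbT eq_sym.
  rewrite (_ : row j _ = 0) ?sub0mx //; apply/rowP=> l.
  by rewrite !mxE inE (negbTE ji) andbF.
by rewrite e rank_add_line ?IH ?cS' // ?delta_sub_coord_mx ?inE ?eqxx // IH // cS'.
Qed.

Lemma perp_coord_mx S : (perp swap_mx (coord_mx S) :=: coord_mx [set i | s i \notin S])%MS.
Proof.
have mulE m (x : 'M[F]_(m, D)) i j : (x *m swap_mx *m (coord_mx S)^T) i j =
    if j \in S then x i (s j) else 0.
  have -> : (coord_mx S)^T = coord_mx S.
    apply/matrixP=> k l; rewrite !mxE eq_sym; case: eqP => //= ->; exact: erefl.
  by rewrite mul_coord_mx mul_swap_mx.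
apply/eqmxP/andP; split.
  have := submx_refl (perp swap_mx (coord_mx S)); rewrite sub_perp => /eqP h.
  apply/sub_coord_mx => i j; rewrite inE negbK => sjS.
  by have := mulE _ (perp swap_mx (coord_mx S)) i (s j); rewrite h mxE sjS sK.
rewrite sub_perp; apply/eqP/matrixP=> i j; rewrite mulE [RHS]mxE; case: ifP => // jS.
by apply: coord_mx_entry; rewrite inE sK jS.
Qed.

Definition swap_form (x : 'rV[F]_D) : F := \sum_i x 0 i * x 0 (s i).

Lemma swap_formE x : x *m swap_mx *m x^T = (swap_form x)%:M.
Proof.
apply/matrixP=> i j; rewrite !ord1 !mxE /= mulr1n; apply: eq_bigr => k _.
by rewrite mul_swap_mx mxE mulrC.
Qed.

Hypothesis F_odd : odd #|F|.

(** The order of the additive group annihilates 1, and it is odd. *)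
Lemma two_neq0 : 2%:R != 0 :> F.
Proof.
have card0 : #|F|%:R = 0 :> F.
  by have := expg_cardG (in_setT (1 : F)); rewrite cardsT FinRing.zmodXgE.
apply/eqP=> h; move: card0; rewrite -(odd_double_half #|F|) F_odd natrD -muln2 natrM h.
by move/eqP; rewrite mulr0 addr0 oner_eq0.
Qed.

(** Without a hyperbolic pair in S the form restricts to the square of the coordinate at c, so the
    isotropic vectors are those whose coordinate at c is zero. *)
Lemma card_isotropic_coord S : (forall i, i \in S -> s i \in S -> s i = i) ->
  (forall i j, s i = i -> s j = j -> i = j) ->
  forall c, s c = c -> c \in S ->
  #|[set x : 'rV_D | (x <= coord_mx S)%MS && (swap_form x == 0)]| = (#|F| ^ #|S|.-1)%N.
Proof.
move=> aniso fix1 c sc cS.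
have -> : #|S|.-1 = #|S :\ c| by rewrite (cardsD1 c S) cS.
rewrite -(rank_coord_mx (S :\ c)) -card_row_vectors; apply: eq_card => x; rewrite !inE.
apply/andP/idP => [[/sub_coord_mx xS /eqP Qx]|/sub_coord_mx xS].
  apply/sub_coord_mx=> i j; rewrite !inE negb_and negbK => /orP[/eqP ->|]; last exact: xS.
  move: Qx; rewrite /swap_form (bigD1 c) //= sc big1 ?addr0.
    by rewrite (ord1 i) => /eqP; rewrite mulf_eq0 orbb => /eqP.
  move=> k kc; have [kS|/xS -> //] := boolP (k \in S); last by rewrite mul0r.
  have [skS|/xS -> //] := boolP (s k \in S); last by rewrite mulr0.
  by move/eqP: kc; case; apply: fix1 => //; apply: aniso.
have x0 j : s j \in S -> j \in S -> x 0 j = 0.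
  move=> sjS jS; apply: xS; rewrite !inE negb_and negbK; apply/orP; left.
  by apply/eqP/fix1 => //; apply: aniso.
split.
  by apply/sub_coord_mx=> i j jS; apply: xS; rewrite !inE negb_and jS orbT.
rewrite /swap_form big1 // => k _.
have [kS|kS] := boolP (k \in S); last by rewrite xS ?mul0r // !inE negb_and kS orbT.
have [skS|skS] := boolP (s k \in S); last by rewrite (xS 0 (s k)) ?mulr0 // !inE negb_and skS orbT.
by rewrite x0 ?mul0r.
Qed.

Lemma swap_form_add (x : 'rV[F]_D) i t : s i != i ->
  swap_form (x + t *: delta_mx 0 i) = swap_form x + 2%:R * t * x 0 (s i).
Proof.
move=> si; pose y : 'rV[F]_D := t *: delta_mx 0 i.
have yE j : y 0 j = if j == i then t else 0.
  by rewrite !mxE /=; case: eqP => _; rewrite ?mulr1 ?mulr0.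
rewrite /swap_form.
have -> : \sum_j (x + y) 0 j * (x + y) 0 (s j) =
  \sum_j (x 0 j * x 0 (s j) + (y 0 j * x 0 (s j) + x 0 j * y 0 (s j))).
  apply: eq_bigr => j _; rewrite [(x + y) 0 j]mxE [(x + y) 0 (s j)]mxE.
  have : y 0 j * y 0 (s j) = 0.
    rewrite !yE; case: eqP => [->|_]; last by rewrite mul0r.
    by rewrite (negbTE si) mulr0.
  move: (y 0 j) (y 0 (s j)) => p q pq; rewrite !mulrDl !mulrDr pq addr0; ring.
rewrite big_split big_split /=; congr (_ + _).
rewrite (bigD1 i) //= yE eqxx big1 => [|j ji]; last by rewrite yE (negbTE ji) mul0r.
rewrite (bigD1 (s i)) //= yE sK eqxx big1 => [|j ji]; last first.
  by rewrite yE -(can_eq sK) sK (negbTE ji) mulr0.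
ring.
Qed.

(** By [swap_form_add] the form is affine in the coordinate at i with slope 2 x_{s i}. Where x_{s i}
    is nonzero, that coordinate is determined by all the others, which are free. *)
Lemma card_isotropic_fiber S i : i \in S -> s i \in S -> s i != i ->
  #|[set x : 'rV_D | [&& (x <= coord_mx S)%MS, swap_form x == 0 & x 0 (s i) != 0]]|
  = (#|F| ^ #|S|.-1 - #|F| ^ #|S|.-2)%N.
Proof.
move=> iS siS si.
set X := [set x | _].
pose f (x : 'rV[F]_D) : 'rV[F]_D := x - x 0 i *: delta_mx 0 i.
have fE x j : f x 0 j = if j == i then 0 else x 0 j.
  rewrite !mxE /=; case: eqP => [->|_]; first by rewrite mulr1 subrr.
  by rewrite mulr0 subr0.
pose Y := [set y : 'rV[F]_D | (y <= coord_mx (S :\ i))%MS &&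
                              ~~ (y <= coord_mx (S :\ i :\ s i))%MS].
have cY : #|Y| = (#|F| ^ #|S|.-1 - #|F| ^ #|S|.-2)%N.
  rewrite card_row_vectorsD ?coord_mxS ?subsetDl // !rank_coord_mx.
  congr (_ ^ _ - _ ^ _)%N; first by rewrite (cardsD1 i S) iS.
  by rewrite (cardsD1 i S) iS (cardsD1 (s i) (S :\ i)) !inE si siS.
pose g (y : 'rV[F]_D) : 'rV[F]_D := y + (- swap_form y / (2%:R * y 0 (s i))) *: delta_mx 0 i.
have YP y : y \in Y -> [/\ forall j, j \notin S -> y 0 j = 0, y 0 i = 0 & y 0 (s i) != 0].
  rewrite inE => /andP[/sub_coord_mx y1 y2]; split.
  - by move=> j jS; apply: y1; rewrite !inE negb_and jS orbT.
  - by apply: y1; rewrite !inE eqxx.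
  - apply: contra y2 => /eqP ysi; apply/sub_coord_mx => k j; rewrite (ord1 k).
    by rewrite 2!inE negb_and negbK => /orP[/eqP -> //|]; apply: y1.
have gE y j : g y 0 j = if j == i then y 0 i + (- swap_form y / (2%:R * y 0 (s i))) else y 0 j.
  rewrite !mxE /=; case: eqP => [->|_]; first by rewrite mulr1.
  by rewrite mulr0 addr0.
rewrite -cY -(card_in_imset (f := f) (D := mem X)) //; last first.
  move=> x y; rewrite !inE => /and3P[_ /eqP Qx x0] /and3P[_ /eqP Qy y0] e.
  have ej j : j != i -> x 0 j = y 0 j.
    by move=> ji; have := fE x j; rewrite e fE (negbTE ji).
  have xf : x = f x + x 0 i *: delta_mx 0 i by rewrite subrK.
  have yf : y = f x + y 0 i *: delta_mx 0 i by rewrite e subrK.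
  have : 2%:R * x 0 i * f x 0 (s i) = 2%:R * y 0 i * f x 0 (s i).
    apply: (@addrI _ (swap_form (f x))).
    by rewrite -!swap_form_add // -xf -yf Qx Qy.
  have fx0 : f x 0 (s i) != 0 by rewrite fE (negbTE si).
  by move/(mulIf fx0)/(mulfI two_neq0) => xy; rewrite xf xy -yf.
apply: eq_card => y; apply/imsetP/idP => [[x xX ->]|yY].
  move: xX; rewrite !inE => /and3P[/sub_coord_mx xS _ x0].
  apply/andP; split.
    apply/sub_coord_mx => k j; rewrite (ord1 k) fE !inE negb_and negbK.
    by case: eqP => //= _; apply: xS.
  apply: contra x0 => /sub_coord_mx h; have := h 0 (s i).
  by rewrite fE (negbTE si) => -> //; rewrite !inE eqxx.
have [yS yi ysi] := YP _ yY.
exists (g y); last first.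
  apply/rowP=> j; rewrite fE gE; case: eqP => [-> //|//].
rewrite inE; apply/and3P; split.
- apply/sub_coord_mx => k j jS; rewrite (ord1 k) gE.
  by case: eqP => [e|_]; [move: jS; rewrite e iS | apply: yS].
- rewrite /g swap_form_add //; apply/eqP.
  have h2 := two_neq0; field; by rewrite ysi h2.
- by rewrite gE (negbTE si).
Qed.

(** Induction on the hyperbolic pairs {i, s i} in S. The vectors with x_{s i} nonzero are counted by
    [card_isotropic_fiber]; those with x_{s i} = 0 live on S without s i, where the induction
    hypothesis gives exactly the power that the first count subtracts. *)
Lemma card_isotropic S : (forall i j, s i = i -> s j = j -> i = j) ->
  forall c, s c = c -> c \in S ->
  #|[set x : 'rV_D | (x <= coord_mx S)%MS && (swap_form x == 0)]| = (#|F| ^ #|S|.-1)%N.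
Proof.
move=> fix1 c sc.
move: {2}#|S| (leqnn #|S|) => k; elim: k S => [|k IH] S cS cinS.
  by move: cS; rewrite leqn0 cards_eq0 => /eqP S0; rewrite S0 inE in cinS.
have [/existsP[i /and3P[iS siS si]]|/existsPn h] :=
  boolP [exists i, [&& i \in S, s i \in S & s i != i]]; last first.
  apply: (card_isotropic_coord _ fix1 sc cinS) => i iS siS.
  by have := h i; rewrite iS siS /= negbK => /eqP.
have ci : c != s i.
  by apply: contra si => /eqP e; rewrite -{2}[i]sK -e sc.
have cS' : #|S :\ s i| = #|S|.-1 by rewrite (cardsD1 (s i) S) siS.
have S2 : (1 < #|S|)%N.
  by rewrite (cardsD1 (s i) S) siS (cardsD1 i (S :\ s i)) !inE eq_sym si iS.
have := IH (S :\ s i); rewrite cS' !inE ci cinS => /(_ _ isT) IH'.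
rewrite -(cardsID [set x : 'rV[F]_D | x 0 (s i) != 0]).
have -> : #|[set x : 'rV_D | (x <= coord_mx S)%MS && (swap_form x == 0)]
             :&: [set x : 'rV[F]_D | x 0 (s i) != 0]| = (#|F| ^ #|S|.-1 - #|F| ^ #|S|.-2)%N.
  rewrite -(card_isotropic_fiber iS siS si); apply: eq_card => x.
  by rewrite !inE andbA.
have -> : #|[set x : 'rV_D | (x <= coord_mx S)%MS && (swap_form x == 0)]
             :\: [set x : 'rV[F]_D | x 0 (s i) != 0]| = (#|F| ^ #|S|.-2)%N.
  rewrite -IH'; last by move: cS; rewrite (cardsD1 (s i) S) siS.
  apply: eq_card => x; rewrite !inE negbK.
  apply/and3P/andP => [[x0 /sub_coord_mx xS ->]|[/sub_coord_mx xS ->]]; split=> //.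
  - apply/sub_coord_mx => l j; rewrite (ord1 l) !inE negb_and negbK.
    by move=> /orP[/eqP ->|]; [exact/eqP | exact: xS].
  - by apply/eqP/xS; rewrite !inE eqxx.
  - by apply/sub_coord_mx => l j jS; apply: xS; rewrite !inE negb_and jS orbT.
by rewrite subnK // leq_pexp2l ?leq_pred //; apply/card_gt0P; exists 0.
Qed.

End Coordinate.

(** Points that are not fixed come in pairs of equal value; the enumeration rank selects one of each
    pair. It serves as a parity argument throughout. *)
Lemma sum_involution (T : finType) (s : T -> T) (f : T -> int) :
  involutive s -> (forall x, f (s x) = f x) ->
  exists k : int, \sum_x f x = \sum_(x | s x == x) f x + 2 * k.
Proof.
move=> sK fs; pose r (x : T) : nat := enum_rank x.
have rI x y : (r x == r y) = (x == y).
  by rewrite /r (inj_eq (@ord_inj _)) (inj_eq enum_rank_inj).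
exists (\sum_(x | (r x < r (s x))%N) f x).
rewrite (bigID (fun x => s x == x)) /=; congr (_ + _).
rewrite (bigID (fun x => (r x < r (s x))%N)) /= mulr_natl mulr2n; congr (_ + _).
  apply: eq_bigl => x; rewrite -rI; lia.
rewrite (reindex_inj (inv_inj sK)) /=; apply: eq_big => [x|x _]; last exact: fs.
rewrite sK -!rI; lia.
Qed.

(** * A coordinate model for every relative position *)

Section Model.
Variables (n d : nat) (A : Xi n d).
Local Notation N := (n.*2.+1).
Local Notation D := (d.*2.+1).

Let a (i j : 'I_N) : nat := val A i j.

Let aD i j : (a i j <= D)%N. Proof. by rewrite -ltnS; exact: ltn_ord. Qed.

Let a_rev i j : a (rev_ord i) (rev_ord j) = a i j.
Proof.
have /andP[_ /forallP/(_ i)/forallP/(_ j)/eqP e] := valP A.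
by rewrite /a -e.
Qed.

Let T := {x : 'I_N * 'I_N * 'I_D | (x.2 < a x.1.1 x.1.2)%N}.

Lemma card_box (k : nat) : (k <= D)%N -> #|[pred m : 'I_D | (m < k)%N]| = k.
Proof.
move=> kD; rewrite -sum1_card -(big_ord_widen_cond _ xpredT (fun=> 1%N) kD).
by rewrite sum_nat_const card_ord muln1.
Qed.

Let cardT : #|{: T}| = D.
Proof.
rewrite card_sig; have /andP[/eqP e _] := valP A; apply: etrans e.
rewrite pair_big /= -sum1_card.
have /= <- := pair_big_dep xpredT
  (fun (p : 'I_N * 'I_N) (m : 'I_D) => (m < a p.1 p.2)%N) (fun _ _ => 1%N).
by apply: eq_bigr => p _; rewrite sum1_card; exact: card_box.
Qed.

Let rev_box (t : T) : (a (val t).1.1 (val t).1.2 - (val t).2.+1 < D)%N.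
Proof. have := aD (val t).1.1 (val t).1.2; have := valP t; rewrite /=; lia. Qed.

Let sigma_pair (t : T) := ((rev_ord (val t).1.1, rev_ord (val t).1.2), Ordinal (rev_box t)).

Let sigma_proof (t : T) :
  ((sigma_pair t).2 < a (sigma_pair t).1.1 (sigma_pair t).1.2)%N.
Proof. by rewrite /= a_rev; have := valP t; rewrite /=; lia. Qed.

Let sigma (t : T) : T :=
  exist (fun x : 'I_N * 'I_N * 'I_D => (x.2 < a x.1.1 x.1.2)%N) (sigma_pair t) (sigma_proof t).

Let sigmaK : involutive sigma.
Proof.
move=> t; apply: val_inj; case: t => -[[i j] m] /= h.
rewrite /sigma_pair /= !rev_ordK; congr (_, _); apply: val_inj; rewrite /= a_rev; move: h => /=; lia.
Qed.

Let h (t : T) : 'I_D := cast_ord cardT (enum_rank t).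
Let h' (x : 'I_D) : T := enum_val (cast_ord (esym cardT) x).

Let hK : cancel h h'.
Proof. by move=> t; rewrite /h /h' cast_ordK enum_rankK. Qed.

Let h'K : cancel h' h.
Proof. by move=> t; rewrite /h /h' enum_valK cast_ordKV. Qed.

(* A pair of flags in position A, as coordinate flags: basis vectors are indexed
   by the triples (i,j,m) with m < a_ij, the form pairs (i,j,m) with
   (N+1-i,N+1-j,a_ij-1-m), and la, mu return i and j. *)
Lemma model_exists : exists (s : 'I_D -> 'I_D) (la mu : 'I_D -> 'I_N) (c : 'I_D),
  [/\ involutive s,
      (forall x, la (s x) = rev_ord (la x)) /\ (forall x, mu (s x) = rev_ord (mu x)),
      s c = c, forall x, s x = x -> x = c &
      forall i j, #|[set x | (la x == i) && (mu x == j)]| = val A i j].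
Proof.
pose s x := h (sigma (h' x)).
pose la x := (val (h' x)).1.1; pose mu x := (val (h' x)).1.2.
have sK : involutive s by move=> x; rewrite /s hK sigmaK h'K.
have las x : la (s x) = rev_ord (la x) by rewrite /la /s hK.
have mus x : mu (s x) = rev_ord (mu x) by rewrite /mu /s hK.
(* A fixed triple lies in the central box and at the middle of it, which leaves a single
   possibility. *)
have fixed x : s x = x -> [/\ la x = n :> nat, mu x = n :> nat &
    ((val (h' x)).2.*2.+1 = a (la x) (mu x))%N].
  move=> sx; have := las x; have := mus x; rewrite sx => /(congr1 val) /= m1 /(congr1 val) /= l1.
  have e : (val (h' x)).2 = (a (la x) (mu x) - (val (h' x)).2.+1)%N :> nat.
    by rewrite -{1}sx /s hK.
  split; try by [have := ltn_ord (la x); lia | have := ltn_ord (mu x); lia].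
  have lt : ((val (h' x)).2 < a (la x) (mu x))%N := valP (h' x).
  move: e lt => /=; lia.
have uniq x y : s x = x -> s y = y -> x = y.
  move=> /fixed[l1 m1 e1] /fixed[l2 m2 e2].
  have l : la x = la y by apply: val_inj; rewrite /= l1 l2.
  have m : mu x = mu y by apply: val_inj; rewrite /= m1 m2.
  apply: (can_inj h'K); apply: val_inj; rewrite [LHS]surjective_pairing [RHS]surjective_pairing.
  congr pair; last by apply: val_inj => /=; move: e1 e2; rewrite l m => /=; lia.
  rewrite [LHS]surjective_pairing [RHS]surjective_pairing; congr pair; [exact: l | exact: m].
(* The involution acts on a set of odd size D and so has a fixed point. *)
have [c sc] : exists c, s c = c.
  have [k] := sum_involution (f := fun=> 1) sK (fun=> erefl).
  have [/existsP[c /eqP sc] _|/existsPn no] := boolP [exists x, s x == x]; first by exists c.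
  rewrite [X in X + _]big_pred0; last by move=> x; apply/negbTE.
  rewrite sumr_const card_ord; lia.
exists s, la, mu, c; split=> // [x /uniq|i j]; first exact.
rewrite -[RHS](card_box (aD i j)) -(card_imset _ (can_inj h'K)).
pose f (t : T) := (val t).2.
rewrite -(card_in_imset (f := f) (D := mem (h' @: [set x | (la x == i) && (mu x == j)]))); last first.
  move=> _ _ /imsetP[x + ->] /imsetP[y + ->]; rewrite !inE => /andP[/eqP lx /eqP mx] /andP[/eqP ly /eqP my] e.
  apply: val_inj; rewrite [LHS]surjective_pairing [RHS]surjective_pairing; congr pair; last exact: e.
  by rewrite [LHS]surjective_pairing [RHS]surjective_pairing -/(la x) -/(la y) -/(mu x) -/(mu y) lx ly mx my.
apply: eq_card => m; rewrite inE; apply/imsetP/idP => [[_ /imsetP[x + ->] ->]|mlt].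
  rewrite inE => /andP[/eqP lx /eqP mx]; have := valP (h' x).
  by rewrite /= -/(la x) -/(mu x) lx mx.
pose t : T := exist (fun x : 'I_N * 'I_N * 'I_D => (x.2 < a x.1.1 x.1.2)%N) ((i, j), m) mlt.
exists t => //; apply/imsetP; exists (h t); rewrite ?hK // inE /la /mu hK /=.
by rewrite !eqxx.
Qed.

End Model.

Section CoordinateFlags.
Variables (F : finFieldType) (n d : nat).
Local Notation N := (n.*2.+1).
Local Notation D := (d.*2.+1).
Variable s : 'I_D -> 'I_D.
Hypothesis sK : involutive s.
Local Notation J := (swap_mx F s).

Definition coord_flag (la : 'I_D -> 'I_N) : flag F n D :=
  [ffun i : 'I_(n.*2.+2) => <<coord_mx F [set x | (la x < i)%N]>>%MS].

Lemma fl_coord_flag la i : (i <= N)%N ->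
  fl (coord_flag la) i = <<coord_mx F [set x | (la x < i)%N]>>%MS.
Proof. by move=> iN; rewrite /fl ffunE inordK ?ltnS. Qed.

Lemma coord_flag_isotropic la : (forall x, la (s x) = rev_ord (la x)) ->
  coord_flag la \in isotropic_flags n J.
Proof.
move=> las; apply/isotropic_flagP; split.
- by move=> i; rewrite /fl ffunE genmx_id.
- rewrite fl_coord_flag // (_ : [set x | _] = set0); last by apply/setP=> x; rewrite !inE.
  rewrite (_ : coord_mx F set0 = 0) ?genmx0 //.
  by apply/matrixP=> i j; rewrite !mxE inE andbF.
- rewrite fl_coord_flag // (_ : coord_mx F _ = 1%:M) //.
  by apply/matrixP=> i j; rewrite !mxE inE ltn_ord andbT.
- move=> i j /andP[ij jN]; rewrite !fl_coord_flag //; last exact: leq_trans jN.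
  rewrite !genmxE coord_mxS //; apply/subsetP=> x; rewrite !inE => /leq_trans; exact.
- move=> i iN; rewrite !fl_coord_flag ?leq_subr //.
  rewrite (perp_eqmx J (genmxE _)) -perp_gen; apply/eq_genmx.
  apply: eqmx_trans (eqmx_sym (perp_coord_mx F sK _)).
  rewrite (_ : [set x | (la x < i)%N] = [set i0 | s i0 \notin [set x | (la x < N - i)%N]]) //.
  apply/setP=> x; rewrite !inE las /= -leqNgt; have := ltn_ord (la x); lia.
Qed.

Variables (A : Xi n d) (la mu : 'I_D -> 'I_N) (c : 'I_D).
Hypothesis las : forall x, la (s x) = rev_ord (la x).
Hypothesis mus : forall x, mu (s x) = rev_ord (mu x).
Hypothesis card_lamu : forall i j, #|[set x | (la x == i) && (mu x == j)]| = val A i j.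

Lemma coord_flag_orbit : in_orbit A (coord_flag la) (coord_flag mu).
Proof.
apply/(in_orbitP _ (coord_flag_isotropic las) (coord_flag_isotropic mus)) => i j iN jN.
rewrite /rk !fl_coord_flag // (cap_eqmx (genmxE _) (genmxE _)) coord_mxI rank_coord_mx.
rewrite -sum1_card (eq_bigl (fun x => (la x < i)%N && (mu x < j)%N)); last by move=> x; rewrite !inE.
rewrite (partition_big la (fun k : 'I_N => (k < i)%N)) /=; last by move=> x /andP[].
rewrite (big_morph Posz PoszD (erefl _)); apply: eq_bigr => k ki.
rewrite (partition_big mu (fun l : 'I_N => (l < j)%N)) /=; last by move=> x /andP[/andP[]].
rewrite (big_morph Posz PoszD (erefl _)); apply: eq_bigr => l lj.
rewrite mxE -card_lamu -sum1_card; congr Posz; apply: eq_bigl => x; rewrite !inE.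
case: eqP => [->|_]; last by rewrite andbF.
by case: eqP => [->|_]; rewrite ?ki ?lj ?andbF.
Qed.

Hypothesis F_odd : odd #|F|.
Hypothesis sc : s c = c.
Hypothesis fix1 : forall x, s x = x -> x = c.

Lemma middle_space j (b : 'I_N) : b = n :> nat -> (j <= N)%N ->
  (step_space b (coord_flag la) (coord_flag mu) j
     :=: coord_mx F [set x | (la x < n) || ((la x < n.+1) && (mu x < j))]%N)%MS.
Proof.
move=> bn jN; rewrite /step_space bn !fl_coord_flag //; try lia.
apply: eqmx_trans (adds_eqmx (genmxE _) (cap_eqmx (genmxE _) (genmxE _))) _.
apply: eqmx_trans (adds_eqmx (eqmx_refl _) (coord_mxI _ _ _)) _.
apply: eqmx_trans (coord_mxU _ _ _) _.
by rewrite (_ : _ :|: _ = [set x | (la x < n) || ((la x < n.+1) && (mu x < j))]%N) //;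
  apply/setP=> x; rewrite !inE.
Qed.

(** For j > n the coordinate set contains the fixed point c and [card_isotropic] applies. For j <= n
    it contains no x together with s x, so the form vanishes identically and nothing is lost. *)
Lemma card_isotropic_middle j (b : 'I_N) : b = n :> nat -> (j <= N)%N ->
  #|[set x : 'rV_D | (x <= step_space b (coord_flag la) (coord_flag mu) j)%MS
                      && (x *m J *m x^T == 0)]|
  = (#|F| ^ (\rank (step_space b (coord_flag la) (coord_flag mu) j) - (n < j)))%N.
Proof.
move=> bn jN; have e := middle_space bn jN; rewrite e rank_coord_mx.
set S := [set x | _].
have center (f : 'I_D -> 'I_N) : (forall x, f (s x) = rev_ord (f x)) -> f c = n :> nat.
  by move=> fs; have := fs c; rewrite sc => /(congr1 val) /=; have := ltn_ord (f c); lia.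
have -> : [set x : 'rV_D | (x <= step_space b (coord_flag la) (coord_flag mu) j)%MS
                      && (x *m J *m x^T == 0)]
  = [set x : 'rV_D | (x <= coord_mx F S)%MS && (swap_form s x == 0)].
  apply/setP=> x; rewrite !inE e swap_formE //; congr (_ && _).
  by apply/eqP/eqP => [/matrixP/(_ 0 0)|->]; rewrite ?mxE ?mulr1n ?scalemx0 //; apply/matrixP=> ? ?; rewrite !mxE mul0rn.
case: ltnP => nj.
  rewrite subn1; apply: (card_isotropic sK F_odd _ sc).
    by move=> i k /fix1 -> /fix1 ->.
  by rewrite inE center // center // nj ltnSn orbT.
rewrite subn0 -(rank_coord_mx F S) -card_row_vectors; apply: eq_card => x; rewrite !inE.
apply: andb_idr => /sub_coord_mx xS; apply/eqP/big1 => k _.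
have [kS|kS] := boolP (k \in S); last by rewrite xS ?mul0r.
rewrite [X in _ * X]xS ?mulr0 //; apply: contraL kS; rewrite !inE las mus /=.
by have := ltn_ord (la k); have := ltn_ord (mu k); lia.
Qed.

End CoordinateFlags.

(** One formula covers every b. For b = n isotropy costs one dimension in [step_space] once its
    index exceeds n, and in row b of A the partial sums up to columns u and u+1 drop by the same
    amount, because the mirror image of the moved unit lies in that row too. Fixing J, V and W
    before a, b, u, A and C also provides a pair of flags in every position B. *)
Lemma card_adjacent (F : finFieldType) n d (B : Xi n d) : odd #|F| ->
  exists (J : 'M[F]_(d.*2.+1)) (V W : flag F n d.*2.+1),
  [/\ J^T = J /\ J \in unitmx, V \in isotropic_flags n J /\ W \in isotropic_flags n J,
      in_orbit B V W &
  forall (a b u : 'I_(n.*2.+1)) (A C : Xi n d), b = a.+1 :> nat ->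
    is_diag_mx (Xi_mx C - Etheta b a) -> ro (Xi_mx C) = ro (Xi_mx B) ->
    Xi_mx A = Xi_mx B + (Etheta a u - Etheta b u) ->
  (#|[set S in isotropic_flags n J | in_orbit C V S && in_orbit A S W]| * (#|F| - 1)
    = #|F| ^ (\sum_(l < n.*2.+1 | (l < u)%N) val A b l) * (#|F| ^ (val A b u).+1 - 1))%N].
Proof.
move=> F_odd.
have [s [la [mu [c [sK [las mus] sc fix1 card_lamu]]]]] := model_exists B.
exists (swap_mx F s), (coord_flag F la), (coord_flag F mu).
have Vf := coord_flag_isotropic F sK las; have Wf := coord_flag_isotropic F sK mus.
have BVW := coord_flag_orbit F sK las mus card_lamu.
have Ju := swap_mx_unit F sK; have Js := swap_mx_sym F sK.
split=> // a b u A C ab dC roC AB.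
set V := coord_flag F la in Vf BVW *; set W := coord_flag F mu in Wf BVW *.
have := card_step_flags Js Ju ab Vf Wf BVW dC roC AB.
set Z := #|_|; set r := \rank (fl V b); set q := #|F|.
set alpha := (\sum_(l < _ | _) _)%N; set x := val A b u : nat.
have bN := ltn_ord b; have uN := ltn_ord u.
have q2 : (1 < q)%N by apply: card_finNzRing_gt1.
set J := swap_mx F s in Ju Js Vf Wf *.
pose beta j : int := \sum_(l < n.*2.+1 | (l < j)%N) Xi_mx B b l.
have rP j : (j <= n.*2.+1)%N -> (\rank (step_space b V W j))%:Z = r%:Z + beta j.
  move=> jN; have := rank_step_space b W Vf j; rewrite -/r => h.
  have := cumSl (Xi_mx B) b j; rewrite -/(beta j).
  rewrite -!(in_orbitP _ Vf Wf BVW) ?(ltnW bN) //.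
  lia.
have AE j : (j <= n.*2.+1)%N -> \sum_(l < n.*2.+1 | (l < j)%N) Xi_mx A b l
   = beta j - (u < j)%N%:R - ((b == n :> nat) && (n.*2.+1 - u.+1 < j))%N%:R.
  move=> jN.
  have h M : \sum_(l < n.*2.+1 | (l < j)%N) (M : 'M[int]__) b l = cum M b.+1 j - cum M b j.
    by rewrite cumSl addrC addKr.
  rewrite /beta !h AB !(cumD (Xi_mx B)) !(cum_Etheta_diff ab).
  have -> : (b.+1 == b :> nat) = false by lia.
  have -> : (b.+1 == n.*2.+1 - b)%N = (b == n :> nat) by lia.
  have -> : (b == n.*2.+1 - b :> nat)%N = false by lia.
  by rewrite eqxx /=; ring.
have alphaE : alpha%:Z = beta u - ((b == n :> nat) && (n < u))%N%:R.
  have := AE u (ltnW uN); rewrite ltnn subr0.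
  have -> : ((b == n :> nat) && (n.*2.+1 - u.+1 < u))%N = ((b == n :> nat) && (n < u))%N by lia.
  move=> <-; rewrite /alpha (big_morph Posz PoszD (erefl _)).
  by apply: eq_bigr => l _; rewrite mxE.
have xE : alpha%:Z + x%:Z = beta u.+1 - 1 - ((b == n :> nat) && (n <= u))%N%:R.
  have := AE u.+1 uN; rewrite ltnSn.
  have -> : ((b == n :> nat) && (n.*2.+1 - u.+1 < u.+1))%N = ((b == n :> nat) && (n <= u))%N by lia.
  move=> <-; rewrite (bigD1 u) //= [RHS]addrC; congr (_ + _); last by rewrite mxE.
  rewrite /alpha (big_morph Posz PoszD (erefl _)).
  apply: eq_big => [l|l _]; last by rewrite mxE.
  by rewrite ltnS ltn_neqAle andbC.
have card_iso j : (j <= n.*2.+1)%N ->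
  #|[set y : 'rV[F]_(d.*2.+1) | (y <= step_space b V W j)%MS &&
      ((b == n :> nat) ==> (y *m swap_mx F s *m y^T == 0))]|
  = (q ^ (\rank (step_space b V W j) - ((b == n :> nat) && (n < j))))%N.
  move=> jN; case: eqP => bn /=.
    by rewrite (card_isotropic_middle sK las mus F_odd sc fix1 bn jN).
  by rewrite subn0 -card_row_vectors; apply: eq_card => y; rewrite !inE andbT.
have cX : #|step_vectors J b u V W| = (q ^ (r + (alpha + x.+1)) - q ^ (r + alpha))%N.
  pose iso j := [set y : 'rV[F]_(d.*2.+1) | (y <= step_space b V W j)%MS &&
      ((b == n :> nat) ==> (y *m J *m y^T == 0))].
  have -> : #|step_vectors J b u V W| = #|iso u.+1 :\: iso u|.
    apply: eq_card => y; rewrite !inE; case: (_ ==> _); rewrite ?andbT ?andbF // andbC //.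
  rewrite cardsDS; last first.
    apply/subsetP=> y; rewrite !inE => /andP[h ->]; rewrite andbT.
    apply: (submx_trans h); apply: (step_spaceS (J := J)) => //; rewrite leqnSn //.
  rewrite !card_iso //; last exact: ltnW.
  have h1 := rP u.+1 uN; have h2 := rP u (ltnW uN).
  congr (_ ^ _ - _ ^ _)%N; move: h1 h2 alphaE xE; clear -bN; case: (b == n :> nat); lia.
have qr : (0 < q ^ r)%N by rewrite expn_gt0 (ltnW q2).
have -> : (q ^ r.+1 - q ^ r = q ^ r * (q - 1))%N by rewrite mulnBr muln1 expnSr.
have e : (q ^ (r + (alpha + x.+1)) - q ^ (r + alpha) = q ^ r * (q ^ alpha * (q ^ x.+1 - 1)))%N.
  by rewrite !mulnBr !muln1 -!expnD.
rewrite cX e mulnCA => /eqP; rewrite eqn_pmul2l // => /eqP; exact.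
Qed.

(** * Constraints on relative positions *)

Section OrbitConstraints.
Variables (F : finFieldType) (n d : nat) (J : 'M[F]_(d.*2.+1)).
Local Notation N := (n.*2.+1).
Hypothesis (J_sym : J^T = J) (J_unit : J \in unitmx).
Variables (V W S : flag F n d.*2.+1) (A B C : Xi n d).
Hypotheses (Vf : V \in isotropic_flags n J) (Wf : W \in isotropic_flags n J).
Hypothesis Sf : S \in isotropic_flags n J.
Hypotheses (BVW : in_orbit B V W) (CVS : in_orbit C V S) (ASW : in_orbit A S W).

Lemma orbit_ro : ro (Xi_mx C) = ro (Xi_mx B).
Proof.
apply/matrixP=> i j; have iN := ltn_ord i; rewrite (ord1 j) !ro_cumE.
by rewrite -!(rank_flag_ro Vf Sf CVS) ?(ltnW iN) // -!(rank_flag_ro Vf Wf BVW) ?(ltnW iN).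
Qed.

Lemma orbit_co : co (Xi_mx A) = co (Xi_mx B).
Proof.
apply/matrixP=> i j; have iN := ltn_ord i; rewrite (ord1 j) !co_cumE.
by rewrite -!(rank_flag_co Sf Wf ASW) ?(ltnW iN) // -!(rank_flag_co Vf Wf BVW) ?(ltnW iN).
Qed.

Lemma orbit_co_ro : co (Xi_mx C) = ro (Xi_mx A).
Proof.
apply/matrixP=> i j; have iN := ltn_ord i; rewrite (ord1 j) ro_cumE co_cumE.
by rewrite -!(rank_flag_ro Sf Wf ASW) ?(ltnW iN) // -!(rank_flag_co Vf Sf CVS) ?(ltnW iN).
Qed.

Lemma orbit_diag : is_diag_mx (Xi_mx C) -> S = V.
Proof.
move=> dC; apply/ffunP=> i; rewrite -[i]inord_val -!/(fl _ _).
have iN : (i <= N)%N by rewrite -ltnS.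
have rV : (\rank (fl V i))%:Z = cum (Xi_mx C) i i.
  by rewrite (rank_flag_ro Vf Sf CVS) // [RHS]cum_diag // minnn.
have coC : cum (Xi_mx C) N i = cum (Xi_mx C) i i.
  by rewrite cum_diag // (minn_idPr iN) [RHS]cum_diag // minnn.
apply/esym/(flag_eq Vf Sf).
  apply: capmx_full; apply/eqP; rewrite -eqz_nat rV.
  by have -> := in_orbitP _ Vf Sf CVS i i iN iN.
by apply/eqP; rewrite -eqz_nat rV (rank_flag_co Vf Sf CVS) // coC.
Qed.

Variables (a b : 'I_N).
Hypothesis ab : b = a.+1 :> nat.
Hypothesis dC : is_diag_mx (Xi_mx C - Etheta b a).

Lemma orbit_adjacent_exists : exists u, Xi_mx A = Xi_mx B + (Etheta a u - Etheta b u).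
Proof.
have bN := ltn_ord b.
have rankC i : (i <= N)%N -> (\rank (fl V i))%:Z = cum (Xi_mx C) i N.
  by move=> iN; rewrite (rank_flag_ro Vf Sf CVS).
have [VS rS eS] := in_orbit_adjacentP J_unit ab Vf Sf dC rankC CVS.
have /isotropic_flagP[gS _ _ _ pS] := Sf.
have SV : (fl S b <= fl V b.+1)%MS.
  have [e|ne] := eqVneq b.+1 (N - b)%N.
    have -> : fl V b.+1 = perp J (fl V b).
      by case/isotropic_flagP: Vf => _ _ _ _ -> //; congr (perp J (fl V _)); nat_lia.
    apply: submx_trans (perpS J VS).
    have -> : perp J (fl S b) = fl S b.+1 by rewrite (pS b.+1) //; congr (perp J (fl S _)); nat_lia.
    by apply: (flagS Sf); rewrite leqnSn.
  rewrite -(eS b.+1) //; first by apply: (flagS Sf); rewrite leqnSn.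
  by rewrite neq_ltn ltnSn orbT.
pose P j := step_space b V W j.
have PN : (fl S b <= P N)%MS.
  apply: submx_trans SV _; apply: submx_trans (addsmxSr _ _); rewrite sub_capmx submx_refl.
  by case/isotropic_flagP: Wf => _ _ -> _ _; rewrite genmxE submx1.
(* The line by which S_b exceeds V_b is located by the least j for which S_b lies in P_j; u is the
   predecessor of this j. *)
have ex : exists j, (fl S b <= P j)%MS by exists N.
case: (ex_minnP ex) => k kP kmin.
have k0 : (0 < k)%N.
  rewrite lt0n; apply/eqP=> e; move: kP; rewrite e /P /step_space.
  case/isotropic_flagP: Wf => _ -> _ _ _; rewrite capmx0 addsmx0 => /mxrankS.
  by rewrite rS ltnn.
have kN : (k.-1 < N)%N by have := kmin N PN; nat_lia.
pose u := Ordinal kN; have uN := ltn_ord u.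
have SP j : (j <= N)%N -> (fl S b <= P j)%MS = (u < j)%N.
  move=> jN; rewrite /= prednK //; apply/idP/idP; first exact: kmin.
  by move=> kj; apply: submx_trans kP _; apply: (step_spaceS (J := J)); rewrite ?kj.
exists u; apply: cum_inj => i j iN jN.
have BP := in_orbitP _ Vf Wf BVW; have AP := in_orbitP _ Sf Wf ASW.
have rb l : (l <= N)%N -> rk S W b l = (rk V W b l + (u < l))%N.
  by move=> lN; rewrite /rk (rank_meet_step W l VS SV rS) SP.
have nbF : (b == N - b :> nat)%N = false by nat_lia.
rewrite cumD (cum_Etheta_diff ab) -BP // -AP //.
have [->|ib] := eqVneq i b.
  by rewrite rb // nbF /= subr0 PoszD; case: (u < j)%N.
have [->|ib'] := eqVneq i (N - b)%N; last first.
  by rewrite /rk eS //= subrr addr0.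
have h1 := rk_dual Sf Wf J_sym J_unit (ltnW bN) (leq_subr j N).
have h2 := rk_dual Vf Wf J_sym J_unit (ltnW bN) (leq_subr j N).
have h3 := rb (N - j)%N (leq_subr _ _).
have h4 := rank_flag_dual Vf J_unit (ltnW bN).
have h5 := rank_flag_dual Sf J_unit (ltnW bN).
have eu : (u < N - j)%N = ~~ (N - u.+1 < j)%N by move: jN uN; clear; nat_lia.
move: h1 h2 h3 h4 h5 rS; rewrite !subKn // eu /=; case: (N - u.+1 < j)%N => /=; clear; nat_lia.
Qed.

End OrbitConstraints.

(** * Fibre dimensions *)

Section OrbitDimension.
Variable n : nat.
Local Notation N := (n.*2.+1).
Implicit Types M : 'M[int]_N.

(* Dimension of the type A orbit attached to a matrix, polarized. *)
Definition flag_dim M M' : int :=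
  \sum_(i < N) \sum_(j < N) \sum_(k < N) \sum_(l < N) ((k <= i) && (j < l))%N%:R * (M i j * M' k l).

(** This collects the linear parts of the terms a_ij (a_ij - 1)/2 of d_A, doubled and with the sign
    reversed. *)
Definition corner_sum M : int := \sum_(i < N | (n <= i)%N) \sum_(j < N | (j < n)%N) M i j.

Lemma flag_dimDl M1 M2 M : flag_dim (M1 + M2) M = flag_dim M1 M + flag_dim M2 M.
Proof.
rewrite /flag_dim -big_split; apply: eq_bigr => i _ /=; rewrite -big_split; apply: eq_bigr => j _ /=.
rewrite -big_split; apply: eq_bigr => k _ /=; rewrite -big_split; apply: eq_bigr => l _ /=.
rewrite mxE; ring.
Qed.

Lemma flag_dimBl M1 M2 M : flag_dim (M1 - M2) M = flag_dim M1 M - flag_dim M2 M.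
Proof. by apply/eqP; rewrite eq_sym subr_eq -flag_dimDl subrK. Qed.

Lemma flag_dimDr M1 M2 M : flag_dim M (M1 + M2) = flag_dim M M1 + flag_dim M M2.
Proof.
rewrite /flag_dim -big_split; apply: eq_bigr => i _ /=; rewrite -big_split; apply: eq_bigr => j _ /=.
rewrite -big_split; apply: eq_bigr => k _ /=; rewrite -big_split; apply: eq_bigr => l _ /=.
rewrite mxE; ring.
Qed.

Lemma flag_dimBr M1 M2 M : flag_dim M (M1 - M2) = flag_dim M M1 - flag_dim M M2.
Proof. by apply/eqP; rewrite eq_sym subr_eq -flag_dimDr subrK. Qed.

Lemma corner_sumD M1 M2 : corner_sum (M1 + M2) = corner_sum M1 + corner_sum M2.
Proof.
rewrite /corner_sum -big_split; apply: eq_bigr => i _ /=; rewrite -big_split.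
by apply: eq_bigr => j _ /=; rewrite mxE.
Qed.

Lemma sum_delta (f : 'I_N -> 'I_N -> int) r s :
  \sum_i \sum_j f i j * (delta_mx r s : 'M[int]_N) i j = f r s.
Proof.
rewrite (bigD1 r) //= (bigD1 s) //= !mxE !eqxx mulr1 big1 => [|j /negbTE js]; last first.
  by rewrite mxE js andbF mulr0.
rewrite big1 ?addr0 // => i /negbTE ir; apply: big1 => j _.
by rewrite mxE ir mulr0.
Qed.

Lemma flag_dim_deltar M r s :
  flag_dim M (delta_mx r s) = \sum_(i < N | (r <= i)%N) \sum_(j < N | (j < s)%N) M i j.
Proof.
rewrite [RHS]big_mkcond; apply: eq_bigr => i _.
transitivity (\sum_(j < N) ((r <= i) && (j < s))%N%:R * M i j).
  apply: eq_bigr => j _; rewrite -(sum_delta (fun k l => ((k <= i) && (j < l))%N%:R * M i j)).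
  by apply: eq_bigr => k _; apply: eq_bigr => l _; rewrite mulrA.
case: (r <= i)%N => /=; last by rewrite big1 // => j _; rewrite mul0r.
rewrite [RHS]big_mkcond; apply: eq_bigr => j _.
by case: (j < s)%N; rewrite ?mul1r ?mul0r.
Qed.

Lemma flag_dim_deltal M r s :
  flag_dim (delta_mx r s) M = \sum_(k < N | (k <= r)%N) \sum_(l < N | (s < l)%N) M k l.
Proof.
transitivity (\sum_(i < N) \sum_(j < N) (\sum_(k < N) \sum_(l < N) ((k <= i) && (j < l))%N%:R * M k l) * (delta_mx r s : 'M[int]_N) i j).
  apply: eq_bigr => i _; apply: eq_bigr => j _; rewrite mulr_suml; apply: eq_bigr => k _.
  by rewrite mulr_suml; apply: eq_bigr => l _; ring.
rewrite sum_delta [RHS]big_mkcond; apply: eq_bigr => k _.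
case: (k <= r)%N => /=; last by rewrite big1 // => j _; rewrite mul0r.
rewrite [RHS]big_mkcond; apply: eq_bigr => j _.
by case: (s < j)%N; rewrite ?mul1r ?mul0r.
Qed.

Lemma flag_dim_delta2 (r s r' s' : 'I_N) :
  flag_dim (delta_mx r s) (delta_mx r' s') = ((r' <= r) && (s < s'))%N%:R.
Proof.
rewrite flag_dim_deltal big_mkcond (eq_bigr (fun k : 'I_N => \sum_(l < N)
   ((k <= r) && (s < l))%N%:R * (delta_mx r' s' : 'M[int]_N) k l)).
  exact: sum_delta.
move=> k _; case: (k <= r)%N => /=; last by rewrite big1 // => j _; rewrite mul0r.
rewrite big_mkcond; apply: eq_bigr => j _.
by case: (s < j)%N; rewrite ?mul1r ?mul0r.
Qed.

Lemma corner_sum_delta (r s : 'I_N) :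
  corner_sum (delta_mx r s) = ((n <= r) && (s < n))%N%:R.
Proof.
rewrite /corner_sum big_mkcond (eq_bigr (fun i : 'I_N => \sum_(j < N)
   ((n <= i) && (j < n))%N%:R * (delta_mx r s : 'M[int]_N) i j)).
  exact: sum_delta.
move=> k _; case: (n <= k)%N => /=; last by rewrite big1 // => j _; rewrite mul0r.
rewrite big_mkcond; apply: eq_bigr => j _.
by case: (j < n)%N; rewrite ?mul1r ?mul0r.
Qed.

Lemma sum_geS (f : 'I_N -> int) (a b : 'I_N) : b = a.+1 :> nat ->
  \sum_(i < N | (b <= i)%N) f i - \sum_(i < N | (a <= i)%N) f i = - f a.
Proof.
move=> ab; rewrite [X in _ - X](bigD1 a) //= opprD addrCA -[RHS]addr0; congr (_ + _).
apply/eqP; rewrite subr_eq0; apply/eqP/eq_bigl => i.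
by rewrite ab ltn_neqAle andbC -(inj_eq val_inj) eq_sym.
Qed.

Lemma sum_leS (f : 'I_N -> int) (a b : 'I_N) : b = a.+1 :> nat ->
  \sum_(i < N | (i <= b)%N) f i - \sum_(i < N | (i <= a)%N) f i = f b.
Proof.
move=> ab; rewrite (bigD1 b) //= -addrA -[RHS]addr0; congr (_ + _).
apply/eqP; rewrite subr_eq0; apply/eqP/eq_bigl => i.
by rewrite -(inj_eq val_inj) /= ab; lia.
Qed.

(* Twice d_A; centrosymmetry turns d_A into a quadratic form plus a linear one. *)
Definition fiber_dim2 M : int := flag_dim M M - corner_sum M.

(** The change of matrix is m + m' with m' the mirror image of m. Centrosymmetry of M makes the
    bilinear contributions of m and m' equal, whence the factor 2; the terms quadratic in m + m',
    together with the corner term, leave only the correction for a = n. *)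
Lemma fiber_dim2_step M (a b u : 'I_N) : centrosymmetric M -> b = a.+1 :> nat ->
  fiber_dim2 (M + (Etheta b u - Etheta a u)) =
  fiber_dim2 M + 2 * (\sum_(l < N | (u < l)%N) M b l - \sum_(l < N | (l < u)%N) M a l
                      + ((a == n :> nat) && (n < u))%N%:R).
Proof.
move=> cM ab; pose m := (delta_mx b u - delta_mx a u : 'M[int]_N).
pose m' := (delta_mx (rev_ord b) (rev_ord u) - delta_mx (rev_ord a) (rev_ord u) : 'M[int]_N).
have -> : Etheta b u - Etheta a u = m + m' by rewrite /Etheta /m /m' addrACA opprD.
have ab' : rev_ord a = (rev_ord b).+1 :> nat by rewrite /= ab; have := ltn_ord b; lia.
have revP (f : 'I_N -> int) P : \sum_(l < N | P l) f l = \sum_(l < N | P (rev_ord l)) f (rev_ord l).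
  exact: (reindex_inj rev_ord_inj).
have Mm : flag_dim M m = - \sum_(l < N | (l < u)%N) M a l.
  by rewrite flag_dimBr !flag_dim_deltar (sum_geS (fun i => \sum_(j < N | (j < u)%N) M i j) ab).
have mM : flag_dim m M = \sum_(l < N | (u < l)%N) M b l.
  by rewrite flag_dimBl !flag_dim_deltal (sum_leS (fun i => \sum_(j < N | (u < j)%N) M i j) ab).
have Mm' : flag_dim M m' = \sum_(l < N | (u < l)%N) M b l.
  rewrite flag_dimBr !flag_dim_deltar -opprB.
  rewrite (sum_geS (fun i => \sum_(j < N | (j < rev_ord u)%N) M i j) ab') opprK revP.
  apply: eq_big => [l|l _]; last exact: centrosymmetricE.
  by rewrite /=; have := ltn_ord l; lia.
have m'M : flag_dim m' M = - \sum_(l < N | (l < u)%N) M a l.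
  rewrite flag_dimBl !flag_dim_deltal -opprB.
  rewrite (sum_leS (fun i => \sum_(j < N | (rev_ord u < j)%N) M i j) ab') revP.
  congr (- _); apply: eq_big => [l|l _]; last exact: centrosymmetricE.
  by rewrite /=; have := ltn_ord u; lia.
have quad : flag_dim (m + m') (m + m') - corner_sum (m + m')
    = 2 * ((a == n :> nat) && (n < u))%N%:R.
  have csN X : corner_sum (- X) = - corner_sum X.
    by apply/eqP; rewrite -addr_eq0 -corner_sumD addNr /corner_sum big1 // => i _; rewrite big1 // => j _; rewrite mxE.
  rewrite (flag_dimDl m m') !(flag_dimDr m m') /m /m' !flag_dimBl !flag_dimBr !flag_dim_delta2.
  rewrite (corner_sumD m m') /m /m' !corner_sumD !csN !corner_sum_delta /= ab.
  have := ltn_ord b; rewrite ab !ltnn !andbF => aN.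
  have uN := ltn_ord u.
  have := ltngtP u n; rewrite [(u < N - u.+1)%N](_ : _ = (u < n)%N); last by apply/idP/idP; lia.
  rewrite [(N - u.+1 < u)%N](_ : _ = (n < u)%N); last by apply/idP/idP; lia.
  rewrite [(N - u.+1 < n)%N](_ : _ = (n < u)%N); last by apply/idP/idP; lia.
  case=> un; rewrite ?andbT ?andbF; move: aN; clear; lia.
rewrite /fiber_dim2 flag_dimDl flag_dimDr [flag_dim (m + m') _]flag_dimDr corner_sumD.
rewrite [flag_dim M (m + m')]flag_dimDr [flag_dim (m + m') M]flag_dimDl.
rewrite Mm Mm' mM m'M; move: quad; lia.
Qed.

Lemma fiber_dim2_diag M : is_diag_mx M -> fiber_dim2 M = 0.
Proof.
move=> /is_diag_mxP dM; rewrite /fiber_dim2 /corner_sum big1 => [|i ni]; last first.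
  by apply: big1 => j jn; apply: dM; apply/eqP; lia.
rewrite subr0 /flag_dim big1 // => i _; rewrite big1 // => j _; rewrite big1 // => k _.
rewrite big1 // => l _; have [ij|ij] := eqVneq i j; last by rewrite dM // mul0r mulr0.
have [kl|kl] := eqVneq k l; last by rewrite (dM k l) // !mulr0.
by rewrite -ij -kl (_ : (_ && _) = false) ?mul0r //; lia.
Qed.

End OrbitDimension.

Lemma Xi_centrosymmetric n d (A : Xi n d) : centrosymmetric (Xi_mx A).
Proof.
have /andP[_ /forallP h] := valP A; apply/forallP=> i; apply/forallP=> j.
by have /forallP/(_ j)/eqP e := h i; rewrite !mxE e.
Qed.

(** * The exponent d_A as half of a quadratic and a linear form *)

Section DimA.
Variables (n d : nat) (A : Xi n d).
Local Notation N := (n.*2.+1).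
Let M := Xi_mx A.
Let MC : centrosymmetric M := Xi_centrosymmetric A.

(** R i k is the share of rows i and k in [flag_dim M M]; P, T and L are the contributions of a
    single row to the second and third sums of d_A. *)
Let R (i k : 'I_N) : int := \sum_(j < N) \sum_(l < N | (j < l)%N) M i j * M k l.
Let P (i : 'I_N) : int := \sum_(j < N) \sum_(l < N | ((j < l) && (j + l < n.*2))%N) M i j * M i l.
Let T (i : 'I_N) : int := \sum_(j < N | (j < n)%N) M i j * M i j.
Let L (i : 'I_N) : int := \sum_(j < N | (j < n)%N) M i j.

Let rev_sum (Q : pred 'I_N) (f : 'I_N -> int) :
  \sum_(l | Q l) f l = \sum_(l | Q (rev_ord l)) f (rev_ord l).
Proof. exact: (reindex_inj rev_ord_inj). Qed.

Let R_rev i k : R (rev_ord i) (rev_ord k) = R k i.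
Proof.
rewrite /R (rev_sum xpredT) /=.
under eq_bigr => j _.
  rewrite rev_sum; under eq_bigr => l _ do rewrite !centrosymmetricE //.
  over.
rewrite (exchange_big_dep xpredT) //=; apply: eq_bigr => l _.
apply: eq_big => [j|j _]; last by rewrite mulrC.
by have := ltn_ord l; have := ltn_ord j; lia.
Qed.

Let R_corner i : R i (rev_ord i) = 2 * P i + T i.
Proof.
have -> : R i (rev_ord i) = \sum_(j < N) \sum_(l < N | (j + l < n.*2)%N) M i j * M i l.
  apply: eq_bigr => j _; rewrite rev_sum; apply: eq_big => [l|l _]; last by rewrite centrosymmetricE.
  by rewrite /=; have := ltn_ord l; have := ltn_ord j; lia.
have -> : T i = \sum_(j < N) \sum_(l < N | ((j == l) && (j + l < n.*2))%N) M i j * M i l.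
  rewrite /T big_mkcond; apply: eq_bigr => j _.
  rewrite (eq_bigl (fun l => (l == j) && (j < n)%N)); last first.
    by move=> l; case: (eqVneq l j) => [->|h] /=; [lia | done].
  case: ifP => jn; last by rewrite big1 // => l; rewrite andbF.
  by rewrite (eq_bigl (pred1 j)) ?big_pred1_eq // => l; rewrite andbT.
have swap : P i = \sum_(j < N) \sum_(l < N | ((l < j) && (j + l < n.*2))%N) M i j * M i l.
  rewrite /P (exchange_big_dep xpredT) //=; apply: eq_bigr => l _.
  by apply: eq_big => [j|j _]; rewrite ?[(j + l)%N]addnC // mulrC.
rewrite mulr_natl mulr2n {2}swap /P -!big_split; apply: eq_bigr => j _ /=.
rewrite (bigID (fun l : 'I_N => (j < l)%N)) /= -addrA; congr (_ + _).
  by apply: eq_bigl => l; rewrite andbC.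
rewrite (bigID (fun l : 'I_N => (l < j)%N)) /=; congr (_ + _); apply: eq_bigl => l.
  by lia.
by rewrite -(inj_eq val_inj) /=; lia.
Qed.

Let flag_dimR : flag_dim M M = \sum_(i < N) \sum_(k < N | (k <= i)%N) R i k.
Proof.
rewrite /flag_dim; apply: eq_bigr => i _; rewrite exchange_big /= [RHS]big_mkcond.
apply: eq_bigr => k _; case: ifP => ki /=; last first.
  by rewrite big1 // => j _; rewrite big1 // => l _; rewrite mul0r.
apply: eq_bigr => j _; rewrite [RHS]big_mkcond; apply: eq_bigr => l _.
by case: ifP; rewrite ?mul1r ?mul0r.
Qed.

Let sum_rev2 (f : 'I_N -> 'I_N -> int) (Q : 'I_N -> 'I_N -> bool) :
  (forall i k, f (rev_ord k) (rev_ord i) = f i k) ->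
  \sum_(i < N) \sum_(k | Q i k) f i k = \sum_(i < N) \sum_(k | Q (rev_ord k) (rev_ord i)) f i k.
Proof.
move=> fr; rewrite (rev_sum xpredT) /=.
under eq_bigr => i _ do rewrite rev_sum.
rewrite (exchange_big_dep xpredT) //=; apply: eq_bigr => k _; apply: eq_bigr => i _.
by rewrite fr.
Qed.

Let first_sum : 2 * (\sum_(i < N) \sum_(k < N | ((k < i) && (i + k < n.*2))%N) R i k)
   + \sum_(i < N | (n < i)%N) R i (rev_ord i) = \sum_(i < N) \sum_(k < N | (k < i)%N) R i k.
Proof.
have := sum_rev2 (f := R) (fun i k => ((k < i) && (i + k < n.*2))%N) (fun i k => R_rev k i).
rewrite mulr_natl mulr2n => {2}->.
rewrite [X in _ + X]big_mkcond -!big_split; apply: eq_bigr => i _ /=.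
have := ltn_ord i => iN.
rewrite [RHS](bigID (fun k : 'I_N => (i + k < n.*2)%N)) /= -addrA; congr (_ + _).
rewrite [RHS](bigID (fun k : 'I_N => (k == rev_ord i))) /= addrC; congr (_ + _); last first.
  apply: eq_bigl => k; rewrite -(inj_eq val_inj) /=; have := ltn_ord k; lia.
case: ifP => ni; last first.
  by rewrite big_pred0 // => k; rewrite -(inj_eq val_inj) /=; have := ltn_ord k; lia.
rewrite (eq_bigl (pred1 (rev_ord i))) ?big_pred1_eq // => k /=.
by rewrite -(inj_eq val_inj) /=; have := ltn_ord k; lia.
Qed.

(** Reversal sends the rows (i,k) to the mirror images of (k,i) without changing R, so the condition
    i + k < N+1 keeps one half of the pairs off the antidiagonal. On the antidiagonal [R_corner]
    splits R into twice the terms of the second sum and the squares that complete a(a-1). *)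
Lemma dimA_double : 2 * (dimA A)%:Z = fiber_dim2 (Xi_mx A).
Proof.
rewrite /fiber_dim2 -/M flag_dimR.
pose F1 := \sum_(i < N) \sum_(k < N | ((k < i) && (i + k < n.*2))%N) R i k.
pose F2 := \sum_(i < N | (i < n)%N) R i i + \sum_(i < N | (n <= i)%N) P i.
pose F3 : int := \sum_(i < N | (n <= i)%N) \sum_(j < N | (j < n)%N) ((val A i j * (val A i j).-1)./2)%:Z.
have dE : (dimA A)%:Z = F1 + F2 + F3.
  rewrite /dimA !PoszD; congr (_ + _ + _).
  - rewrite (big_morph Posz PoszD (erefl _)); apply: eq_bigr => i _.
    rewrite (big_morph Posz PoszD (erefl _)).
    under eq_bigr => j _.
      rewrite (big_morph Posz PoszD (erefl _)).
      under eq_bigr => k _ do rewrite (big_morph Posz PoszD (erefl _)).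
      over.
    rewrite exchange_big /= [RHS]big_mkcond; apply: eq_bigr => k _.
    case: ifP => ik; last first.
      rewrite big1 // => j _; rewrite big_pred0 // => l.
      by move: ik; case: (k < i)%N; case: (i + k < n.*2)%N; rewrite ?andbF.
    apply: eq_bigr => j _; apply: eq_big => [l|l _]; last by rewrite !mxE PoszM.
    by case/andP: ik => -> ->; rewrite andbT.
  - rewrite (big_morph Posz PoszD (erefl _)) (bigID (fun i : 'I_N => (i < n)%N)) /=.
    congr (_ + _); last rewrite (eq_bigl (fun i : 'I_N => (n <= i)%N)).
    + apply: eq_bigr => i ni; rewrite (big_morph Posz PoszD (erefl _)).
      apply: eq_bigr => j _; rewrite (big_morph Posz PoszD (erefl _)).
      by apply: eq_big => [l|l _]; [rewrite ni andbT | rewrite !mxE PoszM].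
    + apply: eq_bigr => i ni; rewrite (big_morph Posz PoszD (erefl _)).
      apply: eq_bigr => j _; rewrite (big_morph Posz PoszD (erefl _)).
      apply: eq_big => [l|l _]; last by rewrite !mxE PoszM.
      by rewrite [(i < n)%N]ltnNge ni.
    + by move=> i; rewrite -leqNgt.
  - rewrite (big_morph Posz PoszD (erefl _)) [RHS]big_mkcond; apply: eq_bigr => i _.
    rewrite (big_morph Posz PoszD (erefl _)).
    by case: ifP => ni //=; rewrite big_pred0.
have F3E : 2 * F3 = \sum_(i < N | (n <= i)%N) (T i - L i).
  rewrite /F3 mulr_sumr; apply: eq_bigr => i _; rewrite mulr_sumr -sumrB.
  apply: eq_bigr => j _; rewrite !mxE.
  have : (val A i j * (val A i j).-1)%N = ((val A i j * (val A i j).-1)./2).*2.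
    by case: (nat_of_ord (val A i j)) => // m; rewrite -[LHS]odd_double_half oddM /= andNb.
  by case: (nat_of_ord (val A i j)) => // m /=; nia.
have diagE : \sum_(i < N | (i < n)%N) R i i = \sum_(i < N | (n < i)%N) R i i.
  rewrite rev_sum; apply: eq_big => [i|i _]; last exact: R_rev.
  by rewrite /=; have := ltn_ord i; lia.
have mid (f : 'I_N -> int) : \sum_(i < N | (n <= i)%N) f i = f (inord n) + \sum_(i < N | (n < i)%N) f i.
  have nN : (n < N)%N by lia.
  rewrite (bigD1 (inord n)) /= ?inordK //; congr (_ + _); apply: eq_bigl => i.
  by rewrite -(inj_eq val_inj) /= inordK //; lia.
have totE : \sum_(i < N) \sum_(k < N | (k <= i)%N) R i k =
    \sum_(i < N) \sum_(k < N | (k < i)%N) R i k + \sum_(i < N) R i i.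
  rewrite -big_split; apply: eq_bigr => i _ /=; rewrite (bigD1 i) //= addrC; congr (_ + _).
  by apply: eq_bigl => k; rewrite ltn_neqAle andbC.
have allE : \sum_(i < N) R i i = R (inord n) (inord n) + 2 * \sum_(i < N | (n < i)%N) R i i.
  rewrite (bigID (fun i : 'I_N => (i < n)%N)) /= diagE (eq_bigl (fun i : 'I_N => (n <= i)%N)).
    by rewrite mid; ring.
  by move=> i; rewrite -leqNgt.
have nE : R (inord n) (inord n) = 2 * P (inord n) + T (inord n).
  rewrite -R_corner; congr R; apply: val_inj; rewrite /= inordK; lia.
have cornerE : corner_sum M = \sum_(i < N | (n <= i)%N) L i by [].
have sumC : \sum_(i < N | (n < i)%N) R i (rev_ord i)
   = 2 * (\sum_(i < N | (n < i)%N) P i) + \sum_(i < N | (n < i)%N) T i.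
  by rewrite mulr_sumr -big_split; apply: eq_bigr => i _; rewrite R_corner.
rewrite dE !mulrDr F3E sumrB totE allE nE -first_sum sumC cornerE /F2 diagE !mid /F1.
ring.
Qed.

End DimA.

(** * Structure polynomials *)

Lemma odd_finField_exists k : (0 < k)%N -> exists F : finFieldType, #|F| = (3 ^ k)%N.
Proof. by move=> k0; case: (PrimePowerField (isT : prime 3) k0) => F _ cF; exists F. Qed.

(** The orders 3^k already give more roots of the difference than its degree allows. *)
Lemma poly_eq_odd_cards (p1 p2 : {poly int}) :
  (forall F : finFieldType, odd #|F| -> p1.[#|F|%:R] = p2.[#|F|%:R]) -> p1 = p2.
Proof.
move=> h; apply/eqP; rewrite -subr_eq0; apply: contraT => p0.
pose s : seq int := [seq (3 ^ i.+1)%N%:R | i <- iota 0 (size (p1 - p2))].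
have /(max_poly_roots p0) : all (root (p1 - p2)) s.
  apply/allP=> _ /mapP[i _ ->]; have [F cF] := odd_finField_exists (ltn0Sn i).
  by rewrite rootE hornerD hornerN -cF h ?subrr // cF oddX.
rewrite size_map size_iota ltnn => -> //.
rewrite map_inj_uniq ?iota_uniq // => i j /eqP.
by rewrite eqr_nat eqn_exp2l // eqSS => /eqP.
Qed.

Section StructureConstants.
Variables (n : nat) (g : forall d, Xi n d -> Xi n d -> Xi n d -> {poly int}).
Hypothesis g_spec : structure_polynomials g.
Variable d : nat.
Implicit Types A B C E : Xi n d.
Local Notation gd := (g (d := d)).

(** Both sides count the pairs (S', S) such that V, S', S, W are successively in positions A, A',
    A'', where (V, W) is a fixed pair in position E. Summing over B imposes nothing, since any two
    flags are in exactly one position. *)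
Lemma structure_assoc A A' A'' E :
  \sum_B gd A A' B * gd B A'' E = \sum_B gd A' A'' B * gd A B E.
Proof.
apply: poly_eq_odd_cards => F F_odd.
have [J [V [W [[Js Ju] [Vf Wf] EVW _]]]] := card_adjacent E F_odd.
pose X := isotropic_flags (F := F) n J.
have cnt A1 A2 A3 (V1 V2 : flag F n d.*2.+1) : V1 \in X -> V2 \in X -> in_orbit A3 V1 V2 ->
  (gd A1 A2 A3).[#|F|%:R] = (\sum_(S in X) (in_orbit A1 V1 S && in_orbit A2 S V2))%N%:R.
  move=> V1X V2X h; rewrite (g_spec F_odd Js Ju A1 A2 V1X V2X h) -sum1_card; congr (_%:R).
  rewrite [RHS]big_mkcond [LHS]big_mkcond; apply: eq_bigr => S _; rewrite inE.
  by case: (S \in _) => //=; case: (_ && _).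
have one (V1 V2 : flag F n d.*2.+1) : V1 \in X -> V2 \in X -> (\sum_(B : Xi n d) in_orbit B V1 V2)%N = 1%N.
  move=> V1X V2X; have [B0 h] := relpos_exists Js Ju V1X V2X.
  rewrite (bigD1 B0) //= h big1 // => B BB0; apply/eqP; rewrite eqb0.
  by apply: contra BB0 => h'; rewrite (in_orbit_inj h' h).
rewrite !horner_sum.
pose tot := (\sum_(S in X) \sum_(S' in X)
   [&& in_orbit A V S', in_orbit A' S' S & in_orbit A'' S W])%N.
transitivity (tot%:R : int).
  transitivity ((\sum_(B : Xi n d) \sum_(S in X) \sum_(S' in X)
     in_orbit B V S * [&& in_orbit A V S', in_orbit A' S' S & in_orbit A'' S W])%N%:R : int).
    rewrite natr_sum; apply: eq_bigr => B _; rewrite hornerM (cnt B A'' E V W) //.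
    rewrite natr_sum mulr_sumr natr_sum; apply: eq_bigr => S SX.
    have [BS|BS] /= := boolP (in_orbit B V S); last first.
      by rewrite mulr0 big1.
    rewrite (cnt A A' B V S) // -natrM big_distrl; congr (_%:R); apply: eq_bigr => S' _ /=.
    by rewrite mul1n mulnb andbA.
  congr (_%:R); rewrite exchange_big; apply: eq_bigr => S SX.
  rewrite exchange_big; apply: eq_bigr => S' _ /=.
  by rewrite -big_distrl /= one // mul1n.
rewrite /tot exchange_big /=.
transitivity ((\sum_(B : Xi n d) \sum_(S' in X) \sum_(S in X)
     in_orbit B S' W * [&& in_orbit A V S', in_orbit A' S' S & in_orbit A'' S W])%N%:R : int).
  congr (_%:R); apply: esym; rewrite exchange_big; apply: eq_bigr => S SX.
  rewrite exchange_big; apply: eq_bigr => S' _ /=.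
  by rewrite -big_distrl /= one // mul1n.
rewrite natr_sum; apply: eq_bigr => B _; rewrite hornerM (cnt A B E V W) //.
rewrite [in RHS]natr_sum mulr_sumr natr_sum; apply: eq_bigr => S SX.
have [BS|BS] /= := boolP (in_orbit B S W); last first.
  by rewrite andbF mulr0 big1.
rewrite (cnt A' A'' B S W) // -natrM big_distrl; congr (_%:R); apply: eq_bigr => S' _ /=.
by rewrite mul1n andbT mulnb andbC.
Qed.

Lemma structure_eq0 A B C : ~~ [&& ro (Xi_mx C) == ro (Xi_mx B),
   co (Xi_mx A) == co (Xi_mx B) & co (Xi_mx C) == ro (Xi_mx A)] -> gd C A B = 0.
Proof.
move=> h; apply: poly_eq_odd_cards => F F_odd.
have [J [V [W [[Js Ju] [Vf Wf] BVW _]]]] := card_adjacent B F_odd.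
rewrite (g_spec F_odd Js Ju C A Vf Wf BVW) horner0; apply/eqP; rewrite pnatr_eq0 cards_eq0.
apply: contraR h => /set0Pn[S]; rewrite inE => /and3P[Sf CS AS].
by rewrite (orbit_ro Vf Wf Sf BVW CS) (orbit_co Vf Wf Sf BVW AS) (orbit_co_ro Vf Wf Sf CS AS) !eqxx.
Qed.

Lemma structure_diag A B C : is_diag_mx (Xi_mx C) -> co (Xi_mx C) = ro (Xi_mx A) ->
  gd C A B = (A == B)%:R.
Proof.
move=> dC coC; apply: poly_eq_odd_cards => F F_odd.
have [J [V [W [[Js Ju] [Vf Wf] BVW _]]]] := card_adjacent B F_odd.
rewrite (g_spec F_odd Js Ju C A Vf Wf BVW).
have [AB|AB] := eqVneq A B; last first.
  rewrite horner0; apply/eqP; rewrite pnatr_eq0 cards_eq0; apply: contraNT AB => /set0Pn[S].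
  rewrite inE => /and3P[Sf CS AS]; move: AS; rewrite (orbit_diag Vf Sf CS dC) => AS.
  by rewrite (in_orbit_inj AS BVW).
rewrite hornerC (_ : [set _ in _ | _] = [set V]) ?cards1 //.
apply/setP=> S; rewrite in_set in_set1; apply/and3P/eqP => [[Sf CS AS]|->]; first exact: (orbit_diag Vf Sf CS dC).
split; rewrite ?AB //; apply/(in_orbitP _ Vf Vf) => i j iN jN.
have rV k : (k <= n.*2.+1)%N -> (\rank (fl V k))%:Z = cum (Xi_mx C) k n.*2.+1.
  move=> kN; rewrite (rank_flag_ro Vf Wf BVW) // -AB cum_ro -coC -cum_co.
  by rewrite cum_diag // (minn_idPr kN).
rewrite cum_diag // -rV; last by rewrite geq_min iN.
congr Posz; rewrite /rk; have [ij|ij] := leqP i j.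
  have s : (fl V i <= fl V j)%MS by apply: (flagS Vf); rewrite ij.
  by apply/eqP; rewrite eqn_leq !mxrankS ?capmxSl // sub_capmx submx_refl.
have s : (fl V j <= fl V i)%MS by apply: (flagS Vf); rewrite ltnW.
by apply/eqP; rewrite eqn_leq !mxrankS ?capmxSr // sub_capmx submx_refl s.
Qed.

Variables (a b : 'I_(n.*2.+1)).
Hypothesis ab : b = a.+1 :> nat.

Lemma structure_adjacent A B C u : is_diag_mx (Xi_mx C - Etheta b a) ->
  ro (Xi_mx C) = ro (Xi_mx B) -> Xi_mx A = Xi_mx B + (Etheta a u - Etheta b u) ->
  gd C A B * ('X - 1) =
    'X^(\sum_(l < n.*2.+1 | (l < u)%N) val A b l) * ('X^((val A b u).+1) - 1).
Proof.
move=> dC roC AB; apply: poly_eq_odd_cards => F F_odd.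
have [J [V [W [[Js Ju] [Vf Wf] BVW h]]]] := card_adjacent B F_odd.
rewrite !hornerE (g_spec F_odd Js Ju C A Vf Wf BVW).
have F0 : (0 < #|F|)%N by apply: ltnW; apply: card_finNzRing_gt1.
have := h a b u A C ab dC roC AB => /(congr1 (fun k : nat => k%:R : int)).
by rewrite !natrM !natrB ?expn_gt0 ?F0 // !natrX.
Qed.

Lemma structure_nonadjacent A B C : is_diag_mx (Xi_mx C - Etheta b a) ->
  (forall u, Xi_mx A != Xi_mx B + (Etheta a u - Etheta b u)) -> gd C A B = 0.
Proof.
move=> dC h; apply: poly_eq_odd_cards => F F_odd.
have [J [V [W [[Js Ju] [Vf Wf] BVW _]]]] := card_adjacent B F_odd.
rewrite (g_spec F_odd Js Ju C A Vf Wf BVW) horner0; apply/eqP; rewrite pnatr_eq0 cards_eq0.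
apply/negPn/negP => /set0Pn[S]; rewrite inE => /and3P[Sf CS AS].
have [u e] := orbit_adjacent_exists Js Ju Vf Wf Sf BVW CS AS ab dC.
by have /eqP := h u.
Qed.

End StructureConstants.

(** * The Schur algebra over Q(v) *)

Lemma laurent_val_inj : injective laurent_val.
Proof. exact: val_inj. Qed.

Lemma laurent_valM x y : laurent_val (x * y) = laurent_val x * laurent_val y.
Proof. exact: (rmorphM (\val : laurent -> Qv)). Qed.

Lemma laurent_val_sum I (r : seq I) (P : pred I) (f : I -> laurent) :
  laurent_val (\sum_(i <- r | P i) f i) = \sum_(i <- r | P i) laurent_val (f i).
Proof. exact: (rmorph_sum (\val : laurent -> Qv)). Qed.

Lemma laurent_val_nat k : laurent_val k%:R = k%:R.
Proof. exact: (rmorph_nat (\val : laurent -> Qv)). Qed.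

Lemma laurent_val_horner (p : {poly int}) (x : laurent) :
  laurent_val (map_poly intr p).[x] = (map_poly intr p).[laurent_val x].
Proof.
rewrite -[LHS](horner_map (\val : laurent -> Qv)) -map_poly_comp; congr (_.[_]).
by apply: eq_map_poly => k; exact: (rmorph_int (\val : laurent -> Qv)).
Qed.

Lemma v_expf_neq1 k : (0 < k)%N -> v ^+ k != 1.
Proof.
move=> k0; rewrite /v -rmorphXn -[1](rmorph1 (@FracField.tofrac _)) /= tofrac_eq.
apply/eqP=> h; have := congr1 (size : {poly rat} -> nat) h.
by rewrite size_polyXn size_poly1 => -[k1]; rewrite k1 in k0.
Qed.

Lemma Xi_mx_inj n d : injective (@Xi_mx n d).
Proof.
move=> A B /matrixP e; apply/val_inj/matrixP=> i j; apply: val_inj => /=.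
by have := e i j; rewrite !mxE => -[].
Qed.

Section SchurQ.
Variables (n : nat) (g : forall d, Xi n d -> Xi n d -> Xi n d -> {poly int}).
Hypothesis g_spec : structure_polynomials g.
Variable d : nat.
Implicit Types A B C : Xi n d.
Local Notation gd := (g (d := d)).

(** The regular module [Qv^o] as codomain makes these functions a module over Q(v). *)
Definition schurQ := {ffun Xi n d -> Qv^o}.

Definition schur_to_Q (x : schur n d) : schurQ := [ffun C => laurent_val (x C)].

Definition struct A B C : Qv := (map_poly intr (gd A B C)).[v ^+ 2].

Definition schurQ_mul (x y : schurQ) : schurQ :=
  [ffun C => \sum_A \sum_B x A * y B * struct A B C].

Lemma schur_to_Q_mul x y :
  schur_to_Q (schur_mul gd x y) = schurQ_mul (schur_to_Q x) (schur_to_Q y).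
Proof.
apply/ffunP=> C; rewrite !ffunE laurent_val_sum; apply: eq_bigr => A _.
rewrite laurent_val_sum; apply: eq_bigr => B _.
by rewrite !laurent_valM laurent_val_horner !ffunE; congr (_ * _.[_]).
Qed.

Lemma schurQ_mulDl x y z : schurQ_mul (x + y) z = schurQ_mul x z + schurQ_mul y z.
Proof.
apply/ffunP=> C; rewrite !ffunE -big_split; apply: eq_bigr => A _ /=.
by rewrite -big_split; apply: eq_bigr => B _ /=; rewrite ffunE !mulrDl.
Qed.

Lemma schurQ_mulDr x y z : schurQ_mul x (y + z) = schurQ_mul x y + schurQ_mul x z.
Proof.
apply/ffunP=> C; rewrite !ffunE -big_split; apply: eq_bigr => A _ /=.
by rewrite -big_split; apply: eq_bigr => B _ /=; rewrite ffunE mulrDr mulrDl.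
Qed.

Lemma schurQ_scaleE c (x : schurQ) C : (c *: x) C = (c : Qv) * x C.
Proof. by rewrite ffunE. Qed.

Lemma schurQ_mulZl c x y : schurQ_mul (c *: x) y = c *: schurQ_mul x y.
Proof.
apply/ffunP=> C; rewrite schurQ_scaleE !ffunE mulr_sumr; apply: eq_bigr => A _ /=.
by rewrite mulr_sumr; apply: eq_bigr => B _ /=; rewrite schurQ_scaleE !mulrA.
Qed.

Lemma schurQ_mulZr c x y : schurQ_mul x (c *: y) = c *: schurQ_mul x y.
Proof.
apply/ffunP=> C; rewrite schurQ_scaleE !ffunE mulr_sumr; apply: eq_bigr => A _ /=.
rewrite mulr_sumr; apply: eq_bigr => B _ /=.
by rewrite schurQ_scaleE mulrCA !mulrA.
Qed.

Lemma struct_assoc A A' A'' E :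
  \sum_B struct A' A'' B * struct A B E = \sum_B struct A A' B * struct B A'' E.
Proof.
have := structure_assoc g_spec A A' A'' E.
move=> /(congr1 (fun p : {poly int} => (map_poly intr p : {poly Qv}).[v ^+ 2])).
rewrite !rmorph_sum !horner_sum /= => e.
transitivity (\sum_B ((map_poly intr (gd A A' B * gd B A'' E)) : {poly Qv}).[v ^+ 2]).
  by rewrite e; apply: eq_bigr => B _; rewrite rmorphM hornerM.
by apply: eq_bigr => B _; rewrite rmorphM hornerM.
Qed.

Lemma structQ_assoc (x y z : Xi n d -> Qv) E :
  \sum_A \sum_B x A * (\sum_A' \sum_A'' y A' * z A'' * struct A' A'' B) * struct A B E =
  \sum_B \sum_A'' (\sum_A \sum_A' x A * y A' * struct A A' B) * z A'' * struct B A'' E.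
Proof.
transitivity (\sum_A \sum_A' \sum_A'' x A * y A' * z A'' * \sum_B struct A' A'' B * struct A B E).
  apply: eq_bigr => A _.
  transitivity (\sum_B \sum_A' \sum_A'' x A * y A' * z A'' * (struct A' A'' B * struct A B E)).
    apply: eq_bigr => B _; rewrite mulr_sumr mulr_suml; apply: eq_bigr => A' _.
    rewrite mulr_sumr mulr_suml; apply: eq_bigr => A'' _.
    by rewrite !mulrA.
  rewrite exchange_big; apply: eq_bigr => A' _ /=.
  rewrite exchange_big; apply: eq_bigr => A'' _ /=.
  by rewrite mulr_sumr.
transitivity (\sum_A \sum_A' \sum_A'' \sum_B x A * y A' * z A'' * (struct A A' B * struct B A'' E)).
  apply: eq_bigr => A _; apply: eq_bigr => A' _; apply: eq_bigr => A'' _.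
  by rewrite struct_assoc mulr_sumr.
transitivity (\sum_B \sum_A'' \sum_A \sum_A' x A * y A' * z A'' * (struct A A' B * struct B A'' E)).
  transitivity (\sum_B \sum_A \sum_A' \sum_A'' x A * y A' * z A'' * (struct A A' B * struct B A'' E)).
    rewrite [RHS]exchange_big; apply: eq_bigr => A _ /=.
    rewrite [RHS]exchange_big; apply: eq_bigr => A' _ /=.
    by rewrite [RHS]exchange_big.
  apply: eq_bigr => B _; rewrite [RHS]exchange_big; apply: eq_bigr => A _ /=.
  by rewrite [RHS]exchange_big.
apply: eq_bigr => B _; apply: eq_bigr => A'' _; rewrite -mulrA mulr_suml.
apply: eq_bigr => A _; rewrite mulr_suml; apply: eq_bigr => A' _.
by rewrite -!mulrA; congr (_ * (_ * _)); rewrite mulrCA.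
Qed.

Lemma schurQ_mulA x y z : schurQ_mul x (schurQ_mul y z) = schurQ_mul (schurQ_mul x y) z.
Proof.
apply/ffunP=> E; rewrite [LHS]ffunE [RHS]ffunE.
transitivity (\sum_A \sum_B x A * (\sum_A' \sum_A'' y A' * z A'' * struct A' A'' B) * struct A B E : Qv).
  by apply: eq_bigr => A _; apply: eq_bigr => B _; rewrite ffunE.
rewrite structQ_assoc; apply: eq_bigr => B _; apply: eq_bigr => A'' _.
by rewrite ffunE.
Qed.

(** The value is 0 when M does not come from Xi_d, so inadmissible terms of a sum vanish by
    themselves. *)
Definition stdQ (M : 'M[int]_(n.*2.+1)) : schurQ := schur_to_Q (schur_std d M).

Lemma stdQE M C : stdQ M C = if Xi_mx C == M then v ^ (- (dimA C)%:Z) else 0.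
Proof.
rewrite ffunE /schur_std; case: pickP => [A /eqP AM|noA]; last first.
  by rewrite ffunE noA.
rewrite ffunE laurent_valM /schur_e ffunE -AM (inj_eq (@Xi_mx_inj n d)).
rewrite laurent_val_nat; case: eqP => [->|_]; first by rewrite mulr1.
by rewrite mulr0.
Qed.

Lemma stdQ_notin M : ~~ in_Xi d M -> stdQ M = 0.
Proof.
move=> h; apply/ffunP=> C; rewrite stdQE [RHS]ffunE; case: eqP => // e.
by case/negP: h; apply/existsP; exists C; rewrite e.
Qed.

Lemma schurQ_mul_std A B C :
  schurQ_mul (stdQ (Xi_mx A)) (stdQ (Xi_mx B)) C
  = v ^ (- (dimA A)%:Z) * v ^ (- (dimA B)%:Z) * struct A B C.
Proof.
rewrite ffunE (bigD1 A) //= [X in _ + X]big1 ?addr0 => [|A' /negbTE AA']; last first.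
  apply: big1 => B' _; rewrite stdQE (inj_eq (@Xi_mx_inj n d)) AA' !mul0r //.
rewrite (bigD1 B) //= [X in _ + X]big1 ?addr0 => [|B' /negbTE BB']; last first.
  by rewrite (stdQE _ B') (inj_eq (@Xi_mx_inj n d)) BB' mulr0 mul0r.
by rewrite !stdQE !eqxx.
Qed.

Lemma schurQ_mul_std0 A B : co (Xi_mx A) != ro (Xi_mx B) ->
  schurQ_mul (stdQ (Xi_mx A)) (stdQ (Xi_mx B)) = 0.
Proof.
move=> h; apply/ffunP=> C; rewrite schurQ_mul_std ffunE /struct.
by rewrite (structure_eq0 g_spec) ?rmorph0 ?horner0 ?mulr0 // (negbTE h) !andbF.
Qed.

Lemma schurQ_mul_std_diag A C : is_diag_mx (Xi_mx C) -> co (Xi_mx C) = ro (Xi_mx A) ->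
  schurQ_mul (stdQ (Xi_mx C)) (stdQ (Xi_mx A)) = stdQ (Xi_mx A).
Proof.
move=> dC coC; apply/ffunP=> B; rewrite schurQ_mul_std /struct (structure_diag g_spec) //.
rewrite stdQE (inj_eq (@Xi_mx_inj n d)) eq_sym.
have -> : dimA C = 0%N.
  have := dimA_double C; rewrite fiber_dim2_diag // => /eqP.
  by rewrite mulf_eq0 /= => /eqP[].
rewrite expr0z mul1r; case: eqP => [->|_].
  by rewrite rmorph1 hornerC mulr1.
by rewrite rmorph0 horner0 mulr0.
Qed.

End SchurQ.

Lemma vexpD (i j : int) : v ^ (i + j) = v ^ i * v ^ j.
Proof. exact: (expfzDr _ _ v_neq0). Qed.

Lemma vexp_neq0 (i : int) : v ^ i != 0.
Proof. exact: (expfz_neq0 _ v_neq0). Qed.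

Lemma vexp_neq1 (i : int) : i != 0 -> v ^ i != 1.
Proof.
case: i => [[|k]|k] // _; first exact: v_expf_neq1.
by rewrite NegzE -exprnN invr_eq1 v_expf_neq1.
Qed.

Lemma bar_quotient (K : fieldType) (w : K) (x : nat) : w != 0 -> w ^+ 2 - 1 != 0 ->
  (w ^ (- (2 * (x%:Z + 1))) - 1) / (w ^ (-2) - 1)
  = w ^ (- (2 * x%:Z)) * ((w ^+ 2) ^+ x.+1 - 1) / (w ^+ 2 - 1).
Proof.
move=> w0 w1; have p0 := expfz_neq0 (2 * x%:Z) w0.
have -> : w ^ (- (2 * (x%:Z + 1))) = (w ^ (2 * x%:Z))^-1 * (w ^+ 2)^-1.
  by rewrite mulrDr opprD expfzDr // -!invr_expz.
have -> : w ^ (- (2 * x%:Z)) = (w ^ (2 * x%:Z))^-1 by rewrite -invr_expz.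
have -> : (w ^+ 2) ^+ x.+1 = w ^ (2 * x%:Z) * w ^+ 2.
  by rewrite exprSr -exprM -PoszM.
have -> : w ^ (-2) = (w ^+ 2)^-1 by [].
have w2 : w ^+ 2 != 0 by rewrite expf_neq0.
have w1' : 1 - w ^+ 2 != 0 by rewrite -opprB oppr_eq0.
move: w1 p0 w2 w1'; move: (w ^+ 2) (w ^ (2 * x%:Z)) => y p y1 p0 y0 y1'.
by field; rewrite y1 p0 y0 mulN1r.
Qed.

Lemma qint_barE (a : int) : qint_bar a = (v ^ (- (2 * a)) - 1) / (v ^ (-2) - 1).
Proof.
rewrite /qint_bar /qbin_bar /qbin big_nat1 mulr1 subrK -!exprz_inv //.
Qed.

Lemma qint_den_neq0 : v ^ (-2) - 1 != 0.
Proof. by rewrite subr_eq0 vexp_neq1. Qed.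

Lemma qint_bar_neq0 (a : int) : a != 0 -> qint_bar a != 0.
Proof.
move=> a0; rewrite qint_barE; apply: mulf_neq0.
  by rewrite subr_eq0; apply: vexp_neq1; lia.
by rewrite invr_neq0 // qint_den_neq0.
Qed.

Lemma qint_bar_split (a b : int) : qint_bar (a + b) = qint_bar a + v ^ (- (2 * a)) * qint_bar b.
Proof.
rewrite !qint_barE mulrDr opprD vexpD mulrA -mulrDl; congr (_ / _).
by rewrite mulrBr mulr1 [RHS]addrC addrA subrK.
Qed.

(** * Products with a generator in the Schur algebra *)

Section Chevalley.
Variable n : nat.
Local Notation N := (n.*2.+1).
Implicit Types M : 'M[int]_N.

(** For B = M + E^theta_{b,u} - E^theta_{a,u} and a generator C this is d_B - d_M - d_C + 2s, where
    s is the sum of row b of M up to column u included. The term 2s is the power of v split off when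
    the counting polynomial is written with a barred quantum integer. *)
Definition chev_exp M (a b u : 'I_N) : int :=
  \sum_(l < N | (l <= u)%N) M b l - \sum_(l < N | (l < u)%N) M a l
  + ((a == n :> nat) && (n < u))%N%:R.

Definition chev M (a b u : 'I_N) : Qv := v ^ chev_exp M a b u * qint_bar (M b u + 1).

Variables (g : forall d, Xi n d -> Xi n d -> Xi n d -> {poly int}).
Hypothesis g_spec : structure_polynomials g.
Variable d : nat.
Implicit Types A B C : Xi n d.
Variables (a b : 'I_N).
Hypothesis ab : b = a.+1 :> nat.

Lemma Etheta_diff_inj u u' : Etheta b u - Etheta a u = Etheta b u' - Etheta a u' -> u = u'.
Proof.
move=> h; have bN := ltn_ord b.
have e w j : cum (Etheta b w - Etheta a w) b j = - (w < j)%N%:R.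
  have := cum_Etheta_diff ab w b j.
  have -> : (b == N - b :> nat)%N = false by lia.
  by rewrite eqxx /= subr0 => <-; rewrite !cumB opprB.
apply/eqP; rewrite -(inj_eq val_inj) eqn_leq /=.
have := e u u.+1; rewrite h e ltnSn => /oppr_inj.
have := e u' u'.+1; rewrite -h e ltnSn => /oppr_inj.
by rewrite !ltnS; case: (u <= u')%N => // _; case: (u' <= u)%N.
Qed.

Lemma adjacent_ro C M u : is_diag_mx (Xi_mx C - Etheta b a) -> co (Xi_mx C) = ro M ->
  ro (Xi_mx C) = ro (M + (Etheta b u - Etheta a u)).
Proof. by move=> dC coC; rewrite (ro_offdiag dC) coC roD roB !ro_Etheta co_Etheta. Qed.

(** C arises from a diagonal matrix D0 by moving one unit, so [fiber_dim2_step] applied to D0 leaves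
    only the diagonal entry of D0 in row b, which is a column sum of C. *)
Lemma dimA_adjacent A C : is_diag_mx (Xi_mx C - Etheta b a) -> co (Xi_mx C) = ro (Xi_mx A) ->
  (dimA C)%:Z = \sum_l Xi_mx A b l.
Proof.
move=> dC coC; have bN := ltn_ord b; have aN := ltn_ord a.
pose D0 := Xi_mx C - Etheta b a + Etheta a a.
have cD0 : centrosymmetric D0.
  apply: centrosymmetricD; last exact: centrosymmetric_Etheta.
  apply: centrosymmetricD; first exact: Xi_centrosymmetric.
  apply: centrosymmetricN; exact: centrosymmetric_Etheta.
have dD0 : is_diag_mx D0.
  apply/is_diag_mxP=> i j ij; rewrite mxE (is_diag_mxP dC) // add0r /Etheta !mxE.
  have -> : (i == a) && (j == a) = false by apply/negP => /andP[/eqP i1 /eqP j1]; rewrite i1 j1 eqxx in ij.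
  have -> : (i == rev_ord a) && (j == rev_ord a) = false by apply/negP => /andP[/eqP i1 /eqP j1]; rewrite i1 j1 eqxx in ij.
  by [].
have CE : Xi_mx C = D0 + (Etheta b a - Etheta a a).
  by rewrite /D0 addrACA subrr addr0 subrK.
have D0off i j : i != j -> D0 i j = 0 by apply/is_diag_mxP.
have Dbb : D0 b b = \sum_l Xi_mx A b l.
  have <- : co (Xi_mx C) b 0 = \sum_l Xi_mx A b l by rewrite coC mxE.
  have ba : (b == a) = false by rewrite -(inj_eq val_inj) /= ab; lia.
  have bra : (b == rev_ord a) = false by rewrite -(inj_eq val_inj) /= ab; lia.
  have E0 k : (Etheta b a - Etheta a a) k b = 0 by rewrite /Etheta !mxE ba bra !andbF.
  rewrite [RHS]mxE (bigD1 b) //= big1 ?addr0.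
    by rewrite CE [RHS]mxE E0 addr0.
  by move=> k kb; rewrite CE mxE D0off // E0 addr0.
have := dimA_double C; rewrite CE fiber_dim2_step // fiber_dim2_diag // add0r.
have -> : \sum_(l < N | (l < a)%N) D0 a l = 0.
  by apply: big1 => l la; apply: D0off; rewrite -(inj_eq val_inj) neq_ltn la orbT.
have -> : \sum_(l < N | (a < l)%N) D0 b l = D0 b b.
  rewrite (bigD1 b) ?ab //= big1 ?addr0 // => l /andP[_ lb]; apply: D0off; by rewrite eq_sym.
rewrite Dbb; move: (\sum_l _) => s; lia.
Qed.

Lemma schurQ_chevalley A C : is_diag_mx (Xi_mx C - Etheta b a) -> co (Xi_mx C) = ro (Xi_mx A) ->
  schurQ_mul g (stdQ d (Xi_mx C)) (stdQ d (Xi_mx A)) =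
  \sum_u chev (Xi_mx A) a b u *: stdQ d (Xi_mx A + (Etheta b u - Etheta a u)).
Proof.
move=> dC coC; apply/ffunP=> B; rewrite schurQ_mul_std sum_ffunE.
have [/existsP[u /eqP Bu]|/existsPn noB] :=
  boolP [exists u, Xi_mx B == Xi_mx A + (Etheta b u - Etheta a u)]; last first.
  rewrite big1 => [|u _]; last by rewrite schurQ_scaleE stdQE (negbTE (noB u)) mulr0.
  rewrite /struct (structure_nonadjacent g_spec ab dC) ?rmorph0 ?horner0 ?mulr0 // => u.
  apply: contra (noB u) => /eqP ->.
  by rewrite -(opprB (Etheta b u)) subrK.
rewrite (bigD1 u) //= big1 ?addr0 => [|u' u'u]; last first.
  rewrite schurQ_scaleE stdQE; case: eqP => [e|_]; last by rewrite mulr0.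
  by case/eqP: u'u; apply: Etheta_diff_inj; apply: (addrI (Xi_mx A)); rewrite -e Bu.
rewrite schurQ_scaleE stdQE Bu eqxx.
have AB : Xi_mx A = Xi_mx B + (Etheta a u - Etheta b u).
  by rewrite Bu -(opprB (Etheta b u)) addrK.
have roC : ro (Xi_mx C) = ro (Xi_mx B) by rewrite Bu; apply: adjacent_ro.
have := structure_adjacent g_spec ab dC roC AB.
set al := (\sum_(l < _ | _) _)%N; set x := (val A b u : nat).
move=> /(congr1 (fun p : {poly int} => (map_poly intr p : {poly Qv}).[v ^+ 2])).
rewrite !rmorphM !rmorphB /= !map_polyXn map_polyX rmorph1 !hornerE -/(struct g C A B) => hs.
have dB : (dimA B)%:Z = (dimA A)%:Z + (\sum_(l < N | (u < l)%N) Xi_mx A b l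
    - \sum_(l < N | (l < u)%N) Xi_mx A a l + ((a == n :> nat) && (n < u))%N%:R).
  have := dimA_double B; rewrite Bu fiber_dim2_step ?Xi_centrosymmetric // -dimA_double.
  set s := (_ - _ + _); lia.
have dC' := dimA_adjacent dC coC.
have xE : Xi_mx A b u = x%:Z by rewrite mxE.
have alE : al%:Z = \sum_(l < N | (l < u)%N) Xi_mx A b l.
  by rewrite /al (big_morph Posz PoszD (erefl _)); apply: eq_bigr => l _; rewrite mxE.
have sumE : \sum_l Xi_mx A b l = al%:Z + x%:Z + \sum_(l < N | (u < l)%N) Xi_mx A b l.
  rewrite (bigID (fun l : 'I_N => (l < u)%N)) /= -alE -addrA; congr (_ + _).
  rewrite (bigD1 u) ?ltnn //= xE; congr (_ + _); apply: eq_bigl => l.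
  by rewrite -leqNgt ltn_neqAle eq_sym andbC.
have leE : \sum_(l < N | (l <= u)%N) Xi_mx A b l = al%:Z + x%:Z.
  rewrite (bigD1 u) //= xE addrC alE; congr (_ + _); apply: eq_bigl => l.
  by rewrite ltn_neqAle andbC.
rewrite /chev /chev_exp leE xE dB dC' sumE qint_barE.
set s1 := \sum_(l < N | (u < l)%N) _; set s2 := \sum_(l < N | (l < u)%N) _.
set s3 := _%:R; set dA := (dimA A)%:Z.
have v2 : v ^+ 2 - 1 != 0 :> Qv by rewrite subr_eq0; apply: v_expf_neq1.
have -> : struct g C A B = (v ^+ 2) ^+ al * ((v ^+ 2) ^+ x.+1 - 1) / (v ^+ 2 - 1).
  by rewrite -hs mulfK.
have e1 : (v ^ (- (2 * (x%:Z + 1))) - 1) / (v ^ (-2) - 1) =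
   v ^ (- (2 * x%:Z)) * ((v ^+ 2) ^+ x.+1 - 1) / (v ^+ 2 - 1).
  exact: bar_quotient v_neq0 v2.
rewrite e1; have -> : (v ^+ 2) ^+ al = v ^ (2 * al%:Z) by rewrite -exprM -PoszM.
set Z := (_ ^+ x.+1 - 1); set Y := (v ^+ 2 - 1).
have assoc (p q z y : Qv) : p * (q * z / y) = p * q * (z / y) by rewrite !mulrA.
rewrite !assoc -[RHS]mulrA [_ / _ * _ in RHS]mulrC [RHS]mulrA -!vexpD.
by congr (v ^ _ * _); rewrite /dA; ring.
Qed.

End Chevalley.

(** * The matrices of K *)

Section XitTheory.
Variable n : nat.
Local Notation N := (n.*2.+1).
Implicit Types (M : 'M[int]_N) (A B C Z : Xit n).

Lemma center_lt : (n < N)%N. Proof. by rewrite ltnS -addnn leq_addr. Qed.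

Lemma in_XitP M :
  reflect [/\ forall i j, i != j -> 0 <= M i j, ~~ (2 %| M (inord n) (inord n))%Z &
              centrosymmetric M] (in_Xit M).
Proof.
apply: (iffP and3P) => -[h1 h2 h3]; split=> //.
  by move=> i j ij; have /forallP/(_ j)/implyP := forallP h1 i; apply.
by apply/forallP=> i; apply/forallP=> j; apply/implyP; exact: h1.
Qed.

Lemma Xit_off A i j : i != j -> 0 <= val A i j.
Proof. by case/in_XitP: (valP A) => h _ _; apply: h. Qed.

Lemma Xit_sym A : centrosymmetric (val A).
Proof. by case/in_XitP: (valP A). Qed.

Lemma EthetaE (x y i j : 'I_N) :
  Etheta x y i j = ((i == x :> nat) && (j == y :> nat))%N%:R
                 + ((i + x == n.*2) && (j + y == n.*2))%N%:R.
Proof.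
rewrite /Etheta !mxE -!(inj_eq val_inj) /=; congr (_ + (_ && _)%:R).
  by have := ltn_ord x; have := ltn_ord i; lia.
by have := ltn_ord y; have := ltn_ord j; lia.
Qed.

(** A unit at the centre is its own mirror image and is counted twice. Moves thus preserve the
    parity of the central entry. *)
Lemma Etheta_center_even (x y : 'I_N) : (2 %| Etheta x y (inord n) (inord n))%Z.
Proof. by rewrite EthetaE !inordK ?center_lt //; lia. Qed.

Lemma in_Xit_step A (x y x' y' : 'I_N) :
  (forall i j, i != j -> 0 <= (val A + (Etheta x y - Etheta x' y')) i j) ->
  in_Xit (val A + (Etheta x y - Etheta x' y')).
Proof.
move=> h; have /in_XitP[_ o c] := valP A; apply/in_XitP; split=> //.
  have -> : (val A + (Etheta x y - Etheta x' y')) (inord n) (inord n) = val A (inord n) (inord n)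
      + (Etheta x y (inord n) (inord n) - Etheta x' y' (inord n) (inord n)).
    by rewrite [LHS]mxE [X in _ + X]mxE [X in _ + (_ + X)]mxE.
  have := Etheta_center_even x y; have := Etheta_center_even x' y'.
  move: o; move: (val A _ _) (Etheta x y _ _) (Etheta x' y' _ _) => p q r; lia.
by apply: centrosymmetricD => //; apply: centrosymmetricD; rewrite ?centrosymmetricN // centrosymmetric_Etheta.
Qed.

Definition dist2 M : int := \sum_i \sum_j M i j * ((i : nat)%:Z - (j : nat)%:Z) ^+ 2.

Lemma dist2D M M' : dist2 (M + M') = dist2 M + dist2 M'.
Proof.
rewrite /dist2 -big_split; apply: eq_bigr => i _ /=; rewrite -big_split.
by apply: eq_bigr => j _ /=; rewrite mxE mulrDl.
Qed.

Lemma dist2N M : dist2 (- M) = - dist2 M.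
Proof.
rewrite /dist2 -sumrN; apply: eq_bigr => i _ /=; rewrite -sumrN.
by apply: eq_bigr => j _ /=; rewrite mxE mulNr.
Qed.

Lemma dist2_Etheta (x y : 'I_N) : dist2 (Etheta x y) = 2 * ((x : nat)%:Z - (y : nat)%:Z) ^+ 2.
Proof.
have d (r s : 'I_N) : dist2 (delta_mx r s) = ((r : nat)%:Z - (s : nat)%:Z) ^+ 2.
  rewrite /dist2 -[RHS](sum_delta (fun i j : 'I_N => ((i : nat)%:Z - (j : nat)%:Z) ^+ 2)).
  by apply: eq_bigr => i _; apply: eq_bigr => j _; rewrite mulrC.
rewrite /Etheta dist2D !d /=.
have -> : (N - x.+1)%N%:Z = n.*2%:Z - x%:Z by have := ltn_ord x; lia.
have -> : (N - y.+1)%N%:Z = n.*2%:Z - y%:Z by have := ltn_ord y; lia.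
ring.
Qed.

Lemma dist2_ge0 A : 0 <= dist2 (val A).
Proof.
apply: sumr_ge0 => i _; apply: sumr_ge0 => j _.
have [->|ij] := eqVneq i j; first by rewrite subrr expr0n mulr0.
by rewrite mulr_ge0 ?Xit_off ?sqr_ge0.
Qed.

(** The entries of the middle row pair up under reversal, except for the central one. *)
Lemma row_center_odd M : centrosymmetric M -> ~~ (2 %| M (inord n) (inord n))%Z ->
  ~~ (2 %| ro M (inord n) 0%R)%Z.
Proof.
move=> cM o.
have rn : rev_ord (inord n : 'I_N) = inord n.
  by apply: val_inj; rewrite /= inordK ?center_lt //; lia.
have [k] := sum_involution (f := fun j => M (inord n) j) (@rev_ordK N)
  (fun j => etrans (congr1 (fun i => M i (rev_ord j)) (esym rn)) (centrosymmetricE _ _ cM)).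
rewrite [X in _ = X + _](eq_bigl (pred1 (inord n))) ?big_pred1_eq.
  by rewrite mxE => ->; apply: contra o; lia.
move=> j /=; rewrite -!(inj_eq val_inj) /= inordK ?center_lt //; have := ltn_ord j; lia.
Qed.

Lemma Xit_row_center_odd A : ~~ (2 %| ro (val A) (inord n) 0%R)%Z.
Proof. by case/in_XitP: (valP A) => _ o c; apply: row_center_odd. Qed.

(** The matrix is the diagonal of the row sums of A plus R (E^theta_{b,a} - E^theta_{a,a}), the
    subtraction restoring the column sums. Diagonal entries may become negative, so only the parity
    of the centre is at stake. *)
Lemma generator_exists A (a b : 'I_N) (R : nat) : a != b ->
  exists C, is_diag_mx (val C - Etheta b a *+ R) /\ co (val C) = ro (val A).
Proof.
move=> ab; pose D0 : 'M[int]_N := diag_mx (\row_i ro (val A) i 0).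
have cD0 : centrosymmetric D0.
  apply/forallP=> i; apply/forallP=> j; rewrite !mxE (inj_eq rev_ord_inj).
  apply/eqP; congr (_ *+ _); rewrite [RHS](reindex_inj rev_ord_inj) /=.
  by apply: eq_bigr => k _; rewrite centrosymmetricE // Xit_sym.
pose C0 := D0 + (Etheta b a - Etheta a a) *+ R.
have C0P : in_Xit C0.
  apply/in_XitP; split.
  - move=> i j ij; rewrite mxE [D0 i j]mxE (negbTE ij) mulr0n add0r mulmxnE mxE.
    have -> : (- Etheta a a) i j = 0.
      rewrite mxE EthetaE; apply/eqP; rewrite oppr_eq0.
      by move: ij; rewrite -(inj_eq val_inj) /=; lia.
    by rewrite addr0 mulrn_wge0 // EthetaE addr_ge0 ?ler0n.
  - have -> : C0 (inord n) (inord n) = ro (val A) (inord n) 0%R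
        + (Etheta b a (inord n) (inord n) - Etheta a a (inord n) (inord n)) * R%:Z.
      rewrite [LHS]mxE [D0 _ _]mxE eqxx mulr1n [(\row__ _) _ _]mxE; congr (_ + _).
      by rewrite mulmxnE mxBE -mulr_natr natz.
    have := Xit_row_center_odd A; apply: contra.
    have := Etheta_center_even b a; have := Etheta_center_even a a.
    move: (Etheta b a _ _) (Etheta a a _ _) (ro _ _ _) => x y z.
    move=> /dvdzP[x' ->] /dvdzP[y' ->].
    have -> : (y' * 2 - x' * 2) * R%:Z = 2 * ((y' - x') * R%:Z) by ring.
    by move: (_ * R%:Z) => w; lia.
  - apply: centrosymmetricD => //; apply: centrosymmetricMn.
    by apply: centrosymmetricD; rewrite ?centrosymmetricN // centrosymmetric_Etheta.
exists (exist _ C0 C0P); rewrite /=; split.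
  have -> : C0 - Etheta b a *+ R = D0 - Etheta a a *+ R.
    by rewrite /C0 mulrnBl addrA addrAC addrK.
  apply/is_diag_mxP=> i j ij; rewrite mxBE [D0 i j]mxE mulmxnE.
  have -> : (i == j) = false by apply/negbTE.
  rewrite mulr0n sub0r EthetaE (_ : (_ && _) = false); last by move: ij => /=; lia.
  by rewrite (_ : (_ && _) = false) ?mul0rn ?oppr0 //; move: ij => /=; lia.
rewrite coD coMn coB !co_Etheta subrr mul0rn addr0.
apply/matrixP=> i j; rewrite (ord1 j) mxE (bigD1 i) //= big1 ?addr0.
  by rewrite mxE eqxx mulr1n mxE.
by move=> k /negbTE ki; rewrite mxE ki mulr0n.
Qed.

End XitTheory.

(** * The triangular induction *)

Section Induction.
Variable n : nat.
Local Notation N := (n.*2.+1).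
Implicit Types (M : 'M[int]_N) (A B C Z : Xit n).

(** Centrosymmetry carries entries above the diagonal below it, so a non-diagonal A has a nonzero
    entry below the diagonal; u is the leftmost column containing one. The vanishing to the left of
    u rules out unwanted terms in the induction. *)
Lemma lower_entry A : ~~ is_diag_mx (val A) ->
  exists a b u : 'I_N, [/\ b = a.+1 :> nat, (u <= a)%N, 1 <= val A b u &
    forall i w : 'I_N, (w < i)%N -> (w < u)%N -> val A i w = 0].
Proof.
move=> nd.
have [i [j [ji Aij]]] : exists i j : 'I_N, (j < i)%N /\ 0 < val A i j.
  have /existsP[i /existsP[j /andP[ij Aij]]] : [exists i : 'I_N, exists j : 'I_N, (i != j :> nat) && (val A i j != 0)].
    apply: contraR nd => /existsPn h; apply/is_diag_mxP=> i j ij.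
    by have /existsPn/(_ j) := h i; rewrite ij negbK => /eqP.
  have Ap : 0 < val A i j by rewrite lt_def Aij Xit_off.
  have [ji|ij'] := ltnP j i; first by exists i, j.
  exists (rev_ord i), (rev_ord j); rewrite centrosymmetricE ?Xit_sym //; split=> //=.
  have := ltn_ord i; have := ltn_ord j; lia.
have ex : exists u : nat, [exists i : 'I_N, exists j : 'I_N, [&& (j == u :> nat), (j < i)%N & 0 < val A i j]].
  by exists j; apply/existsP; exists i; apply/existsP; exists j; rewrite eqxx ji Aij.
case: (ex_minnP ex) => u0 /existsP[i0 /existsP[u /and3P[/eqP uu0 ui0 Au]]] umin.
have a0 : (i0.-1 < N)%N by have := ltn_ord i0; lia.
have ex' : exists b : nat, [exists i : 'I_N, [&& (i == b :> nat), (u < i)%N & 0 < val A i u]].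
  by exists i0; apply/existsP; exists i0; rewrite eqxx ui0 Au.
exists (Ordinal a0), i0, u; split=> /=; try lia.
- by rewrite -gtz0_ge1.
- move=> i' w wi wu; apply/eqP; rewrite -[_ == 0]negbK; apply/negP => Aw.
  have := umin w; rewrite -uu0 leqNgt wu /=.
  have Aw' : 0 < val A i' w by rewrite lt_def Aw Xit_off // -(inj_eq val_inj) neq_ltn wi orbT.
  by move/(_ (introT existsP (ex_intro _ i' (introT existsP (ex_intro _ w _))))); rewrite eqxx wi Aw' => /(_ isT).
Qed.

(* Induction on sum a_ij (i-j)^2: a non-diagonal A is the leading term of the
   product of a generator C and a smaller A', the other terms being smaller. *)
Lemma Xit_ind (P : Xit n -> Prop) :
  (forall A, is_diag_mx (val A) -> P A) ->
  (forall (A A' C : Xit n) (a b u : 'I_N), b = a.+1 :> nat -> u != b ->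
     is_diag_mx (val C - Etheta b a) -> co (val C) = ro (val A') ->
     val A = val A' + (Etheta b u - Etheta a u) -> 0 <= val A' b u -> P A' ->
     (forall (Z : Xit n) w, val Z = val A' + (Etheta b w - Etheta a w) -> w != u -> P Z) ->
     P A) ->
  forall A, P A.
Proof.
move=> Pdiag Pstep A.
move: {2}`|dist2 (val A)|%N (leqnn `|dist2 (val A)|) => k.
elim: k A => [|k IH] A Ak.
  apply: Pdiag; apply: contraT => /lower_entry[a [b [u [ab ua Abu _]]]].
  have : 0 < dist2 (val A).
    have t0 i j : 0 <= val A i j * ((i : nat)%:Z - (j : nat)%:Z) ^+ 2.
      have [->|ij] := eqVneq i j; first by rewrite subrr expr0n mulr0.
      by rewrite mulr_ge0 ?Xit_off ?sqr_ge0.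
    rewrite /dist2 (bigD1 b) //= (bigD1 u) //= -addrA ltr_wpDr //.
      by apply: addr_ge0; apply: sumr_ge0 => i _ //; apply: sumr_ge0.
    by rewrite pmulr_rgt0 ?(lt_le_trans _ Abu) // lt_def sqr_ge0 andbT expf_neq0 // subr_eq0 ab; lia.
  by have := dist2_ge0 A; move: Ak; lia.
have [/Pdiag //|/lower_entry[a [b [u [ab ua Abu Amin]]]]] := boolP (is_diag_mx (val A)).
have bN := ltn_ord b; have aN := ltn_ord a; have uN := ltn_ord u.
have A'P : in_Xit (val A + (Etheta a u - Etheta b u)).
  apply: in_Xit_step => i j ij; rewrite mxDE mxBE.
  have Ap := Xit_off A ij.
  have [/andP[/eqP ib /eqP ju]|h1] := boolP ((i == b :> nat) && (j == u :> nat))%N.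
    have eA : val A i j = val A b u by congr (val A _ _); apply: val_inj.
    by rewrite !EthetaE ib ju eA; move: Abu; lia.
  have [/andP[/eqP ib /eqP ju]|h2] := boolP ((i + b == n.*2) && (j + u == n.*2))%N.
    have eA : val A i j = val A b u.
      rewrite -(centrosymmetricE b u (Xit_sym A)); congr (val A _ _); apply: val_inj => /=; lia.
    rewrite [Etheta b u i j]EthetaE ib ju eA (negbTE h1) !eqxx.
    by rewrite EthetaE; move: Abu; lia.
  by rewrite !EthetaE (negbTE h1) (negbTE h2); move: Ap; clear; lia.
pose A' : Xit n := exist (fun M => in_Xit M) _ A'P.
have ab' : b != a by rewrite -(inj_eq val_inj) /= ab; lia.
have [C [dC coC]] : exists C, is_diag_mx (val C - Etheta b a *+ 1) /\ co (val C) = ro (val A').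
  by apply: generator_exists; rewrite eq_sym.
have AE : val A = val A' + (Etheta b u - Etheta a u).
  by rewrite /= -(opprB (Etheta b u)) subrK.
have A'bu : 0 <= val A' b u.
  rewrite [val A']/(val A + _) mxDE mxBE !EthetaE !eqxx; move: Abu ab ua; clear; lia.
(* With b = a+1 the added difference is 2(2(a-u)+1), which is positive for u <= a and decreasing in
   u. So A' is smaller than A, and terms with w > u are smaller as well. *)
have eA : dist2 (val A) = dist2 (val A') + (2 * ((b : nat)%:Z - (u : nat)%:Z) ^+ 2 - 2 * ((a : nat)%:Z - (u : nat)%:Z) ^+ 2).
  by rewrite AE (dist2D (val A')) (dist2D (Etheta b u)) dist2N !dist2_Etheta.
have g0 := dist2_ge0 A.
apply: (Pstep A A' C a b u) => //.
- by rewrite -(inj_eq val_inj) /= ab; lia.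
- apply: IH; have := dist2_ge0 A'; move: Ak eA; rewrite ab; clear -ua; nia.
- move=> Z w ZE wu; apply: IH.
  (* A term with w < u would take a unit from the entry (a,w) of A'. This entry lies below the
     diagonal to the left of column u and is zero. *)
  have uw : (u < w)%N.
    rewrite ltnNge leq_eqVlt negb_or -(inj_eq val_inj) in wu *; rewrite wu /=.
    apply/negP=> wltu.
    have aw : a != w by rewrite -(inj_eq val_inj) /=; lia.
    have wa : (w < a)%N by move: wltu ua; clear; lia.
    have := Xit_off Z aw; rewrite ZE mxDE mxBE [val A']/(val A + _) mxDE mxBE Amin //.
    rewrite !EthetaE !eqxx; move: wltu ua ab aN uN; clear; lia.
  have eZ : dist2 (val Z) = dist2 (val A') + (2 * ((b : nat)%:Z - (w : nat)%:Z) ^+ 2 - 2 * ((a : nat)%:Z - (w : nat)%:Z) ^+ 2).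
    by rewrite ZE (dist2D (val A')) (dist2D (Etheta b w)) dist2N !dist2_Etheta.
  have := dist2_ge0 Z; move: Ak eA eZ g0; rewrite ab; clear -uw; nia.
Qed.

End Induction.

(** * Maps out of free modules *)

Section Extension.
Variables (R : nzRingType) (X : choiceType) (V : zmodType).
Implicit Types (h : R -> X -> V) (x y : {freeg X / R}).

(** Only additivity of h in the coefficient is used, not linearity, so the same construction yields
    base changes along ring morphisms and bilinear products. *)
Definition fgsum h x : V := \sum_(A <- dom x) h (coeff A x) A.

Lemma fgsum_uniq h (s : seq X) x : (forall A, h 0 A = 0) -> uniq s -> {subset dom x <= s} ->
  fgsum h x = \sum_(A <- s) h (coeff A x) A.
Proof.
move=> h0 us sub; rewrite /fgsum [RHS](bigID (fun A => A \in dom x)) /= [X in _ + X]big1 ?addr0.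
  rewrite -[RHS]big_filter; apply: perm_big; apply: uniq_perm.
  - exact: uniq_dom.
  - exact: filter_uniq.
  - by move=> A; rewrite mem_filter; case: (boolP (A \in dom x)) => //= /sub ->.
by move=> A Ax; rewrite coeff_outdom.
Qed.

Lemma fgsumD h : (forall A, {morph h^~ A : c c' / c + c'}) -> {morph fgsum h : x y / x + y}.
Proof.
move=> hD x y; have h0 A : h 0 A = 0.
  by apply: (@addrI _ (h 0 A)); rewrite -hD !addr0.
pose s := undup (dom x ++ dom y ++ dom (x + y)).
have us : uniq s by apply: undup_uniq.
rewrite !(fgsum_uniq h0 us); last first.
- by move=> A; rewrite mem_undup !mem_cat => ->; rewrite ?orbT.
- by move=> A; rewrite mem_undup !mem_cat => ->; rewrite ?orbT.
- by move=> A; rewrite mem_undup !mem_cat => ->; rewrite ?orbT.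
by rewrite -big_split; apply: eq_bigr => A _; rewrite coeffD hD.
Qed.

Lemma fgsumU h c A : (forall A, h 0 A = 0) -> fgsum h << c *g A >> = h c A.
Proof.
move=> h0; have [->|c0] := eqVneq c 0.
  by rewrite freegU0 /fgsum dom0 big_nil h0.
by rewrite /fgsum domU // big_seq1 coeffU eqxx mulr1.
Qed.

Lemma fgsum0 h : fgsum h 0 = 0.
Proof. by rewrite /fgsum dom0 big_nil. Qed.

Lemma additive_ext (f f' : {freeg X / R} -> V) :
  {morph f : x y / x + y} -> {morph f' : x y / x + y} ->
  (forall c A, f << c *g A >> = f' << c *g A >>) -> f =1 f'.
Proof.
move=> fD fD' e x; rewrite -(freeg_sumE x).
have z (k : {freeg X / R} -> V) : {morph k : x y / x + y} -> k 0 = 0.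
  by move=> kD; apply: (@addrI _ (k 0)); rewrite -kD !addr0.
elim: (dom x) => [|A s IH]; first by rewrite big_nil !z.
by rewrite big_cons fD fD' IH e.
Qed.

End Extension.

Lemma freeg_scale (R : nzRingType) (X : choiceType) (c k : R) (A : X) :
  c *: << k *g A >> = << (c * k) *g A >>.
Proof.
by apply/eqP/freeg_eqP => B; rewrite coeffZ !coeffU mulrA.
Qed.

Section Bilinear.
Variables (R : comNzRingType) (X : choiceType) (m : X -> X -> {freeg X / R}).
Local Notation FG := {freeg X / R}.
Implicit Types x y z : FG.

Definition fgmul x y : FG :=
  fgsum (fun c A => fgsum (fun c' B => (c * c') *: m A B) y) x.

Lemma fgmul_termDr c A : {morph fgsum (fun c' B => (c * c') *: m A B) : y z / y + z}.
Proof. by apply: fgsumD => B c1 c2; rewrite mulrDr scalerDl. Qed.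

Lemma fgmul_termDl y A : {morph (fun c => fgsum (fun c' B => (c * c') *: m A B) y) : c c' / c + c'}.
Proof.
move=> c c'; rewrite /fgsum -big_split; apply: eq_bigr => B _ /=.
by rewrite mulrDl scalerDl.
Qed.

Lemma fgmulDl x y z : fgmul (x + y) z = fgmul x z + fgmul y z.
Proof. by apply: fgsumD => A; exact: fgmul_termDl. Qed.

Lemma fgmulDr x y z : fgmul x (y + z) = fgmul x y + fgmul x z.
Proof.
rewrite /fgmul /fgsum -big_split; apply: eq_bigr => A _ /=; exact: fgmul_termDr.
Qed.

Lemma fgmulUU c A c' B : fgmul << c *g A >> << c' *g B >> = (c * c') *: m A B.
Proof.
rewrite /fgmul fgsumU => [|D].
  by rewrite fgsumU // => D; rewrite mulr0 scale0r.
by rewrite /fgsum big1 // => B' _; rewrite mul0r scale0r.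
Qed.

Lemma fgmulZl c x y : fgmul (c *: x) y = c *: fgmul x y.
Proof.
apply: (additive_ext (f := fun x => fgmul (c *: x) y) (f' := fun x => c *: fgmul x y)).
- by move=> a b; rewrite scalerDr fgmulDl.
- by move=> a b; rewrite fgmulDl scalerDr.
move=> k A; apply: (additive_ext (f := fun y => fgmul (c *: << k *g A >>) y)
   (f' := fun y => c *: fgmul << k *g A >> y)).
- by move=> a b; rewrite fgmulDr.
- by move=> a b; rewrite fgmulDr scalerDr.
by move=> k' B; rewrite freeg_scale !fgmulUU scalerA mulrA.
Qed.

Lemma fgmulZr c x y : fgmul x (c *: y) = c *: fgmul x y.
Proof.
apply: (additive_ext (f := fun x => fgmul x (c *: y)) (f' := fun x => c *: fgmul x y)).
- by move=> a b; rewrite fgmulDl.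
- by move=> a b; rewrite fgmulDl scalerDr.
move=> k A; apply: (additive_ext (f := fun y => fgmul << k *g A >> (c *: y))
   (f' := fun y => c *: fgmul << k *g A >> y)).
- by move=> a b; rewrite scalerDr fgmulDr.
- by move=> a b; rewrite fgmulDr scalerDr.
by move=> k' B; rewrite freeg_scale !fgmulUU scalerA mulrCA.
Qed.

End Bilinear.

Lemma bilinear_ext (R : nzRingType) (X : choiceType) (V : zmodType)
    (f f' : {freeg X / R} -> {freeg X / R} -> V) :
  (forall x y z, f (x + y) z = f x z + f y z) -> (forall x y z, f x (y + z) = f x y + f x z) ->
  (forall x y z, f' (x + y) z = f' x z + f' y z) -> (forall x y z, f' x (y + z) = f' x y + f' x z) ->
  (forall c A c' B, f << c *g A >> << c' *g B >> = f' << c *g A >> << c' *g B >>) ->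
  forall x y, f x y = f' x y.
Proof.
move=> fl fr fl' fr' e x y.
apply: (additive_ext (f := f^~ y) (f' := f'^~ y)) => [a b|a b|c A] //.
by apply: (additive_ext (f := f << c *g A >>) (f' := f' << c *g A >>)).
Qed.

Section BaseChange.
Variables (R S : nzRingType) (X : choiceType) (phi : {rmorphism R -> S}).

Definition freeg_map x : {freeg X / S} := fgsum (fun c A => << phi c *g A >>) x.

Lemma freeg_mapD : {morph freeg_map : x y / x + y}.
Proof. by apply: fgsumD => A c c'; rewrite rmorphD freegUD. Qed.

Lemma freeg_mapU c A : freeg_map << c *g A >> = << phi c *g A >>.
Proof. by rewrite /freeg_map fgsumU // => B; rewrite rmorph0 freegU0. Qed.

Lemma freeg_map0 : freeg_map 0 = 0.
Proof. exact: fgsum0. Qed.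

Lemma freeg_mapZ c x : freeg_map (c *: x) = phi c *: freeg_map x.
Proof.
apply: (additive_ext (f := fun x => freeg_map (c *: x)) (f' := fun x => phi c *: freeg_map x)).
- by move=> a b; rewrite scalerDr freeg_mapD.
- by move=> a b; rewrite freeg_mapD scalerDr.
by move=> k A; rewrite freeg_scale !freeg_mapU freeg_scale rmorphM.
Qed.

Lemma coeff_freeg_map x A : coeff A (freeg_map x) = phi (coeff A x).
Proof.
apply: (additive_ext (f := fun x => coeff A (freeg_map x)) (f' := fun x => phi (coeff A x))).
- by move=> a b; rewrite freeg_mapD coeffD.
- by move=> a b; rewrite coeffD rmorphD.
by move=> c B; rewrite freeg_mapU !coeffU rmorphM rmorph_nat.
Qed.

Lemma freeg_map_inj : injective phi -> injective freeg_map.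
Proof.
move=> phiI x y e; apply/eqP/freeg_eqP => A; apply: phiI.
by rewrite -!coeff_freeg_map e.
Qed.

End BaseChange.

Lemma freeg_map_mul (R S : comNzRingType) (X : choiceType) (phi : {rmorphism R -> S})
    (m : X -> X -> {freeg X / R}) (x y : {freeg X / R}) :
  freeg_map phi (fgmul m x y) =
  fgmul (fun A B => freeg_map phi (m A B)) (freeg_map phi x) (freeg_map phi y).
Proof.
apply: (bilinear_ext (f := fun x y => freeg_map phi (fgmul m x y))
  (f' := fun x y => fgmul (fun A B => freeg_map phi (m A B)) (freeg_map phi x) (freeg_map phi y))).
- by move=> a b c; rewrite fgmulDl freeg_mapD.
- by move=> a b c; rewrite fgmulDr freeg_mapD.
- by move=> a b c; rewrite freeg_mapD fgmulDl.
- by move=> a b c; rewrite freeg_mapD fgmulDr.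
by move=> c A c' B; rewrite fgmulUU freeg_mapZ !freeg_mapU fgmulUU rmorphM.
Qed.

(** * Stabilization *)

Section Shift.
Variable n : nat.
Local Notation N := (n.*2.+1).
Implicit Types (M : 'M[int]_N) (A B C Z : Xit n).

Definition total M : int := \sum_i \sum_j M i j.

Lemma in_XiP d M :
  reflect [/\ forall i j, 0 <= M i j, centrosymmetric M & total M = d.*2.+1%:Z] (in_Xi d M).
Proof.
apply: (iffP existsP) => [[A /eqP <-]|[M0 cM tM]].
  split; first by move=> i j; rewrite mxE.
    exact: Xi_centrosymmetric.
  have /andP[/eqP e _] := valP A; rewrite -[X in _ = X%:Z]e (big_morph Posz PoszD (erefl _)).
  apply: eq_bigr => i _; rewrite (big_morph Posz PoszD (erefl _)).
  by apply: eq_bigr => j _; rewrite mxE.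
have bnd i j : (`|M i j| < d.*2.+2)%N.
  have : M i j <= total M.
    rewrite /total (bigD1 i) //= (bigD1 j) //= -addrA lerDl.
    by apply: addr_ge0; apply: sumr_ge0 => // k _; apply: sumr_ge0.
  by have := M0 i j; rewrite tM; lia.
pose A := \matrix_(i < N, j < N) Ordinal (bnd i j).
have AE i j : (A i j : nat)%:Z = M i j by rewrite mxE /= gez0_abs.
have AP : ((\sum_i \sum_j A i j == d.*2.+1)%N && centrosymmetric A).
  apply/andP; split.
    rewrite -eqz_nat -tM (big_morph Posz PoszD (erefl _)).
    apply/eqP/eq_bigr => i _; rewrite (big_morph Posz PoszD (erefl _)).
    by apply: eq_bigr => j _; rewrite AE.
  apply/forallP=> i; apply/forallP=> j; apply/eqP/val_inj.
  by rewrite !mxE /= centrosymmetricE.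
exists (exist _ A AP); apply/eqP/matrixP=> i j; rewrite mxE /=; exact: AE.
Qed.

Lemma shift2pE p A i j : shift2p p A i j = val A i j + (p.*2 * (i == j))%N%:Z.
Proof. by rewrite !mxE; case: eqP => _; rewrite ?muln1 ?muln0. Qed.

Lemma shift2p_inj p : injective (@shift2p n p).
Proof. by move=> A B /addIr/val_inj. Qed.

Lemma centrosymmetric_scalar (k : int) : centrosymmetric (k%:M : 'M[int]_N).
Proof.
by apply/forallP=> i; apply/forallP=> j; rewrite !mxE (inj_eq rev_ord_inj).
Qed.

Lemma total_shift p A : total (shift2p p A) = total (val A) + (p.*2 * N)%N%:Z.
Proof.
rewrite /total.
transitivity (\sum_i (\sum_j val A i j + p.*2%:Z)).
  apply: eq_bigr => i _; transitivity (\sum_j (val A i j + (p.*2%:Z)%:M i j)).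
    by apply: eq_bigr => j _; rewrite mxE.
  rewrite big_split /=; congr (_ + _); rewrite (bigD1 i) //= mxE eqxx big1 ?addr0 //.
  by move=> j ji; rewrite mxE eq_sym (negbTE ji).
by rewrite big_split /= sumr_const card_ord PoszM -mulr_natr natz.
Qed.

(** Mirrored rows have equal sums, so the total has the parity of the middle row sum. Hence totals
    of shifted matrices have the form 2d+1. *)
Lemma total_odd A : exists k : int, total (val A) = 2 * k + 1.
Proof.
have rs i : ro (val A) (rev_ord i) 0 = ro (val A) i 0.
  rewrite !mxE (reindex_inj rev_ord_inj) /=.
  by apply: eq_bigr => j _; rewrite centrosymmetricE // Xit_sym.
have [k] := sum_involution (f := fun i => ro (val A) i 0) (@rev_ordK N) rs.
rewrite [X in _ = X + _ -> _](eq_bigl (pred1 (inord n))) ?big_pred1_eq; last first.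
  move=> j /=; rewrite -!(inj_eq val_inj) /= inordK ?center_lt //; have := ltn_ord j; lia.
have -> : \sum_i ro (val A) i 0 = total (val A) by apply: eq_bigr => i _; rewrite mxE.
by have := Xit_row_center_odd A; move: (ro _ _ _) => x x2 ->; exists (k + (x %/ 2)%Z); lia.
Qed.

Lemma shift_nonneg A : exists p0, forall p, (p0 <= p)%N -> forall i j, 0 <= shift2p p A i j.
Proof.
exists (\sum_i `|val A i i|)%N => p p0 i j; rewrite shift2pE.
have [<-|ij] := eqVneq i j; last by rewrite muln0 addr0 Xit_off.
by move: p0; rewrite (bigD1 i) //= muln1; lia.
Qed.

Lemma shift_in_Xi A p d : (forall i j, 0 <= shift2p p A i j) ->
  in_Xi d (shift2p p A) = (total (val A) + (p.*2 * N)%N%:Z == d.*2.+1%:Z).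
Proof.
move=> A0; apply/in_XiP/eqP => [[_ _]|h]; first by rewrite total_shift.
split=> //; last by rewrite total_shift.
apply: centrosymmetricD; first exact: Xit_sym.
exact: centrosymmetric_scalar.
Qed.

(** For large p membership in Xi_d depends on the total alone, so matrices of equal total enter the
    same Schur algebra together. *)
Lemma shift_eventually A : exists p0, forall p, (p0 <= p)%N ->
  (forall d, in_Xi d (shift2p p A) = (total (val A) + (p.*2 * N)%N%:Z == d.*2.+1%:Z))
  /\ exists d, in_Xi d (shift2p p A).
Proof.
have [p1 h1] := shift_nonneg A; have [k tA] := total_odd A.
(* The value of d will be k + pN, and p >= |k| makes it nonnegative. *)
exists (maxn p1 (absz k)) => p; rewrite geq_max => /andP[pp1 pk].
have h d := shift_in_Xi d (h1 p pp1); split=> //.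
have [d kd] : exists d, k + (p * N)%N%:Z = d%:Z.
  exists (absz (k + (p * N)%N%:Z)); rewrite gez0_abs //.
  have : (p <= p * N)%N by rewrite leq_pmulr.
  by move: pk; lia.
exists d; rewrite h tA; apply/eqP; rewrite -(muln2 p) -mulnA mulnCA PoszM mulrC; lia.
Qed.

Lemma ro_shift p A : ro (shift2p p A) = ro (val A) + ro ((p.*2%:Z)%:M).
Proof. exact: roD. Qed.

Lemma co_shift p A : co (shift2p p A) = co (val A) + co ((p.*2%:Z)%:M).
Proof. exact: coD. Qed.

Lemma co_ro_shift p A B : (co (shift2p p A) == ro (shift2p p B)) = (co (val A) == ro (val B)).
Proof.
rewrite ro_shift co_shift.
have -> : co ((p.*2%:Z)%:M : 'M[int]_N) = ro ((p.*2%:Z)%:M).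
  apply/matrixP=> i j; rewrite !mxE; apply: eq_bigr => k _; by rewrite !mxE eq_sym.
by rewrite (inj_eq (addIr _)).
Qed.

Lemma total_ro M : total M = \sum_i ro M i 0.
Proof. by apply: eq_bigr => i _; rewrite mxE. Qed.

Lemma total_co M : total M = \sum_i co M i 0.
Proof. by rewrite /total exchange_big; apply: eq_bigr => i _; rewrite mxE. Qed.

End Shift.

Lemma v_exp_inj : injective (fun k : nat => v ^- k).
Proof.
move=> i j /= /invr_inj; wlog ij : i j / (i <= j)%N.
  by move=> h e; case/orP: (leq_total i j) => [/h -> //|/h /(_ (esym e)) ->].
rewrite -(subnKC ij) exprD -[X in X = _ -> _]mulr1 => /(mulfI (expf_neq0 i v_neq0)) h.
have [e|/v_expf_neq1] := posnP (j - i); first by rewrite e addn0.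
by rewrite -h eqxx.
Qed.

Lemma poly_eq0_vpow (P : {poly Qv}) p0 :
  (forall p, (p0 <= p)%N -> P.[v ^- p.*2] = 0) -> P = 0.
Proof.
move=> h; apply/eqP; apply: contraT => P0.
pose s : seq Qv := [seq v ^- (p0 + i).*2 | i <- iota 0 (size P)].
have /(max_poly_roots P0) : all (root P) s.
  by apply/allP=> _ /mapP[i _ ->]; rewrite rootE h ?leq_addr.
rewrite size_map size_iota ltnn => -> //.
rewrite map_inj_uniq ?iota_uniq // => i j /v_exp_inj /double_inj.
by move/addnI.
Qed.

(** It isolates the leading term a of a product k a + r whose leading coefficient k is
    invertible. *)
Lemma solve_scaled (R : nzRingType) (V : lmodType R) (a r : V) (k k' : R) : k' * k = 1 ->
  a = k' *: (k *: a + r) + (- k') *: r.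
Proof. by move=> kk; rewrite scalerDr scalerA kk scale1r scaleNr addrK. Qed.

Section Stabilization.
Variable n : nat.
Local Notation N := (n.*2.+1).
Variables (g : forall d, Xi n d -> Xi n d -> Xi n d -> {poly int}).
Hypothesis g_spec : structure_polynomials g.
Implicit Types (M : 'M[int]_N) (A B C Z : Xit n).

(* [K] with an additional parameter v': the free module carrying the
   stabilization data before the specialization v' = 1. *)
Definition KP := {freeg (Xit n) / {poly Qv}}.
Implicit Types x y z : KP.

(** The indices p and d are independent: a shifted matrix outside Xi_d is sent to 0, so identities
    can be stated for all d and no matching d has to be carried along. *)
Definition ev (p d : nat) : KP -> schurQ n d :=
  fgsum (fun c A => c.[v ^- p.*2] *: stdQ d (shift2p p A)).

Lemma evD p d : {morph ev p d : x y / x + y}.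
Proof. by apply: fgsumD => A c c'; rewrite hornerD scalerDl. Qed.

Lemma evU p d c A : ev p d << c *g A >> = c.[v ^- p.*2] *: stdQ d (shift2p p A).
Proof. by rewrite /ev fgsumU // => B; rewrite horner0 scale0r. Qed.

Lemma ev0 p d : ev p d 0 = 0.
Proof. exact: fgsum0. Qed.

Lemma evZ p d c x : ev p d (c *: x) = c.[v ^- p.*2] *: ev p d x.
Proof.
apply: (additive_ext (f := fun x => ev p d (c *: x)) (f' := fun x => c.[v ^- p.*2] *: ev p d x)).
- by move=> a b; rewrite scalerDr evD.
- by move=> a b; rewrite evD scalerDr.
by move=> k A; rewrite freeg_scale !evU hornerM scalerA.
Qed.

Lemma evB p d x y : ev p d (x - y) = ev p d x - ev p d y.
Proof. by rewrite evD -scaleN1r evZ hornerN hornerC scaleN1r. Qed.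

Lemma ev_sum p d (I : Type) (r : seq I) (P : pred I) (f : I -> KP) :
  ev p d (\sum_(i <- r | P i) f i) = \sum_(i <- r | P i) ev p d (f i).
Proof. exact: (big_morph _ (@evD p d) (ev0 p d)). Qed.

Lemma ev_std_coeff p d x A (A0 : Xi n d) : Xi_mx A0 = shift2p p A ->
  ev p d x A0 = (coeff A x).[v ^- p.*2] * v ^ (- (dimA A0)%:Z).
Proof.
move=> A0E.
apply: (additive_ext (f := fun x => ev p d x A0)
   (f' := fun x => (coeff A x).[v ^- p.*2] * v ^ (- (dimA A0)%:Z))).
- by move=> a b; rewrite evD ffunE.
- by move=> a b; rewrite coeffD hornerD mulrDl.
move=> c B; rewrite evU schurQ_scaleE stdQE A0E (inj_eq (@shift2p_inj n p)) coeffU.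
rewrite [A == B]eq_sym mulr_natr; case: eqP => _; first by rewrite mulr1n.
by rewrite mulr0n horner0 mul0r mulr0.
Qed.

(** For each large p the coefficient at A can be read off in the Schur algebra containing A + 2pI.
    It is a polynomial vanishing at infinitely many powers of v. *)
Lemma ev_inj x (p0 : nat) : (forall p, (p0 <= p)%N -> forall d, ev p d x = 0) -> x = 0.
Proof.
move=> h; apply/eqP/freeg_eqP => A; rewrite coeff0.
have [p1 h1] := shift_eventually A.
apply: (@poly_eq0_vpow _ (maxn p0 p1)) => p; rewrite geq_max => /andP[pp0 pp1].
have [_ [d /existsP[A0 /eqP A0E]]] := h1 p pp1.
have := ev_std_coeff x A0E; rewrite h // ffunE => /esym/eqP.
by rewrite mulf_eq0 (negbTE (vexp_neq0 _)) orbF => /eqP.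
Qed.

Lemma ev_inj_eq x y (p0 : nat) :
  (forall p, (p0 <= p)%N -> forall d, ev p d x = ev p d y) -> x = y.
Proof.
move=> h; apply/eqP; rewrite -subr_eq0; apply/eqP.
by apply: (@ev_inj _ p0) => p pp0 d; rewrite evB h // subrr.
Qed.

(** The stabilized product as a relation: uniqueness, bilinearity and associativity can be proved
    before it is known to exist. *)
Definition Stab x y z : Prop :=
  exists p0, forall p, (p0 <= p)%N -> forall d, ev p d z = schurQ_mul g (ev p d x) (ev p d y).

Lemma Stab_uniq x y z z' : Stab x y z -> Stab x y z' -> z = z'.
Proof.
move=> [p0 h] [p1 h']; apply: (@ev_inj_eq _ _ (maxn p0 p1)) => p.
by rewrite geq_max => /andP[pp0 pp1] d; rewrite h // h'.
Qed.

Lemma StabDl x x' y z z' : Stab x y z -> Stab x' y z' -> Stab (x + x') y (z + z').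
Proof.
move=> [p0 h] [p1 h']; exists (maxn p0 p1) => p.
by rewrite geq_max => /andP[pp0 pp1] d; rewrite !evD schurQ_mulDl h // h'.
Qed.

Lemma StabDr x y y' z z' : Stab x y z -> Stab x y' z' -> Stab x (y + y') (z + z').
Proof.
move=> [p0 h] [p1 h']; exists (maxn p0 p1) => p.
by rewrite geq_max => /andP[pp0 pp1] d; rewrite !evD schurQ_mulDr h // h'.
Qed.

Lemma StabZl c x y z : Stab x y z -> Stab (c *: x) y (c *: z).
Proof. by move=> [p0 h]; exists p0 => p pp0 d; rewrite !evZ schurQ_mulZl h. Qed.

Lemma StabZr c x y z : Stab x y z -> Stab x (c *: y) (c *: z).
Proof. by move=> [p0 h]; exists p0 => p pp0 d; rewrite !evZ schurQ_mulZr h. Qed.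

Lemma schurQ_mul0l d (x : schurQ n d) : schurQ_mul g 0 x = 0.
Proof. by have := schurQ_mulZl g 0 (0 : schurQ n d) x; rewrite !scale0r. Qed.

Lemma schurQ_mul0r d (x : schurQ n d) : schurQ_mul g x 0 = 0.
Proof. by have := schurQ_mulZr g 0 x (0 : schurQ n d); rewrite !scale0r. Qed.

Lemma Stab0l y : Stab 0 y 0.
Proof. by exists 0%N => p _ d; rewrite ev0 schurQ_mul0l. Qed.

Lemma Stab0r y : Stab y 0 0.
Proof. by exists 0%N => p _ d; rewrite ev0 schurQ_mul0r. Qed.

Lemma Stab_assoc x y z xy yz w : Stab x y xy -> Stab y z yz -> Stab x yz w -> Stab xy z w.
Proof.
move=> [p0 h0] [p1 h1] [p2 h2]; exists (maxn p0 (maxn p1 p2)) => p.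
rewrite !geq_max => /and3P[pp0 pp1 pp2] d.
by rewrite (h2 p pp2) (h1 p pp1) (h0 p pp0) (schurQ_mulA g_spec).
Qed.

Lemma stdQ_cases d M : stdQ d M = 0 \/ exists A0 : Xi n d, Xi_mx A0 = M.
Proof.
have [/existsP[A0 /eqP e]|/stdQ_notin e] := boolP (in_Xi d M); [by right; exists A0 | by left].
Qed.

Lemma evX p d A : ev p d << A >> = stdQ d (shift2p p A).
Proof. by rewrite evU hornerC scale1r. Qed.

Lemma Stab_noncomposable A B : co (val A) != ro (val B) -> Stab << A >> << B >> 0.
Proof.
move=> AB; exists 0%N => p _ d; rewrite ev0 !evX.
have [->|[A0 A0E]] := stdQ_cases d (shift2p p A); first by rewrite schurQ_mul0l.
have [->|[B0 B0E]] := stdQ_cases d (shift2p p B); first by rewrite schurQ_mul0r.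
by rewrite -A0E -B0E schurQ_mul_std0 // A0E B0E co_ro_shift.
Qed.

Lemma Stab_diag A C : is_diag_mx (val C) -> co (val C) = ro (val A) ->
  Stab << C >> << A >> << A >>.
Proof.
move=> dC coC; have [p0 h0] := shift_eventually C; have [p1 h1] := shift_eventually A.
exists (maxn p0 p1) => p; rewrite geq_max => /andP[pp0 pp1] d; rewrite !evX.
have tCA : total (val C) = total (val A).
  by rewrite total_co total_ro coC.
have [in1|/negbTE out1] := boolP (in_Xi d (shift2p p C)); last first.
  have out2 : in_Xi d (shift2p p A) = false.
    by rewrite (proj1 (h1 p pp1)) -tCA -(proj1 (h0 p pp0)).
  by rewrite !stdQ_notin ?out1 ?out2 // schurQ_mul0l.
have /existsP[C0 /eqP C0E] := in1.
have : in_Xi d (shift2p p A) by rewrite (proj1 (h1 p pp1)) -tCA -(proj1 (h0 p pp0)).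
case/existsP=> A0 /eqP A0E; rewrite -C0E -A0E schurQ_mul_std_diag //.
  rewrite C0E; apply/is_diag_mxP=> i j ij; rewrite shift2pE.
  by rewrite (is_diag_mxP dC) // -[i == j]/((i : nat) == j) (negbTE ij) muln0 addr0.
by apply/eqP; rewrite C0E A0E co_ro_shift coC.
Qed.

(* The coefficient [chev (M + 2pI)] as a polynomial in v' = v^(-2p). *)
Definition chevP M (a b u : 'I_N) : {poly Qv} :=
  (v ^ chev_exp M a b u / (v ^ (-2) - 1)) *: ((v ^ (- (2 * (M b u + 1)))) *: 'X^(2 * (b == u)) - 1).

(** The shift contributes 2p to the sum over row b when b <= u, and to the one over row a when a <
    u. For b = a+1 the two conditions coincide and the contributions cancel. *)
Lemma chev_exp_shift p A (a b u : 'I_N) : b = a.+1 :> nat ->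
  chev_exp (shift2p p A) a b u = chev_exp (val A) a b u.
Proof.
move=> ab; rewrite /chev_exp; congr (_ + _).
have diagsum (r : 'I_N) (Q : pred 'I_N) :
  \sum_(l | Q l) shift2p p A r l = \sum_(l | Q l) val A r l + (p.*2 * Q r)%N%:Z.
  under eq_bigr => l _ do rewrite shift2pE.
  rewrite big_split /=; congr (_ + _); case: (boolP (Q r)) => Qr.
    rewrite (bigD1 r) //= eqxx big1 ?addr0 ?muln1 // => l /andP[_ /negbTE lr].
    by rewrite eq_sym lr muln0.
  rewrite big1 ?muln0 // => l Ql; case: eqP => [e|_]; last by rewrite muln0.
  by move: Qr; rewrite e Ql.
by rewrite !diagsum ab; ring.
Qed.

Lemma chevP_shift p A (a b u : 'I_N) : b = a.+1 :> nat ->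
  (chevP (val A) a b u).[v ^- p.*2] = chev (shift2p p A) a b u.
Proof.
move=> ab; rewrite /chevP /chev qint_barE chev_exp_shift // shift2pE.
rewrite hornerZ hornerD hornerN hornerZ hornerXn hornerC mulrAC -mulrA.
congr (_ * (_ / _)); congr (_ - _); case: eqP => _ /=; last by rewrite !muln0 expr0 mulr1 (addr0 (val A b u)).
rewrite !muln1 -exprVn -exprM.
have -> : v^-1 ^+ (p.*2 * 2) = v ^ (- (2 * p.*2%:Z)).
  by rewrite exprVn -exprnN mulnC.
by rewrite -vexpD; congr (v ^ _); ring.
Qed.

(** Away from the diagonal the shift does not touch the entry (b,u). The leading coefficient of the
    induction is therefore a constant polynomial, which is invertible as soon as it is nonzero. *)
Lemma chevP_const M (a b u : 'I_N) : u != b ->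
  chevP M a b u = (chev M a b u)%:P.
Proof.
move=> ub; rewrite /chevP /chev qint_barE eq_sym (negbTE ub) muln0 expr0.
by rewrite alg_polyC -polyCB -mul_polyC -polyCM mulrA mulrAC.
Qed.

Lemma chevP1 M a b u : (chevP M a b u).[1] = chev M a b u.
Proof.
rewrite /chevP /chev qint_barE hornerZ hornerD hornerN hornerZ hornerXn hornerC.
by rewrite expr1n mulr1 mulrAC -mulrA.
Qed.

Definition basisP M : KP := if insub M is Some A then << (A : Xit n) >> else 0.

Lemma Stab_chevalley A C (a b : 'I_N) : b = a.+1 :> nat ->
  is_diag_mx (val C - Etheta b a) -> co (val C) = ro (val A) ->
  Stab << C >> << A >>
    (\sum_u chevP (val A) a b u *: basisP (val A + (Etheta b u - Etheta a u))).
Proof.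
move=> ab dC coC; have [p0 h0] := shift_eventually C; have [p1 h1] := shift_eventually A.
exists (maxn p0 p1) => p; rewrite geq_max => /andP[pp0 pp1] d; rewrite !evX ev_sum.
have tCA : total (val C) = total (val A).
  by rewrite total_co total_ro coC.
(* A moved matrix outside the index set has a negative off-diagonal entry, which no shift removes,
   so both sides are then 0. *)
have evb u : ev p d (basisP (val A + (Etheta b u - Etheta a u)))
    = stdQ d (shift2p p A + (Etheta b u - Etheta a u)).
  have e : shift2p p A + (Etheta b u - Etheta a u) = val A + (Etheta b u - Etheta a u) + (p.*2%:Z)%:M.
    by rewrite /shift2p addrAC.
  rewrite /basisP; case: insubP => [Z _ ZE|notin]; first by rewrite evX e -ZE.
  rewrite ev0 stdQ_notin //; apply: contra notin => /in_XiP[M0 _ _].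
  apply: in_Xit_step => i j ij; have := M0 i j; rewrite e (mxDE _ (p.*2%:Z)%:M).
  by rewrite [X in _ + X]mxE (negbTE ij) mulr0n addr0.
under eq_bigr => u _ do rewrite evZ evb chevP_shift //.
have [in1|/negbTE out1] := boolP (in_Xi d (shift2p p C)); last first.
  rewrite (stdQ_notin (negbT out1)) schurQ_mul0l big1 // => u _.
  rewrite stdQ_notin ?scaler0 //; apply/negP => /in_XiP[_ _ tM].
  move: out1; rewrite (proj1 (h0 p pp0)) tCA -total_shift -tM => /eqP; apply.
  have totD M M' : total (M + M') = total M + total M'.
    by rewrite !total_ro -big_split; apply: eq_bigr => i _; rewrite roD mxE.
  have totB M M' : total (M - M') = total M - total M'.
    by apply/eqP; rewrite eq_sym subr_eq -totD subrK.
  rewrite totD totB !total_co !co_Etheta subrr addr0 //.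
have /existsP[C0 /eqP C0E] := in1.
have : in_Xi d (shift2p p A) by rewrite (proj1 (h1 p pp1)) -tCA -(proj1 (h0 p pp0)).
case/existsP=> A0 /eqP A0E; rewrite -C0E -A0E (schurQ_chevalley g_spec ab) //.
  rewrite C0E; apply/is_diag_mxP=> i j ij.
  have := is_diag_mxP dC i j ij; rewrite !mxBE shift2pE.
  by rewrite -[i == j]/((i : nat) == j) (negbTE ij) muln0 addr0.
by apply/eqP; rewrite C0E A0E co_ro_shift coC.
Qed.

(** The elements that have a stabilized product with every right factor form a submodule closed
    under stabilized products. It thus suffices to put the diagonal matrices and the generators in
    it and to run the triangular induction. *)
Definition stab_left x := forall y, exists z, Stab x y z.

Lemma stab_leftD x y : stab_left x -> stab_left y -> stab_left (x + y).
Proof.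
move=> hx hy w; have [z h] := hx w; have [z' h'] := hy w.
by exists (z + z'); apply: StabDl.
Qed.

Lemma stab_leftZ c x : stab_left x -> stab_left (c *: x).
Proof. by move=> hx w; have [z h] := hx w; exists (c *: z); apply: StabZl. Qed.

Lemma stab_left_basis x : (forall B, exists z, Stab x << B >> z) -> stab_left x.
Proof.
move=> h y; rewrite -(freeg_sumE y); elim: (dom y) => [|B s [z IH]].
  by rewrite big_nil; exists 0; apply: Stab0r.
rewrite big_cons; have [z' h'] := h B.
exists (coeff B y *: z' + z); apply: StabDr; last exact: IH.
by rewrite -[X in << X *g _ >>]mulr1 -freeg_scale; apply: StabZr.
Qed.

Lemma stab_left_mul x y z : stab_left x -> stab_left y -> Stab x y z -> stab_left z.
Proof.
move=> hx hy h w; have [yw h1] := hy w; have [t h2] := hx yw.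
by exists t; apply: Stab_assoc h h1 h2.
Qed.

Lemma stab_left_all A : stab_left << A >>.
Proof.
apply: (Xit_ind (P := fun A => stab_left << A >>)) => {A}.
  move=> A dA; apply: stab_left_basis => B.
  have [coA|coA] := eqVneq (co (val A)) (ro (val B)).
    by exists << B >>; apply: Stab_diag.
  by exists 0; apply: Stab_noncomposable.
move=> A A' C a b u ab ub dC coC AE A'bu IHA' IHZ.
have leftC : stab_left << C >>.
  apply: stab_left_basis => B; have [coA|coA] := eqVneq (co (val C)) (ro (val B)).
    by eexists; exact: (Stab_chevalley ab dC coA).
  by exists 0; apply: Stab_noncomposable.
have h := Stab_chevalley ab dC coC.
have := stab_left_mul leftC IHA' h.
rewrite (bigD1 u isT) -AE /basisP valK (chevP_const _ _ ub) => hs.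
set c := chev _ a b u in hs.
have c0 : c != 0.
  apply: mulf_neq0; first exact: vexp_neq0.
  by apply: qint_bar_neq0; move: A'bu; lia.
set r := \sum_(i | _) _ in hs.
have hr : stab_left r.
  rewrite /r; elim/big_rec: _ => [|w y /andP[_ wu] hy]; first by move=> y; exists 0; apply: Stab0l.
  apply: stab_leftD; last exact: hy.
  apply: stab_leftZ; case: insubP => [Z _ ZE|_].
    exact: IHZ ZE wu.
  by move=> t; exists 0; apply: Stab0l.
have cV : (c^-1)%:P * c%:P = 1 by rewrite -polyCM (mulVf c0).
rewrite (solve_scaled << A >> r cV).
by apply: stab_leftD; apply: stab_leftZ; [exact: hs | exact: hr].
Qed.

Lemma Stab_exists x y : exists z, Stab x y z.
Proof.
suff : stab_left x by exact.
rewrite -(freeg_sumE x); elim: (dom x) => [|A s IH].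
  by rewrite big_nil => w; exists 0; apply: Stab0l.
rewrite big_cons; apply: stab_leftD; last exact: IH.
by rewrite -[X in << X *g _ >>]mulr1 -freeg_scale; apply: stab_leftZ; apply: stab_left_all.
Qed.

End Stabilization.

(** * The algebra K *)

(** Associativity descends along a multiplicative map with a section. It is applied to the
    specialization v' = 1, whose section is the embedding of constants. *)
Lemma assoc_transport (T U : Type) (mT : T -> T -> T) (mU : U -> U -> U) (f : T -> U) (l : U -> T) :
  (forall x y, f (mT x y) = mU (f x) (f y)) -> cancel l f ->
  (forall x y z, mT x (mT y z) = mT (mT x y) z) -> forall x y z, mU x (mU y z) = mU (mU x y) z.
Proof. by move=> fM lK aT x y z; rewrite -(lK x) -(lK y) -(lK z) -!fM aT. Qed.

Lemma laurent_val_in (x : laurent) : laurent_val x \in is_laurent.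
Proof. by case: x. Qed.

Lemma vexp_laurent (k : int) : v ^ k \in is_laurent.
Proof. exact: is_laurent_vpow. Qed.

(* Multiplying by v^(2 deg G) and shifting p kills the leading term of G, so
   that the values G(v^(-2p)) satisfy a linear recurrence over Z[v,v^-1] with
   unit extreme coefficients; it can be run backwards. *)
Lemma laurent_backward (G : {poly Qv}) p0 :
  (forall p, (p0 <= p)%N -> G.[v ^- p.*2] \in is_laurent) ->
  forall p, G.[v ^- p.*2] \in is_laurent.
Proof.
move: {2}(size G) (leqnn (size G)) => k; elim: k G p0 => [|k IH] G p0 sG hG p.
  by move: sG; rewrite leqn0 size_poly_eq0 => /eqP ->; rewrite horner0 rpred0.
pose H := v ^+ (2 * k) *: (G \Po (v ^- 2 *: 'X)) - G.
have HE q : H.[v ^- q.*2] = v ^+ (2 * k) * G.[v ^- q.+1.*2] - G.[v ^- q.*2].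
  rewrite /H hornerD hornerN hornerZ horner_comp hornerZ hornerX; congr (_ * _.[_] - _).
  by rewrite -invfM -exprD doubleS add2n.
have sH : (size H <= k)%N.
  apply/leq_sizeP=> j kj; rewrite coefB coefZ.
  have -> : (G \Po (v ^- 2 *: 'X))`_j = G`_j * (v ^- 2) ^+ j.
    rewrite comp_polyE coef_sum.
    under eq_bigr => i _ do rewrite exprZn scalerA coefZ coefXn.
    have [jG|jG] := ltnP j (size G); last first.
      rewrite [in RHS]nth_default // mul0r big1 // => i _.
      have -> : (j == i) = false by apply/negbTE; rewrite neq_ltn (leq_trans (ltn_ord i) jG) orbT.
      by rewrite mulr0.
    rewrite (bigD1 (Ordinal jG) isT) big1 => [|i /andP[_ ij]].
      by apply: etrans (addr0 _) _; rewrite eqxx mulr1.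
    by have -> : (j == i) = false; [apply/negbTE; rewrite eq_sym | rewrite mulr0].
  move: kj; rewrite leq_eqVlt => /orP[/eqP <-|kj].
    rewrite mulrCA exprVn -exprM divff ?mulr1 ?subrr //; exact: expf_neq0 v_neq0.
  by rewrite nth_default ?(leq_trans sG) // mul0r mulr0 subrr.
(* H has smaller size than G and satisfies the hypothesis beyond q, so the induction gives its value
   at q itself; solving the recurrence for G at q then stays among Laurent polynomials. *)
have step q : G.[v ^- q.+1.*2] \in is_laurent ->
    (forall r, (q < r)%N -> G.[v ^- r.*2] \in is_laurent) -> G.[v ^- q.*2] \in is_laurent.
  move=> hq hr.
  have hH : H.[v ^- q.*2] \in is_laurent.
    apply: (IH H q.+1 sH) => r qr; rewrite HE.
    by apply: rpredB; [apply: rpredM; [exact: (vexp_laurent (2 * k)%N) | apply: hr; exact: ltnW] | exact: hr].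
  have -> : G.[v ^- q.*2] = v ^+ (2 * k) * G.[v ^- q.+1.*2] - H.[v ^- q.*2].
    by rewrite HE opprB addrCA subrr addr0.
  by apply: rpredB => //; apply: rpredM => //; exact: (vexp_laurent (2 * k)%N).
suff all q : forall r, (p0 - q <= r)%N -> G.[v ^- r.*2] \in is_laurent.
  by apply: (all p0); rewrite subnn.
elim: q => [|q IHq] r; first by rewrite subn0; exact: hG.
rewrite leq_eqVlt => /orP[/eqP <-|]; last first.
  by move=> h; apply: IHq; move: h; lia.
have [qp|qp] := ltnP q p0; last by apply: IHq; lia.
by apply: step => [|r' hr']; apply: IHq; lia.
Qed.

Section Multiplication.
Variable n : nat.
Variables (g : forall d, Xi n d -> Xi n d -> Xi n d -> {poly int}).
Hypothesis g_spec : structure_polynomials g.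
Implicit Types (A B C Z : Xit n).

Definition structP A B : KP n := sval (cid (Stab_exists g_spec << A >> << B >>)).

Lemma structPP A B : Stab g << A >> << B >> (structP A B).
Proof. exact: svalP. Qed.

Definition mulP : KP n -> KP n -> KP n := fgmul structP.

Lemma mulPP x y : Stab g x y (mulP x y).
Proof.
have sumP (s : seq (Xit n)) (f h : Xit n -> KP n) w :
    (forall A, Stab g (f A) w (h A)) -> Stab g (\sum_(A <- s) f A) w (\sum_(A <- s) h A).
  move=> fh; elim: s => [|A s IH]; first by rewrite !big_nil; apply: Stab0l.
  by rewrite !big_cons; apply: StabDl; [exact: fh | exact: IH].
have -> : mulP x y = \sum_(A <- dom x) mulP << coeff A x *g A >> y.
  have mul0 z : mulP 0 z = 0 by exact: fgsum0.
  rewrite -{1}(freeg_sumE x); elim: (dom x) => [|A s IH]; first by rewrite !big_nil mul0.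
  by rewrite !big_cons /mulP fgmulDl -/mulP; congr (_ + _).
rewrite -{1}(freeg_sumE x); apply: sumP => A; move: (coeff A x) => c.
rewrite -(freeg_sumE y); elim: (dom y) => [|B s IH].
  rewrite big_nil; have -> : mulP << c *g A >> 0 = 0.
    by have := fgmulZr structP 0 << c *g A >> (0 : KP n); rewrite !scale0r.
  exact: Stab0r.
rewrite big_cons [mulP _ _](fgmulDr structP); apply: StabDr; last exact: IH.
rewrite fgmulUU -scalerA.
rewrite -[X in << X *g A >>]mulr1 -[X in << X *g B >>]mulr1 -!freeg_scale.
by apply: StabZl; apply: StabZr; apply: structPP.
Qed.

Lemma mulP_assoc x y z : mulP x (mulP y z) = mulP (mulP x y) z.
Proof.
apply: (Stab_uniq (g := g) (x := mulP x y) (y := z)); last exact: mulPP.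
exact: (Stab_assoc g_spec (mulPP x y) (mulPP y z) (mulPP x (mulP y z))).
Qed.

Lemma mulP_uniq x y z : Stab g x y z -> mulP x y = z.
Proof. exact: (Stab_uniq (mulPP x y)). Qed.

(** For large p the value is, up to a power of v, a coefficient of a product in the Schur algebra
    over Z[v,v^-1]; [laurent_backward] extends this to every p. *)
Lemma structP_laurent A B Z p : (coeff Z (structP A B)).[v ^- p.*2] \in is_laurent.
Proof.
have [p0 h0] := structPP A B; have [p1 h1] := shift_eventually Z.
apply: (@laurent_backward _ (maxn p0 p1)) => q; rewrite geq_max => /andP[qp0 qp1].
have [_ [d /existsP[A0 /eqP A0E]]] := h1 q qp1.
have e := ev_std_coeff (structP A B) A0E.
have -> : (coeff Z (structP A B)).[v ^- q.*2] = ev q d (structP A B) A0 * v ^ (dimA A0)%:Z.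
  by rewrite e -mulrA -vexpD addNr expr0z mulr1.
apply: rpredM; last exact: vexp_laurent.
by rewrite (h0 q qp0) !evX -!/(schur_to_Q _) /stdQ -schur_to_Q_mul ffunE laurent_val_in.
Qed.

Definition spec : KP n -> KQ n := freeg_map (horner_eval (1 : Qv)).

Lemma specU c A : spec << c *g A >> = << c.[1] *g A >>.
Proof. exact: freeg_mapU. Qed.

Definition structKQ A B : KQ n := spec (structP A B).

Definition mulKQ : KQ n -> KQ n -> KQ n := fgmul structKQ.

Lemma spec_mul x y : spec (mulP x y) = mulKQ (spec x) (spec y).
Proof. exact: freeg_map_mul. Qed.

Definition liftKQ : KQ n -> KP n := freeg_map (@polyC Qv).

Lemma liftKQK : cancel liftKQ spec.
Proof.
apply: additive_ext => [x y|x y|c A] //; first by rewrite /liftKQ freeg_mapD /spec freeg_mapD.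
by rewrite /liftKQ freeg_mapU specU hornerC.
Qed.

Lemma mulKQ_assoc x y z : mulKQ x (mulKQ y z) = mulKQ (mulKQ x y) z.
Proof.
exact: (assoc_transport spec_mul liftKQK mulP_assoc).
Qed.

Lemma structKQ_laurent A B Z : coeff Z (structKQ A B) \in is_laurent.
Proof.
rewrite /structKQ /spec coeff_freeg_map.
by have := structP_laurent A B Z 0; rewrite expr0 invr1.
Qed.

Lemma K_to_KQE (x : K n) : K_to_KQ x = freeg_map (\val : {rmorphism laurent -> Qv}) x.
Proof. by []. Qed.

Lemma K_to_KQ_inj : injective (@K_to_KQ n).
Proof. by move=> x y; rewrite !K_to_KQE; apply: freeg_map_inj; exact: val_inj. Qed.

Lemma structK_exists A B : exists y : K n, K_to_KQ y = structKQ A B.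
Proof.
exists (\sum_(Z <- dom (structKQ A B)) << Laurent (structKQ_laurent A B Z) *g Z >>).
rewrite K_to_KQE -[RHS]freeg_sumE.
rewrite (big_morph _ (@freeg_mapD _ _ _ _) (@freeg_map0 _ _ _ _)).
by apply: eq_bigr => Z _; rewrite freeg_mapU.
Qed.

Definition structK A B : K n := sval (cid (structK_exists A B)).

Lemma structKE A B : K_to_KQ (structK A B) = structKQ A B.
Proof. exact: (svalP (cid (structK_exists A B))). Qed.

Definition mulK : K n -> K n -> K n := fgmul structK.

Lemma K_to_KQ_mul x y : K_to_KQ (mulK x y) = mulKQ (K_to_KQ x) (K_to_KQ y).
Proof.
rewrite !K_to_KQE freeg_map_mul; congr (fgmul _ _ _).
by apply/funext => A; apply/funext => B; exact: structKE.
Qed.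

Lemma K_to_KQ_basis A : K_to_KQ (K_basis A) = << A >>.
Proof. by rewrite K_to_KQE /K_basis freeg_mapU. Qed.

Lemma K_to_KQZ c x : K_to_KQ (c *: x : K n) = laurent_val c *: K_to_KQ x.
Proof. by rewrite !K_to_KQE freeg_mapZ. Qed.

Lemma K_to_KQ0 : K_to_KQ (0 : K n) = 0.
Proof. by rewrite K_to_KQE freeg_map0. Qed.

Lemma mulK_algebra : is_associative_algebra mulK.
Proof.
split=> [c x y z|c x y z|x y z].
- by rewrite /mulK fgmulDl fgmulZl.
- by rewrite /mulK fgmulDr fgmulZr.
- by apply: K_to_KQ_inj; rewrite !K_to_KQ_mul mulKQ_assoc.
Qed.

End Multiplication.

(** * Products of several factors and stabilization data *)

Section GivenByStabilization.
Variable n : nat.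
Local Notation N := (n.*2.+1).
Variables (g : forall d, Xi n d -> Xi n d -> Xi n d -> {poly int}).
Hypothesis g_spec : structure_polynomials g.
Implicit Types (A B C Z : Xit n).

Local Notation mulP := (mulP g_spec).
Local Notation mulK := (mulK g_spec).
Local Notation mulKQ := (mulKQ g_spec).

Definition prodP A1 (As : seq (Xit n)) : KP n :=
  foldl mulP << A1 >> [seq << A >> | A <- As].

Lemma spec_basis A : spec (<< A >> : KP n) = << A >>.
Proof. by rewrite specU hornerC. Qed.

Lemma spec_prodP A1 As : spec (prodP A1 As) = K_to_KQ (K_prod mulK A1 As).
Proof.
rewrite /prodP /K_prod; have : spec (<< A1 >> : KP n) = K_to_KQ (K_basis A1).
  by rewrite spec_basis K_to_KQ_basis.
move: (<< A1 >> : KP n) (K_basis A1); elim: As => [|B Bs IH] x y xy; first exact: xy.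
by apply: IH; rewrite spec_mul K_to_KQ_mul xy spec_basis K_to_KQ_basis.
Qed.

Lemma ev_prodP A1 As : exists p0, forall p, (p0 <= p)%N -> forall d,
  ev p d (prodP A1 As) =
  schur_to_Q (foldl (@schur_mul n d (g (d := d))) (schur_std d (shift2p p A1))
               [seq schur_std d (shift2p p A) | A <- As]).
Proof.
rewrite /prodP.
suff h (x : KP n) (y : forall p d, schur n d) :
    (exists p0, forall p, (p0 <= p)%N -> forall d, ev p d x = schur_to_Q (y p d)) ->
    exists p0, forall p, (p0 <= p)%N -> forall d, ev p d (foldl mulP x [seq << A >> | A <- As]) =
      schur_to_Q (foldl (@schur_mul n d (g (d := d))) (y p d) [seq schur_std d (shift2p p A) | A <- As]).
  by apply: (h _ (fun p d => schur_std d (shift2p p A1))); exists 0%N => p _ d; rewrite evX.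
elim: As x y => [|B Bs IH] x y [p0 h]; first by exists p0.
apply: (IH (mulP x << B >>) (fun p d => schur_mul (g (d := d)) (y p d) (schur_std d (shift2p p B)))).
have [p1 h1] := mulPP g_spec x << B >>; exists (maxn p0 p1) => p.
rewrite geq_max => /andP[pp0 pp1] d.
by rewrite (h1 p pp1) (h p pp0) evX schur_to_Q_mul.
Qed.

Lemma shift_eventually_seq (s : seq (Xit n)) : exists p0, forall p, (p0 <= p)%N ->
  forall A, A \in s -> forall d, in_Xi d (shift2p p A) = (total (val A) + (p.*2 * N)%N%:Z == d.*2.+1%:Z).
Proof.
elim: s => [|A s [p0 h0]]; first by exists 0%N.
have [p1 h1] := shift_eventually A; exists (maxn p0 p1) => p.
rewrite geq_max => /andP[pp0 pp1] B; rewrite inE => /orP[/eqP ->|Bs] d.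
  by rewrite (proj1 (h1 p pp1)).
exact: h0.
Qed.

Lemma in_Xi_uniq d d' (M : 'M[int]_N) : in_Xi d M -> in_Xi d' M -> d = d'.
Proof.
move=> /in_XiP[_ _ h] /in_XiP[_ _]; rewrite h => -[]; exact: double_inj.
Qed.

Lemma composable_total A1 As : composable A1 As ->
  forall A, A \in A1 :: As -> total (val A) = total (val A1).
Proof.
elim: As A1 => [|B Bs IH] A1 /=; first by move=> _ A; rewrite inE => /eqP ->.
move=> /andP[/eqP AB pB] A; rewrite inE => /orP[/eqP -> //|/(IH _ pB) ->].
by rewrite total_ro -AB total_co.
Qed.

Lemma ev_dom p d (x : KP n) :
  ev p d x = \sum_(Z <- dom x) (coeff Z x).[v ^- p.*2] *: stdQ d (shift2p p Z).
Proof. by []. Qed.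

Lemma stabilization_exists A1 As : composable A1 As ->
  exists (m : nat) (Z : 'I_m -> Xit n) (G : 'I_m -> {poly Qv}), stabilization_data g A1 As Z G.
Proof.
move=> comp; set x := prodP A1 As.
(* The data require every shifted Z_i to lie in the Schur algebra of the factors. Terms with another
   total map to 0 there and are dropped. *)
pose Zs := [seq Z <- dom x | total (val Z) == total (val A1)].
exists (size Zs), (tnth (in_tuple Zs)), (fun i => coeff (tnth (in_tuple Zs) i) x).
have [p0 h0] := ev_prodP A1 As; have [p1 h1] := shift_eventually_seq (A1 :: As ++ dom x).
have [p2 h2] := shift_eventually A1.
exists (maxn p0 (maxn p1 p2)) => p; rewrite !geq_max => /and3P[pp0 pp1 pp2].
have [_ [d A1d]] := h2 p pp2; exists d.
have inE' A : A \in A1 :: As ++ dom x -> in_Xi d (shift2p p A) = (total (val A) == total (val A1)).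
  move=> As'; rewrite (h1 p pp1) //; move: A1d; rewrite (h1 p pp1) ?mem_head // => /eqP <-.
  by rewrite (inj_eq (addIr _)).
split.
- apply/allP=> A AA; rewrite inE'; first by rewrite (composable_total comp AA).
  by move: AA; rewrite !inE mem_cat => /orP[->|->]; rewrite ?orbT.
- move=> i; have := mem_tnth i (in_tuple Zs); rewrite mem_filter => /andP[tZ Zx].
  by rewrite inE' // inE mem_cat Zx !orbT.
- move=> C; have := congr1 (fun f : schurQ n d => f C) (h0 p pp0 d).
  rewrite [X in _ = X -> _]ffunE => <-; rewrite -/x ev_dom sum_ffunE.
  rewrite (bigID (fun Z => total (val Z) == total (val A1))) /= [X in _ + X]big1_seq ?addr0; last first.
    move=> Z /andP[tZ Zx]; rewrite schurQ_scaleE stdQ_notin ?ffunE ?mulr0 //.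
    by rewrite inE' // inE mem_cat Zx !orbT.
  rewrite -big_filter -/Zs (big_tnth _ _ Zs); apply: eq_bigr => i _.
  by rewrite schurQ_scaleE [stdQ _ _ _]ffunE.
Qed.

(** The data concern a single d for each p, whereas [ev_inj_eq] asks for all of them. For any other
    d both sides vanish, since neither the first factor nor any Z_i has its shift in that Schur
    algebra. *)
Lemma stabilization_unique A1 As m (Z : 'I_m -> Xit n) (G : 'I_m -> {poly Qv}) :
  stabilization_data g A1 As Z G ->
  K_to_KQ (K_prod mulK A1 As) = \sum_(i < m) (G i).[1] *: (<< Z i >> : KQ n).
Proof.
move=> [p0 h0]; rewrite -spec_prodP.
have -> : prodP A1 As = \sum_(i < m) << G i *g Z i >>.
  have [p1 h1] := ev_prodP A1 As.
  apply: (@ev_inj_eq _ _ _ (maxn p0 p1)) => p; rewrite geq_max => /andP[pp0 pp1] d'.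
  have [d [inA inZ hC]] := h0 p pp0; rewrite ev_sum.
  have [dd'|dd'] := eqVneq d' d.
    rewrite dd'; apply/ffunP=> C; rewrite (h1 p pp1) [LHS]ffunE hC sum_ffunE.
    by apply: eq_bigr => i _; rewrite evU schurQ_scaleE [stdQ _ _ _]ffunE.
  have notin A : in_Xi d (shift2p p A) -> stdQ d' (shift2p p A) = 0.
    move=> h; apply: stdQ_notin; apply: contra dd' => h'.
    by rewrite (in_Xi_uniq h h').
  rewrite big1 => [|i _]; last by rewrite evU notin ?scaler0.
  rewrite (h1 p pp1); have /andP[/notin A0 _] := inA.
  move: A0; rewrite /stdQ; move: (schur_std _ (shift2p p A1)).
  elim: As {h0 h1 inA hC} => [|B Bs IH] y y0 //=; apply: IH.
  by rewrite schur_to_Q_mul y0 schurQ_mul0l.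
rewrite /spec (big_morph _ (@freeg_mapD _ _ _ _) (@freeg_map0 _ _ _ _)).
apply: eq_bigr => i _; rewrite freeg_scale mulr1; exact: specU.
Qed.

Lemma mulK_basis_eq0 A B : co (val A) != ro (val B) -> mulK (K_basis A) (K_basis B) = 0.
Proof.
move=> AB; apply: K_to_KQ_inj; rewrite K_to_KQ0 K_to_KQ_mul !K_to_KQ_basis.
rewrite -!spec_basis -spec_mul (mulP_uniq g_spec (Stab_noncomposable g_spec AB)).
exact: freeg_map0.
Qed.

Lemma mulK0l x : mulK 0 x = 0.
Proof. exact: fgsum0. Qed.

Lemma mulK0r x : mulK x 0 = 0.
Proof. by have := fgmulZr (structK g_spec) 0 x (0 : K n); rewrite !scale0r. Qed.

(** The product is bracketed from the left, so associativity is needed to bring together the two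
    neighbours whose column and row sums disagree. *)
Lemma K_prod_noncomposable A1 As : ~~ composable A1 As -> K_prod mulK A1 As = 0.
Proof.
have [_ _ assoc] := mulK_algebra g_spec.
have foldl0 s : foldl mulK 0 s = 0 by elim: s => [//|x s IH] /=; rewrite mulK0l.
have step (Bs : seq (Xit n)) (A : Xit n) (x : K n) : ~~ composable A Bs ->
    foldl mulK (mulK x (K_basis A)) [seq K_basis B | B <- Bs] = 0.
  elim: Bs A x => [//|B Bs IH] A x /=; rewrite negb_and => /orP[AB|h]; last exact: IH.
  by rewrite -assoc mulK_basis_eq0 // mulK0r foldl0.
rewrite /K_prod; case: As => [//|B Bs] /=; rewrite negb_and => /orP[AB|h].
  by rewrite mulK_basis_eq0 // foldl0.
exact: step.
Qed.

Lemma mulK_given_by_stabilization : given_by_stabilization g mulK.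
Proof.
move=> A1 As; case: ifP => comp; last by apply: K_prod_noncomposable; rewrite comp.
split; first exact: stabilization_exists.
by move=> m Z G; apply: stabilization_unique.
Qed.

End GivenByStabilization.

(** * Multiplication by powers of a generator *)

Definition qfall (a : int) (k : nat) : Qv := \prod_(i < k) qint_bar (a - i%:Z).

Definition qfact (k : nat) : Qv := \prod_(i < k) qint_bar (i%:Z + 1).

Lemma qint_bar0 : qint_bar 0 = 0.
Proof. by rewrite qint_barE mulr0 oppr0 expr0z subrr mul0r. Qed.

Lemma qbin_barE a k : qbin_bar a k = qfall a k / qfact k.
Proof.
rewrite /qbin_bar /qbin big_add1 big_mkord /qfall /qfact -prodf_div; apply: eq_bigr => i _.
rewrite /qint_bar /qbin_bar /qbin !big_nat1 !mulr1 !subrK.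
have d0 : (v^-1 ^ 2 - 1 : Qv) != 0.
  rewrite subr_eq0 exprz_inv; apply: vexp_neq1; lia.
rewrite invf_div mulrA divfK //.
have -> : a - i.+1%:Z + 1 = a - i%:Z by lia.
by have -> : (2 * (i%:Z + 1)) = 2 * i.+1%:Z by lia.
Qed.

Lemma qfallS a k : qfall a k.+1 = qint_bar a * qfall (a - 1) k.
Proof.
rewrite /qfall big_ord_recl subr0; congr (_ * _); apply: eq_bigr => i _.
by congr qint_bar; rewrite /= /bump /=; lia.
Qed.

Lemma qfallSr a k : qfall a k.+1 = qfall a k * qint_bar (a - k%:Z).
Proof. by rewrite /qfall big_ord_recr. Qed.

Lemma qfactS k : qfact k.+1 = qfact k * qint_bar (k%:Z + 1).
Proof. by rewrite /qfact big_ord_recr. Qed.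

Lemma qbin_absorb a k : qint_bar (k%:Z + 1) * qbin_bar a k.+1 = qint_bar a * qbin_bar (a - 1) k.
Proof.
rewrite !qbin_barE qfallS qfactS.
have h0 : qint_bar (k%:Z + 1) != 0 by apply: qint_bar_neq0; lia.
have cancel (F : fieldType) (x y z w : F) : z != 0 -> z * (x * y / (w * z)) = x * (y / w).
  move=> z0; have [->|w0] := eqVneq w 0; first by rewrite mul0r invr0 !mulr0.
  by field; rewrite z0 w0.
exact: cancel.
Qed.

Lemma qbin_shift a k : qint_bar (a - k%:Z) * qbin_bar a k = qint_bar a * qbin_bar (a - 1) k.
Proof.
rewrite !qbin_barE !mulrA; congr (_ / _).
by rewrite mulrC -qfallSr qfallS.
Qed.

Section Recursion.
Variable n : nat.
Local Notation N := (n.*2.+1).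
Implicit Types (M : 'M[int]_N) (f : 'I_N -> nat).

Definition incr f (u : 'I_N) : 'I_N -> nat := fun w => (f w + (w == u))%N.

Definition move_rows M (a b : 'I_N) f : 'M[int]_N :=
  M + \sum_u (Etheta b u - Etheta a u) *+ f u.

Definition quad (W : nat -> nat -> bool) f : int :=
  \sum_(j < N) \sum_(l < N | W j l) (f j)%:Z * (f l)%:Z.

Definition lin (X : 'I_N -> int) f : int := \sum_(j < N) X j * (f j)%:Z.

Lemma lin_incr X f u : lin X (incr f u) = lin X f + X u.
Proof.
rewrite /lin (bigD1 u) //= [in RHS](bigD1 u) //= /incr eqxx.
have -> : \sum_(j < N | j != u) X j * (f j + (j == u))%N%:Z = \sum_(j < N | j != u) X j * (f j)%:Z.
  by apply: eq_bigr => j /negbTE ->; rewrite addn0.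
have -> : (f u + true)%N%:Z = (f u)%:Z + 1 by lia.
ring.
Qed.

Lemma sum_incr (P : pred 'I_N) f (u : 'I_N) :
  \sum_(l < N | P l) (incr f u l)%:Z = \sum_(l < N | P l) (f l)%:Z + (P u)%:R.
Proof.
rewrite /incr; case Pu : (P u).
  rewrite (bigD1 u) //= eqxx [in RHS](bigD1 u) //=.
  have -> : \sum_(j < N | P j && (j != u)) (f j + (j == u))%N%:Z = \sum_(j < N | P j && (j != u)) (f j)%:Z.
    by apply: eq_bigr => j /andP[_ /negbTE ->]; rewrite addn0.
  by rewrite PoszD addrAC.
rewrite addr0; apply: eq_bigr => j Pj; have -> : (j == u) = false by apply/eqP=> e; rewrite -e Pj in Pu.
by rewrite addn0.
Qed.

Lemma quad_incr W f (u : 'I_N) :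
  quad W (incr f u) = quad W f + \sum_(l < N | W u l) (f l)%:Z
    + \sum_(j < N | W j u) (f j)%:Z + (W u u)%:R.
Proof.
rewrite /quad.
transitivity (\sum_(j < N) (incr f u j)%:Z * (\sum_(l < N | W j l) (f l)%:Z + (W j u)%:R)).
  by apply: eq_bigr => j _; rewrite -(sum_incr (fun l => W j l)) mulr_sumr.
pose X (j : 'I_N) : int := \sum_(l < N | W j l) (f l)%:Z + (W j u)%:R.
transitivity (lin X (incr f u)); first by apply: eq_bigr => j _; rewrite mulrC.
rewrite lin_incr /X addrA; congr (_ + _).
rewrite -addrA [X in _ = _ + X]addrC addrA; congr (_ + _).
rewrite /lin [X in _ = _ + X]big_mkcond -big_split; apply: eq_bigr => j _ /=.
rewrite mulrDl mulr_suml; congr (_ + _); first by apply: eq_bigr => l _; rewrite mulrC.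
by case: (W j u); rewrite ?mul1r ?mul0r.
Qed.

Definition weight f : nat := \sum_u f u.

Lemma weight_incr f u : weight (incr f u) = (weight f).+1.
Proof.
have := sum_incr xpredT f u; rewrite /weight.
rewrite -!(big_morph Posz PoszD (erefl _)) /= => e; move: e; lia.
Qed.

Lemma move_rowsE M (a b : 'I_N) f i j : b = a.+1 :> nat ->
  move_rows M a b f i j = M i j
    + ((i == b)%:R - (i == a)%:R) * (f j)%:Z
    + ((i == rev_ord b)%:R - (i == rev_ord a)%:R) * (f (rev_ord j))%:Z.
Proof.
move=> ab; rewrite mxDE summxE -addrA; congr (_ + _).
transitivity (\sum_(u < N) (((i == b)%:R - (i == a)%:R) * (j == u)%:R * (f u)%:Z
   + ((i == rev_ord b)%:R - (i == rev_ord a)%:R) * (rev_ord j == u)%:R * (f u)%:Z : int)).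
  apply: eq_bigr => u _; rewrite mulmxnE mxBE -[LHS]mulr_natr [X in _ * X]natz /Etheta !mxE.
  rewrite -(can2_eq rev_ordK rev_ordK j u) -!mulnb !natrM; ring.
rewrite big_split /=; congr (_ + _).
  rewrite (bigD1 j) //= eqxx mulr1 big1 ?addr0 // => u /negbTE uj.
  by rewrite [j == u]eq_sym uj mulr0 mul0r.
rewrite (bigD1 (rev_ord j)) //= eqxx mulr1 big1 ?addr0 // => u /negbTE uj.
by rewrite [rev_ord j == u]eq_sym uj mulr0 mul0r.
Qed.

Variables (a b : 'I_N).
Hypothesis ab : b = a.+1 :> nat.

Lemma row_b M f j : move_rows M a b f b j =
  M b j + (f j)%:Z + (b == n :> nat)%:R * (f (rev_ord j))%:Z.
Proof.
have bN := ltn_ord b; rewrite move_rowsE // eqxx -!(inj_eq val_inj) /=.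
have -> : (b == a :> nat) = false by lia.
have -> : (b == N - b.+1 :> nat)%N = (b == n :> nat) by lia.
have -> : (b == N - a.+1 :> nat)%N = false by lia.
by rewrite !subr0 mul1r.
Qed.

Lemma row_a M f j : move_rows M a b f a j =
  M a j - (f j)%:Z - (a == n :> nat)%:R * (f (rev_ord j))%:Z.
Proof.
have bN := ltn_ord b; rewrite move_rowsE // eqxx -!(inj_eq val_inj) /=.
have -> : (a == b :> nat) = false by lia.
have -> : (a == N - b.+1 :> nat)%N = false by lia.
have -> : (a == N - a.+1 :> nat)%N = (a == n :> nat) by lia.
by rewrite !sub0r mulN1r mulNr.
Qed.

(** This is the exponent beta' of formula (2), read for any two adjacent rows a and b. Formulas (1)
    and (3) add middle-row corrections to it. *)
Definition gen_exp M f : int :=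
  lin (fun j => \sum_(l < N | (l <= j)%N) M b l) f - lin (fun j => \sum_(l < N | (l < j)%N) M a l) f
  + quad (fun j l => (l < j)%N) f.

Lemma sum_rev (P : pred 'I_N) (X : 'I_N -> int) :
  \sum_(l | P l) X (rev_ord l) = \sum_(l | P (rev_ord l)) X l.
Proof. by rewrite [RHS](reindex_inj rev_ord_inj); apply: eq_bigl => l; rewrite rev_ordK. Qed.

Lemma weight_split f (u : 'I_N) :
  (weight f)%:Z = \sum_(l < N | (l < u)%N) (f l)%:Z + (f u)%:Z + \sum_(l < N | (u < l)%N) (f l)%:Z.
Proof.
rewrite /weight (big_morph Posz PoszD (erefl _)) (bigID (fun l : 'I_N => (l < u)%N)) /= -addrA.
congr (_ + _); rewrite (bigD1 u) ?ltnn //=; congr (_ + _); apply: eq_bigl => l.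
by rewrite -leqNgt ltn_neqAle eq_sym andbC.
Qed.

(** The last two summands measure the failure of the generic recursion. They occur only when a or b
    is the middle row, where the mirror images of the units already moved lie in the same row. *)
Lemma gen_exp_step M f u :
  gen_exp M f + chev_exp (move_rows M a b f) a b u =
  gen_exp M (incr f u) + ((weight f)%:Z - 2 * \sum_(l < N | (u < l)%N) (f l)%:Z)
  + (b == n :> nat)%:R * \sum_(l < N | (n.*2 <= l + u)%N) (f l)%:Z
  + (a == n :> nat)%:R * (\sum_(l < N | (n.*2 < l + u)%N) (f l)%:Z + (n < u)%N%:R).
Proof.
have uN := ltn_ord u.
rewrite /gen_exp !lin_incr quad_incr ltnn addr0 /chev_exp.
under eq_bigr => l _ do rewrite row_b.
under [X in _ + (_ - X + _)]eq_bigr => l _ do rewrite row_a.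
rewrite !big_split /= !sumrN -!mulr_sumr !(sum_rev _ (fun l => (f l)%:Z)).
have -> : \sum_(l < N | (rev_ord l <= u)%N) (f l)%:Z = \sum_(l < N | (n.*2 <= l + u)%N) (f l)%:Z.
  by apply: eq_bigl => l /=; have := ltn_ord l; lia.
have -> : \sum_(l < N | (rev_ord l < u)%N) (f l)%:Z = \sum_(l < N | (n.*2 < l + u)%N) (f l)%:Z.
  by apply: eq_bigl => l /=; have := ltn_ord l; lia.
have -> : \sum_(l < N | (l <= u)%N) (f l)%:Z = \sum_(l < N | (l < u)%N) (f l)%:Z + (f u)%:Z.
  by rewrite (bigD1 u) //= addrC; congr (_ + _); apply: eq_bigl => l; rewrite ltn_neqAle andbC.
rewrite (weight_split f u).
have -> : ((a == n :> nat) && (n < u)%N)%:R = (a == n :> nat)%:R * (n < u)%N%:R :> int.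
  by rewrite -mulnb natrM.
ring.
Qed.

End Recursion.

Lemma half_triangle k : ((k.+1 * k)./2 = (k * k.-1)./2 + k)%N.
Proof. by have := binS k 1; rewrite bin1 !bin2 addnC. Qed.

(** * One-step recursions of the three families of coefficients *)

Section Coefficients.
Variable n : nat.
Local Notation N := (n.*2.+1).
Implicit Types (M : 'M[int]_N) (f : 'I_N -> nat).
Variables (a b : 'I_N).
Hypothesis ab : b = a.+1 :> nat.
Local Notation gen_exp := (gen_exp a b).

Definition gen_prod M f : Qv := \prod_u qbin_bar (M b u + (f u)%:Z) (f u).

Lemma gen_prod_step M f u :
  gen_prod M f * qint_bar (M b u + (f u)%:Z + 1) = qint_bar ((f u)%:Z + 1) * gen_prod M (incr f u).
Proof.
rewrite /gen_prod (bigD1 u isT) [in RHS](bigD1 u isT) /=.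
have -> : \prod_(i | i != u) qbin_bar (M b i + (incr f u i)%:Z) (incr f u i)
   = \prod_(i | i != u) qbin_bar (M b i + (f i)%:Z) (f i).
  by apply: eq_bigr => i /negbTE iu; rewrite /incr iu addn0.
rewrite {1 2}/incr eqxx addn1 mulrA qbin_absorb.
have -> : M b u + (f u).+1%:Z = M b u + (f u)%:Z + 1 by lia.
by rewrite addrK mulrAC [X in X * _]mulrC.
Qed.

Lemma coef_step_glue (e0 e1 w x : int) (P P' q q' : Qv) : e0 + x = e1 + w -> P * q = q' * P' ->
  v ^ e0 * P * (v ^ x * q) = v ^ w * q' * (v ^ e1 * P').
Proof.
move=> e h; rewrite mulrACA h -vexpD e [RHS]mulrACA -vexpD addrC.
by [].
Qed.

Definition coef_generic M f : Qv := v ^ gen_exp M f * gen_prod M f.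

Local Notation tail f u := ((weight f)%:Z - 2 * \sum_(l < N | (u < l)%N) (f l)%:Z).

(** One more generator is applied to the matrix reached by f. The factor on the right no longer
    involves M, so the contributions of all columns u to one final vector can be added by
    [qint_bar_telescope]. *)
Lemma coef_generic_step M f u : a != n :> nat -> b != n :> nat ->
  coef_generic M f * chev (move_rows M a b f) a b u =
  v ^ tail f u * qint_bar ((f u)%:Z + 1) * coef_generic M (incr f u).
Proof.
move=> an bn; apply: coef_step_glue.
  by have := gen_exp_step ab M f u; rewrite (negbTE an) (negbTE bn) !mul0r !addr0.
by rewrite (row_b ab) (negbTE bn) mul0r addr0 gen_prod_step.
Qed.

(* The corrections to the exponent when row a, resp. row b, is the middle row. *)
Definition exp_upper f : int := quad (fun j l : nat => (l < j) && (n.*2 < j + l))%N f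
  + \sum_(j < N | (n < j)%N) ((f j * (f j).+1)./2)%:Z.

Definition coef_upper M f : Qv := v ^ (gen_exp M f + exp_upper f) * gen_prod M f.

Lemma sum_incr_at (P : pred 'I_N) (h : nat -> int) f u :
  \sum_(j | P j) h (incr f u j) = \sum_(j | P j) h (f j) + (P u)%:R * (h (f u).+1 - h (f u)).
Proof.
case Pu : (P u); last first.
  rewrite mul0r addr0; apply: eq_bigr => j Pj; rewrite /incr.
  by have -> : (j == u) = false; [apply/eqP=> e; rewrite -e Pj in Pu | rewrite addn0].
rewrite (bigD1 u) //= [in RHS](bigD1 u) //= mul1r {1}/incr eqxx addn1.
have -> : \sum_(j | P j && (j != u)) h (incr f u j) = \sum_(j | P j && (j != u)) h (f j).
  by apply: eq_bigr => j /andP[_ /negbTE ju]; rewrite /incr ju addn0.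
ring.
Qed.

Lemma exp_upper_step f (u : 'I_N) :
  exp_upper (incr f u) = exp_upper f + \sum_(l < N | (n.*2 < l + u)%N) (f l)%:Z + (n < u)%N%:R.
Proof.
rewrite /exp_upper quad_incr ltnn /= addr0.
rewrite (sum_incr_at (fun j : 'I_N => (n < j)%N) (fun k => (k * k.+1)./2%:Z)).
have tri : ((f u).+1 * (f u).+2)./2%:Z = (f u * (f u).+1)./2%:Z + (f u)%:Z + 1.
  by rewrite [(_ * (f u).+2)%N]mulnC half_triangle /= [((f u).+1 * _)%N]mulnC; lia.
rewrite tri.
have -> : \sum_(l < N | (n.*2 < l + u)%N) (f l)%:Z
   = \sum_(l < N | ((l < u) && (n.*2 < u + l))%N) (f l)%:Z
   + \sum_(j < N | ((u < j) && (n.*2 < j + u))%N) (f j)%:Z + (n < u)%N%:R * (f u)%:Z.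
  rewrite (bigID (fun l : 'I_N => (l < u)%N)) /= -addrA; congr (_ + _).
    by apply: eq_bigl => l; rewrite andbC addnC.
  rewrite (bigID (fun l : 'I_N => (u < l)%N)) /=; congr (_ + _).
    by apply: eq_bigl => l; lia.
  case nu : (n < u)%N; last first.
    by rewrite mul0r big_pred0 // => l; move: nu; lia.
  rewrite (eq_bigl (pred1 u)) ?big_pred1_eq ?mul1r // => l /=.
  by rewrite -(inj_eq val_inj) /=; lia.
ring.
Qed.

Lemma coef_upper_step M f u : a = n :> nat ->
  coef_upper M f * chev (move_rows M a b f) a b u =
  v ^ tail f u * qint_bar ((f u)%:Z + 1) * coef_upper M (incr f u).
Proof.
move=> an; have bn : (b == n :> nat) = false by lia.
apply: coef_step_glue.
  have := gen_exp_step ab M f u; rewrite an eqxx bn mul0r addr0 mul1r exp_upper_step.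
  by move=> h; rewrite addrAC h; ring.
by rewrite (row_b ab) bn mul0r addr0 gen_prod_step.
Qed.

Definition exp_lower f : int := quad (fun j l : nat => (j < l) && (j + l < n.*2))%N f
  + \sum_(j < N | (j < n)%N) ((f j * (f j).-1)./2)%:Z - ((weight f * (weight f).-1)./2)%:Z.

Lemma exp_lower_step f (u : 'I_N) :
  exp_lower (incr f u) = exp_lower f + \sum_(l < N | (l + u < n.*2)%N) (f l)%:Z - (weight f)%:Z.
Proof.
rewrite /exp_lower quad_incr ltnn /= addr0 weight_incr half_triangle.
rewrite (sum_incr_at (fun j : 'I_N => (j < n)%N) (fun k => (k * k.-1)./2%:Z)).
rewrite half_triangle /= PoszD.
have -> : \sum_(l < N | (l + u < n.*2)%N) (f l)%:Z
   = \sum_(l < N | ((u < l) && (u + l < n.*2))%N) (f l)%:Z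
   + \sum_(j < N | ((j < u) && (j + u < n.*2))%N) (f j)%:Z + (u < n)%N%:R * (f u)%:Z.
  rewrite (bigID (fun l : 'I_N => (u < l)%N)) /= -addrA; congr (_ + _).
    by apply: eq_bigl => l; rewrite andbC addnC.
  rewrite (bigID (fun l : 'I_N => (l < u)%N)) /=; congr (_ + _).
    by apply: eq_bigl => l; lia.
  case nu : (u < n)%N; last first.
    by rewrite mul0r big_pred0 // => l; move: nu; lia.
  rewrite (eq_bigl (pred1 u)) ?big_pred1_eq ?mul1r // => l /=.
  by rewrite -(inj_eq val_inj) /=; lia.
rewrite !PoszD; ring.
Qed.

Definition mid_prod M f : Qv :=
  (\prod_(u < N | (u < n)%N) qbin_bar (M b u + (f u)%:Z + (f (rev_ord u))%:Z) (f u))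
  * (\prod_(u < N | (n < u)%N) qbin_bar (M b u + (f u)%:Z) (f u))
  * (\prod_(0 <= i < f (inord n))
        (qint_bar (M (inord n) (inord n) + 1 + 2 * i%:Z) / qint_bar (i%:Z + 1))).

Definition coef_lower M f : Qv := v ^ (gen_exp M f - exp_lower f) * mid_prod M f.

(** For u < n only the factor of column u changes. For u > n the factor of the mirror column changes
    too, its upper index containing f u; absorption in one factor and the shift of the other
    combine. For u = n the last product gains one factor. *)
Lemma mid_prod_step M f u : b = n :> nat -> centrosymmetric M ->
  mid_prod M f * qint_bar (M b u + (f u)%:Z + (f (rev_ord u))%:Z + 1)
  = qint_bar ((f u)%:Z + 1) * mid_prod M (incr f u).
Proof.
move=> bn cM; have uN := ltn_ord u.
have bE : b = inord n by apply: val_inj; rewrite /= inordK ?center_lt.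
have Mb w : M b (rev_ord w) = M b w.
  rewrite -[RHS](centrosymmetricE b w cM); congr (M _ _).
  by apply: val_inj => /=; lia.
have incrN w : w != u -> incr f u w = f w by move=> /negbTE wu; rewrite /incr wu addn0.
have incrU : incr f u u = (f u).+1 by rewrite /incr eqxx addn1.
have neq (w : 'I_N) : (w != u) = (w != u :> nat) by [].
rewrite /mid_prod.
have absorb (m : int) k : qint_bar (k%:Z + 1) * qbin_bar (m + k.+1%:Z) k.+1
    = qint_bar (m + k%:Z + 1) * qbin_bar (m + k%:Z) k.
  rewrite qbin_absorb; have -> : m + k.+1%:Z = m + k%:Z + 1 by lia.
  by rewrite addrK.
have [un|un|un] := ltngtP u n.
- have P2 : \prod_(w < N | (n < w)%N) qbin_bar (M b w + (incr f u w)%:Z) (incr f u w)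
      = \prod_(w < N | (n < w)%N) qbin_bar (M b w + (f w)%:Z) (f w).
    by apply: eq_bigr => w nw; rewrite incrN // neq; lia.
  have P3 : incr f u (inord n) = f (inord n).
    by rewrite incrN // neq inordK ?center_lt //; lia.
  rewrite P2 P3 (bigD1 u un) [in RHS](bigD1 u un) /=.
  have -> : \prod_(w < N | (w < n)%N && (w != u))
       qbin_bar (M b w + (incr f u w)%:Z + (incr f u (rev_ord w))%:Z) (incr f u w)
     = \prod_(w < N | (w < n)%N && (w != u)) qbin_bar (M b w + (f w)%:Z + (f (rev_ord w))%:Z) (f w).
    apply: eq_bigr => w /andP[wn wu]; rewrite !incrN // neq /=; lia.
  rewrite incrU incrN; last by rewrite neq /=; lia.
  have h := absorb (M b u + (f (rev_ord u))%:Z) (f u).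
  have e1 : M b u + (f (rev_ord u))%:Z + (f u).+1%:Z = M b u + (f u).+1%:Z + (f (rev_ord u))%:Z by lia.
  have e2 : M b u + (f (rev_ord u))%:Z + (f u)%:Z = M b u + (f u)%:Z + (f (rev_ord u))%:Z by lia.
  rewrite e1 e2 in h; rewrite !mulrA h mulrC !mulrA //.
- have P1 : \prod_(w < N | (w < n)%N && (w != rev_ord u))
       qbin_bar (M b w + (incr f u w)%:Z + (incr f u (rev_ord w))%:Z) (incr f u w)
     = \prod_(w < N | (w < n)%N && (w != rev_ord u)) qbin_bar (M b w + (f w)%:Z + (f (rev_ord w))%:Z) (f w).
    apply: eq_bigr => w /andP[wn wu]; rewrite !incrN //.
      by rewrite (can2_eq rev_ordK rev_ordK).
    by rewrite neq; lia.
  have P3 : incr f u (inord n) = f (inord n).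
    by rewrite incrN // neq inordK ?center_lt //; lia.
  have P2 : \prod_(w < N | (n < w)%N && (w != u)) qbin_bar (M b w + (incr f u w)%:Z) (incr f u w)
      = \prod_(w < N | (n < w)%N && (w != u)) qbin_bar (M b w + (f w)%:Z) (f w).
    by apply: eq_bigr => w /andP[_ wu]; rewrite incrN.
  have ru : (rev_ord u < n)%N by move=> /=; lia.
  rewrite P3 (bigD1 (rev_ord u) ru) [in RHS](bigD1 (rev_ord u) ru) P1.
  rewrite (bigD1 u un) [in RHS](bigD1 u un) P2 /= rev_ordK incrU incrN; last by rewrite neq /=; lia.
  rewrite Mb; set y := f (rev_ord u); set k := f u; set m := M b u.
  have h1 := absorb m k.
  have h2 := qbin_shift (m + y%:Z + k.+1%:Z) y.
  have e1 : m + y%:Z + k.+1%:Z - y%:Z = m + k%:Z + 1 by lia.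
  have e2 : m + y%:Z + k.+1%:Z - 1 = m + y%:Z + k%:Z by lia.
  have e3 : m + k%:Z + y%:Z + 1 = m + y%:Z + k.+1%:Z by lia.
  rewrite e1 e2 -e3 in h2; rewrite -e3.
  have comb (R : comNzRingType) (A1 A2 B1 B2 X Y Z s t w x : R) : s * B2 = t * B1 -> t * A2 = w * A1 ->
      A1 * X * (B1 * Y) * Z * w = s * (A2 * X * (B2 * Y) * Z).
    move=> hB hA; have -> : A1 * X * (B1 * Y) * Z * w = (w * A1) * B1 * (X * Y * Z) by ring.
    have -> : s * (A2 * X * (B2 * Y) * Z) = (s * B2) * A2 * (X * Y * Z) by ring.
    by rewrite -hA hB; ring.
  exact: (comb _ _ _ _ _ _ _ _ _ _ _ 0 h1 h2).
- have uE : u = inord n by apply: val_inj; rewrite /= inordK ?center_lt.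
  have P1 : \prod_(w < N | (w < n)%N)
       qbin_bar (M b w + (incr f u w)%:Z + (incr f u (rev_ord w))%:Z) (incr f u w)
     = \prod_(w < N | (w < n)%N) qbin_bar (M b w + (f w)%:Z + (f (rev_ord w))%:Z) (f w).
    by apply: eq_bigr => w wn; rewrite !incrN // neq /=; lia.
  have P2 : \prod_(w < N | (n < w)%N) qbin_bar (M b w + (incr f u w)%:Z) (incr f u w)
      = \prod_(w < N | (n < w)%N) qbin_bar (M b w + (f w)%:Z) (f w).
    by apply: eq_bigr => w nw; rewrite incrN // neq; lia.
  have ruu : rev_ord u = u by apply: val_inj => /=; lia.
  rewrite P1 P2 -uE incrU ruu big_nat_recr //= bE -uE.
  have -> : M u u + (f u)%:Z + (f u)%:Z + 1 = M u u + 1 + 2 * (f u)%:Z by lia.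
  have q0 : qint_bar ((f u)%:Z + 1) != 0 by apply: qint_bar_neq0; lia.
  have comb (F : fieldType) (X Y Z s t : F) : s != 0 -> X * Y * Z * t = s * (X * Y * (Z * (t / s))).
    by move=> s0; field; rewrite s0.
  exact: comb.
Qed.

Lemma coef_lower_step M f u : b = n :> nat -> centrosymmetric M ->
  coef_lower M f * chev (move_rows M a b f) a b u =
  v ^ tail f u * qint_bar ((f u)%:Z + 1) * coef_lower M (incr f u).
Proof.
move=> bn cM; have an : (a == n :> nat) = false by lia.
apply: coef_step_glue.
  have := gen_exp_step ab M f u; rewrite an bn eqxx mul0r addr0 mul1r exp_lower_step.
  have : (weight f)%:Z = \sum_(l < N | (n.*2 <= l + u)%N) (f l)%:Z + \sum_(l < N | (l + u < n.*2)%N) (f l)%:Z.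
    rewrite /weight (big_morph Posz PoszD (erefl _)) (bigID (fun l : 'I_N => (n.*2 <= l + u)%N)) /=.
    by congr (_ + _); apply: eq_bigl => l; rewrite -ltnNge.
  move=> hw h; rewrite addrAC h; move: hw; set S1 := \sum_(l < N | (n.*2 <= _)%N) _ => ->; ring.
by rewrite (row_b ab) bn eqxx mul1r mid_prod_step.
Qed.

End Coefficients.

(** Repeated use of [a + b] = [a] + v^(-2a) [b] for barred quantum integers. The sum over the column
    of the last unit moved thereby becomes the factor [R+1] of the product of a generator with its
    R-fold analogue. *)
Lemma qint_bar_telescope m (s : 'I_m -> nat) :
  \sum_(u < m) v ^ (- (2 * \sum_(l < m | (u < l)%N) (s l)%:Z)) * qint_bar (s u)%:Z
  = qint_bar (\sum_u s u)%N%:Z.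
Proof.
elim: m s => [|m IH] s.
  by rewrite !big_ord0 qint_bar0.
rewrite big_ord_recl [in RHS]big_ord_recl.
have -> : \sum_(i < m) v ^ (- (2 * \sum_(l < m.+1 | (fintype.lift ord0 i < l)%N) (s l)%:Z))
      * qint_bar (s (fintype.lift ord0 i))%:Z
    = \sum_(i < m) v ^ (- (2 * \sum_(l < m | (i < l)%N) (s (fintype.lift ord0 l))%:Z))
      * qint_bar (s (fintype.lift ord0 i))%:Z.
  apply: eq_bigr => i _; congr (v ^ (- (2 * _)) * _).
  rewrite big_mkcond big_ord_recl /= add0r [RHS]big_mkcond; exact: eq_bigr.
rewrite (IH (fun i => s (fintype.lift ord0 i))).
have -> : \sum_(l < m.+1 | (@ord0 m < l)%N) (s l)%:Z = (\sum_(i < m) s (fintype.lift ord0 i))%N%:Z.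
  by rewrite big_mkcond big_ord_recl /= add0r (big_morph Posz PoszD (erefl _)).
rewrite addnC PoszD qint_bar_split; exact: addrC.
Qed.

Section ReindexIncr.
Variables (m K : nat) (V : nmodType).
Local Notation T := {ffun 'I_m -> 'I_K.+1}.

(** The bound K is common to both sides, so that adding a unit stays in one finite type. Vectors
    with zero entry at u are not of the form t + e_u, and F must vanish on them. *)
Lemma sum_incr_reindex R (u : 'I_m) (F : ('I_m -> nat) -> V) : (R < K)%N ->
  (forall f, f u = 0%N -> F f = 0) ->
  \sum_(t : T | (\sum_w t w == R)%N) F (fun w => (t w + (w == u))%N)
  = \sum_(t : T | (\sum_w t w == R.+1)%N) F (fun w => t w : nat).
Proof.
move=> RK F0.
rewrite [RHS](bigID (fun t : T => (t u : nat) == 0%N)) /= [X in _ = X + _]big1 ?add0r; last first.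
  by move=> t /andP[_ /eqP tu]; apply: F0.
pose h (t : T) : T := [ffun w => inord (t w + (w == u))].
pose h' (t : T) : T := [ffun w => inord (t w - (w == u))].
have le_sum (t : T) w : (t w <= \sum_i t i)%N by rewrite (bigD1 w) //= leq_addr.
rewrite [RHS](reindex_onto h h') /=; last first.
  move=> t /andP[/eqP st tu]; apply/ffunP=> w; rewrite !ffunE; apply: val_inj.
  have tw := ltn_ord (t w).
  have e : (inord (t w - (w == u)) : 'I_K.+1) = (t w - (w == u))%N :> nat by rewrite inordK //; lia.
  rewrite /= inordK e.
    by case: eqP => [->|]; move: tu; lia.
  by case: eqP => [->|]; move: tw tu; have := ltn_ord (t u); lia.
have hE (t : T) : (t u < K)%N -> (fun w => h t w : nat) = (fun w => (t w + (w == u))%N).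
  move=> tu; apply/funext => w; rewrite ffunE inordK //.
  by case: eqP => [->|_]; have := ltn_ord (t w); lia.
have sumE (t : T) : (\sum_w (t w + (w == u)) = (\sum_w t w).+1)%N.
  rewrite big_split /= -[RHS]addn1; congr (_ + _)%N.
  by rewrite (bigD1 u) //= eqxx big1 ?addn0 // => i /negbTE ->.
have condE (t : T) : ((\sum_w h t w == R.+1) && ((h t u : nat) != 0%N) && (h' (h t) == t))%N
    = (\sum_w t w == R)%N.
  (* When t u = K the increment overflows and [inord] returns 0. Such t is excluded on the left by h
     t u != 0 and on the right because R < K. *)
  have [tu|tu] := ltnP (t u) K; last first.
    have e : h t u = 0 :> nat.
      rewrite ffunE eqxx addn1 /inord /insubd insubF //; lia.
    by rewrite e eqxx andbF /=; apply/esym/eqP => s; have := le_sum t u; rewrite s => h1; have := leq_trans tu h1; rewrite leqNgt RK.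
  have hw w : h t w = (t w + (w == u))%N :> nat by have := congr1 (fun f => f w) (hE t tu).
  under eq_bigr => w _ do rewrite hw.
  rewrite sumE eqSS hw eqxx addn1 andbT.
  have -> : h' (h t) == t.
    by apply/eqP/ffunP=> w; apply: val_inj; rewrite ffunE hw addnK inord_val.
  by rewrite andbT.
apply: eq_big => [t|t /eqP st]; first by rewrite condE.
by rewrite hE //; have := le_sum t u; rewrite st => h1; exact: leq_ltn_trans h1 RK.
Qed.

End ReindexIncr.

(** * Products with multiples of a generator in the limit algebra *)

Section Generators.
Variable n : nat.
Local Notation N := (n.*2.+1).
Variables (g : forall d, Xi n d -> Xi n d -> Xi n d -> {poly int}).
Hypothesis g_spec : structure_polynomials g.
Implicit Types (M X : 'M[int]_N) (A B C Z : Xit n) (f : 'I_N -> nat).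

Local Notation mulKQ := (mulKQ g_spec).

Lemma KQ_basis_val A : KQ_basis (val A) = << A >>.
Proof. by rewrite /KQ_basis valK. Qed.

Lemma KQ_basis0 M : ~~ in_Xit M -> KQ_basis M = 0.
Proof. by move=> h; rewrite /KQ_basis insubN. Qed.

Lemma spec_basisP M : spec (basisP M) = KQ_basis M.
Proof.
rewrite /basisP /KQ_basis; case: insubP => [Z _ _|_]; [exact: spec_basis | exact: freeg_map0].
Qed.

Lemma mulKQ_Stab A B z : Stab g << A >> << B >> z -> mulKQ << A >> << B >> = spec z.
Proof.
by move=> h; rewrite -!spec_basis -spec_mul (mulP_uniq g_spec h).
Qed.

Lemma mulKQ_diag A C : is_diag_mx (val C) -> co (val C) = ro (val A) -> mulKQ << C >> << A >> = << A >>.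
Proof. by move=> dC coC; rewrite (mulKQ_Stab (Stab_diag g_spec dC coC)) spec_basis. Qed.

Lemma mulKQ0r x : mulKQ x 0 = 0.
Proof. by have := fgmulZr (structKQ g_spec) 0 x (0 : KQ n); rewrite !scale0r. Qed.

Lemma mulKQ_sumr x (I : finType) (P : pred I) (k : I -> Qv) (y : I -> KQ n) :
  mulKQ x (\sum_(i | P i) k i *: y i) = \sum_(i | P i) k i *: mulKQ x (y i).
Proof.
have D : {morph mulKQ x : y z / y + z} by exact: fgmulDr.
rewrite (big_morph _ D (mulKQ0r x)); apply: eq_bigr => i _; exact: fgmulZr.
Qed.

Variables (a b : 'I_N).
Hypothesis ab : b = a.+1 :> nat.

Lemma mulKQ_chevalley A C : is_diag_mx (val C - Etheta b a) -> co (val C) = ro (val A) ->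
  mulKQ << C >> << A >> =
  \sum_u chev (val A) a b u *: KQ_basis (val A + (Etheta b u - Etheta a u)).
Proof.
move=> dC coC; rewrite (mulKQ_Stab (Stab_chevalley g_spec ab dC coC)).
rewrite /spec (big_morph _ (@freeg_mapD _ _ _ _) (@freeg_map0 _ _ _ _)).
apply: eq_bigr => u _; rewrite freeg_mapZ -/(spec _) spec_basisP; congr (_ *: _); exact: chevP1.
Qed.

Lemma ro_move_rows M f : ro (move_rows M a b f) = ro M + (ro (Etheta b a) - co (Etheta b a)) *+ weight f.
Proof.
rewrite /move_rows roD; congr (_ + _).
have roS : {morph @ro N : x y / x + y} by move=> x y; exact: roD.
have ro0 : ro (0 : 'M[int]_N) = 0 by apply/matrixP=> i j; rewrite !mxE big1 // => k _; rewrite mxE.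
rewrite (big_morph _ roS ro0) /weight -sumrMnr; apply: eq_bigr => u _.
by rewrite roMn roB !ro_Etheta co_Etheta.
Qed.

Lemma move_rows0 M : move_rows M a b (fun=> 0%N) = M.
Proof. by rewrite /move_rows big1 ?addr0. Qed.

Lemma move_rows_incr M f u : move_rows M a b (incr f u) = move_rows M a b f + (Etheta b u - Etheta a u).
Proof.
rewrite /move_rows -addrA; congr (_ + _); under eq_bigr => w _ do rewrite mulrnDr.
rewrite big_split /=; congr (_ + _); rewrite (bigD1 u isT) /= eqxx mulr1n big1 ?addr0 //.
by move=> w /negbTE ->.
Qed.

Lemma move_rows_sym M f : centrosymmetric M -> centrosymmetric (move_rows M a b f).
Proof.
move=> cM; apply: centrosymmetricD => //.
apply/forallP=> i; apply/forallP=> j; rewrite !summxE; apply/eqP; apply: eq_bigr => u _.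
rewrite !mulmxnE; congr (_ *+ _); apply/esym/centrosymmetricE.
by apply: centrosymmetricD; rewrite ?centrosymmetricN // centrosymmetric_Etheta.
Qed.

Lemma in_Xit_move_rows A f :
  (forall i j, i != j -> 0 <= move_rows (val A) a b f i j) -> in_Xit (move_rows (val A) a b f).
Proof.
move=> h; apply/in_XitP; split=> //; last exact: move_rows_sym (Xit_sym A).
have /in_XitP[_ o _] := valP A; rewrite move_rowsE //.
have nn : rev_ord (inord n : 'I_N) = inord n.
  by apply: val_inj; rewrite /= inordK ?center_lt //; lia.
have e (c : 'I_N) : (inord n == rev_ord c) = (inord n == c).
  by rewrite -{1}nn (inj_eq rev_ord_inj).
by rewrite !e nn; move: o; move: (val A _ _) => x; case: (_ == b); case: (_ == a); lia.
Qed.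

Lemma in_Xit_move_rows_incr A f u :
  in_Xit (move_rows (val A) a b (incr f u)) -> in_Xit (move_rows (val A) a b f).
Proof.
have bN := ltn_ord b.
case/in_XitP=> h _ _; apply: in_Xit_move_rows => i j ij.
have := h i j ij; have := Xit_off A ij; rewrite !move_rowsE //.
have e0 w : (incr f u w)%:Z = (f w)%:Z + (w == u)%:R by rewrite /incr; case: eqP => _ /=; lia.
rewrite !e0 -!(inj_eq val_inj) /=.
by case: (_ == b :> nat) /eqP; case: (_ == a :> nat) /eqP;
   case: (_ == (_ - b.+1)%N :> nat) /eqP; case: (_ == (_ - a.+1)%N :> nat) /eqP; lia.
Qed.

Lemma generator_entry C R i j : is_diag_mx (val C - Etheta b a *+ R) -> i != j ->
  val C i j = (((i == b :> nat) && (j == a :> nat))%N%:R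
               + ((i + b == n.*2) && (j + a == n.*2))%N%:R) * R%:Z.
Proof.
move=> /is_diag_mxP dC ij; have := dC i j ij.
rewrite mxBE mulmxnE EthetaE => /eqP; rewrite subr_eq0 => /eqP ->.
by rewrite -[LHS]mulr_natr [X in _ * X]natz.
Qed.

(** Only u = a survives: for u != a the entry (a,u) of C' is zero, and taking a unit from it makes
    it negative. *)
Lemma generator_mul C C' C1 R : is_diag_mx (val C' - Etheta b a *+ R) ->
  is_diag_mx (val C1 - Etheta b a) -> co (val C1) = ro (val C') ->
  is_diag_mx (val C - Etheta b a *+ R.+1) -> co (val C) = co (val C') ->
  mulKQ << C1 >> << C' >> = (v ^ R%:Z * qint_bar (R%:Z + 1)) *: << C >>.
Proof.
move=> dC' dC1 coC1 dC coC; have bN := ltn_ord b; have aN := ltn_ord a.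
have CE : val C' + (Etheta b a - Etheta a a) = val C.
  apply: (diag_part_uniq (X := Etheta b a *+ R.+1)) => //; last first.
    by rewrite coC coD coB !co_Etheta subrr addr0.
  apply/is_diag_mxP=> i j ij; have := is_diag_mxP dC' i j ij.
  rewrite mulrSr !mxBE !mulmxnE.
  have -> : (val C' + (Etheta b a - Etheta a a)) i j = val C' i j + Etheta b a i j.
    rewrite mxDE mxBE.
    have -> : Etheta a a i j = 0.
      by rewrite EthetaE; move: (ij : (i : nat) != j); lia.
    by rewrite subr0.
  rewrite (mxDE (Etheta b a *+ R)) mulmxnE => h.
  by rewrite opprD addrACA h subrr addr0.
have ent i j : i != j -> val C' i j = (((i == b :> nat) && (j == a :> nat))%N%:R
               + ((i + b == n.*2) && (j + a == n.*2))%N%:R) * R%:Z.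
  exact: generator_entry.
rewrite mulKQ_chevalley // (bigD1 a isT) [X in _ + X = _]big1; last first.
  move=> u /andP[_ ua]; rewrite KQ_basis0 ?scaler0 //; apply/negP => /in_XitP[h _ _].
  have au : a != u by rewrite eq_sym.
  have := h a u au; rewrite mxDE mxBE ent // !EthetaE !eqxx.
  move: au; rewrite -(inj_eq val_inj) /= ab.
  move: (val u) (ltn_ord u) => x xN.
  have -> : (a == a.+1 :> nat) = false by lia.
  have -> : (a + a.+1 == n.*2)%N = false by lia.
  rewrite !andFb addr0 mul0r; case: (_ && _) => //=; lia.
rewrite addr0 CE KQ_basis_val; congr (_ *: _); rewrite /chev.
have ba : b != a by rewrite -(inj_eq val_inj) /=; lia.
have eba : val C' b a = R%:Z.
  rewrite ent // !eqxx (_ : (_ && (a + a == _)%N) = false) ?addr0 ?mul1r //; lia.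
have -> : chev_exp (val C') a b a = R%:Z.
  rewrite /chev_exp (bigD1 a) //= eba !big1.
  - rewrite addr0 subr0 (_ : (_ && _) = false) ?addr0 //; lia.
  - move=> l la; rewrite ent; last by rewrite -(inj_eq val_inj) /=; lia.
    rewrite (_ : (_ && _) = false); last by lia.
    by rewrite (_ : (_ && _) = false) ?addr0 ?mul0r //; lia.
  - move=> l /andP[la la']; rewrite ent; last by rewrite -(inj_eq val_inj) /=; lia.
    have la2 : (l == a :> nat) = false by apply/negbTE.
    rewrite la2 andbF (_ : (_ && _) = false) ?addr0 ?mul0r //.
    move: la la2; move: (val l) (ltn_ord l) => x; lia.
by rewrite eba.
Qed.

Section General.
(** The three formulas differ only in their coefficients. Any family starting at 1 and satisfying
    the one-step recursion gives a formula for all R. *)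
Variable c : 'M[int]_N -> ('I_N -> nat) -> Qv.
Hypothesis c0 : forall M, centrosymmetric M -> c M (fun=> 0%N) = 1.
Hypothesis c_step : forall M f u, centrosymmetric M ->
  c M f * chev (move_rows M a b f) a b u =
  v ^ ((weight f)%:Z - 2 * \sum_(l < N | (u < l)%N) (f l)%:Z) * qint_bar ((f u)%:Z + 1)
  * c M (incr f u).

(* Since [C_1][C_R] is a nonzero multiple of [C_(R+1)], this follows from the case
   R = 1 by induction; K is only a common bound for the entries of t. *)
Lemma mulKQ_generator K R A C : (R <= K)%N -> is_diag_mx (val C - Etheta b a *+ R) ->
  co (val C) = ro (val A) ->
  mulKQ << C >> << A >> =
  \sum_(t : {ffun 'I_N -> 'I_K.+1} | (\sum_u t u == R)%N)
    c (val A) (fun u => t u : nat) *: KQ_basis (move_rows (val A) a b (fun u => t u : nat)).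
Proof.
elim: R A C => [|R IH] A C RK dC coC.
  rewrite mulr0n subr0 in dC; rewrite (mulKQ_diag dC coC).
  rewrite (bigD1 [ffun=> ord0]) /=; last by rewrite big1 // => u _; rewrite ffunE.
  rewrite [X in _ + X]big1 => [|t /andP[/eqP t0 tn0]]; last first.
    case/eqP: tn0; apply/ffunP=> u; rewrite ffunE; apply: val_inj; apply/eqP.
    by move/eqP: t0; rewrite sum_nat_eq0 => /forallP/(_ u).
  have -> : (fun u : 'I_N => ([ffun=> ord0] : {ffun 'I_N -> 'I_K.+1}) u : nat) = fun=> 0%N.
    by apply/funext => u; rewrite ffunE.
  by rewrite addr0 move_rows0 KQ_basis_val c0 ?scale1r // Xit_sym.
have ab' : a != b by rewrite -(inj_eq val_inj) /=; lia.
have [C' [dC' coC']] := generator_exists A R ab'.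
have [C1 [dC1 coC1]] := generator_exists C' 1 ab'.
rewrite mulr1n in dC1.
have gm := generator_mul dC' dC1 coC1 dC (etrans coC (esym coC')).
pose S := \sum_(t : {ffun 'I_N -> 'I_K.+1} | (\sum_u t u == R.+1)%N)
  c (val A) (fun u => t u : nat) *: KQ_basis (move_rows (val A) a b (fun u => t u : nat)).
have key : mulKQ << C1 >> (mulKQ << C' >> << A >>) = (v ^ R%:Z * qint_bar (R%:Z + 1)) *: S.
  rewrite (IH A C' (ltnW RK) dC' coC') mulKQ_sumr.
  (* The summand is expressed through the vector obtained after adding the unit, so that [f_u] makes
     it vanish when f_u = 0 and [sum_incr_reindex] applies. *)
  pose F (u : 'I_N) (f : 'I_N -> nat) : KQ n :=
    (v ^ (R%:Z - 2 * \sum_(l < N | (u < l)%N) (f l)%:Z) * qint_bar (f u)%:Z)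
    *: (c (val A) f *: KQ_basis (move_rows (val A) a b f)).
  transitivity (\sum_(t : {ffun 'I_N -> 'I_K.+1} | (\sum_u t u == R)%N)
     \sum_u F u (fun w => (t w + (w == u))%N)).
    apply: eq_bigr => t /eqP st.
    have mulM : mulKQ << C1 >> (KQ_basis (move_rows (val A) a b (fun u => t u : nat)))
      = \sum_u chev (move_rows (val A) a b (fun u => t u : nat)) a b u
          *: KQ_basis (move_rows (val A) a b (incr (fun u => t u : nat) u)).
      have [inM|notM] := boolP (in_Xit (move_rows (val A) a b (fun u => t u : nat))).
        pose Z : Xit n := exist (fun M => in_Xit M) _ inM.
        rewrite -[move_rows _ _ _ _]/(val Z) KQ_basis_val mulKQ_chevalley //.
          by apply: eq_bigr => u _; rewrite move_rows_incr.
        rewrite coC1 (ro_offdiag dC') coC' [val Z]/(move_rows _ _ _ _) ro_move_rows.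
        rewrite /weight st roMn coMn mulrnBl; exact: erefl.
      rewrite (KQ_basis0 notM) big1 => [|u _].
        exact: mulKQ0r.
      by rewrite KQ_basis0 ?scaler0 //; apply: contra notM; exact: in_Xit_move_rows_incr.
    rewrite mulM scaler_sumr; apply: eq_bigr => u _; rewrite scalerA c_step ?Xit_sym // /F scalerA.
    rewrite /weight st /incr eqxx addn1.
    have -> : \sum_(l < N | (u < l)%N) (t l + (l == u))%N%:Z = \sum_(l < N | (u < l)%N) (t l : nat)%:Z.
      apply: eq_bigr => l ul; have -> : (l == u) = false by rewrite -(inj_eq val_inj) /=; lia.
      by rewrite addn0.
    by have -> : (t u : nat)%:Z + 1 = (t u).+1%:Z by lia.
  rewrite exchange_big /=.
  transitivity (\sum_u \sum_(t : {ffun 'I_N -> 'I_K.+1} | (\sum_w t w == R.+1)%N) F u (fun w => t w : nat)).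
    apply: eq_bigr => u _; apply: sum_incr_reindex => // f fu.
    by rewrite /F fu qint_bar0 mulr0 scale0r.
  rewrite exchange_big /= scaler_sumr; apply: eq_bigr => t /eqP st.
  rewrite -scaler_suml; congr (_ *: _).
  have := qint_bar_telescope (fun u => t u : nat); rewrite st => tel.
  have -> : R%:Z + 1 = R.+1%:Z by lia.
  rewrite -tel mulr_sumr; apply: eq_bigr => u _.
  rewrite vexpD; exact: esym (mulrA _ _ _).
have : mulKQ << C1 >> (mulKQ << C' >> << A >>) = (v ^ R%:Z * qint_bar (R%:Z + 1)) *: mulKQ << C >> << A >>.
  rewrite mulKQ_assoc gm; exact: fgmulZl.
rewrite key -/S.
have nz : v ^ R%:Z * qint_bar (R%:Z + 1) != 0.
  by apply: mulf_neq0; [exact: vexp_neq0 | apply: qint_bar_neq0; lia].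
clear key gm; move: nz; move: (_ * _) S (mulKQ _ _) => k S T nz e.
by rewrite -[T](scalerK nz) -e (scalerK nz).
Qed.

End General.

End Generators.

(** * The multiplication formulas *)

Section Formulas.
Variable n : nat.
Local Notation N := (n.*2.+1).
Variables (g : forall d, Xi n d -> Xi n d -> Xi n d -> {poly int}).
Hypothesis g_spec : structure_polynomials g.
Implicit Types (M : 'M[int]_N) (A B C : Xit n) (f : 'I_N -> nat) (h : 'I_n).

Local Notation mulKQ := (mulKQ g_spec).
Local Notation mulK := (mulK g_spec).

Lemma row_hE h : row_h h = h :> nat.
Proof. by rewrite inordK //; have := ltn_ord h; lia. Qed.

Lemma row_h1E h : row_h1 h = h.+1 :> nat.
Proof. by rewrite inordK //; have := ltn_ord h; lia. Qed.

Lemma rows_succ h : row_h1 h = (row_h h).+1 :> nat.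
Proof. by rewrite row_hE row_h1E. Qed.

Lemma rev_rows_succ h : rev_ord (row_h h) = (rev_ord (row_h1 h)).+1 :> nat.
Proof. by rewrite /= row_hE row_h1E; have := ltn_ord h; lia. Qed.

Lemma qbin_bar0 (x : int) : qbin_bar x 0 = 1.
Proof. by rewrite /qbin_bar /qbin big_geq. Qed.

Section ZeroMoves.
Variables a b : 'I_N.

Lemma gen_exp0 M : gen_exp a b M (fun=> 0%N) = 0.
Proof.
rewrite /gen_exp /lin /quad !big1 ?subr0 ?addr0 // => j _; rewrite ?mulr0 //.
by apply: big1 => l _; rewrite ?mul0r.
Qed.

Lemma quad0 W : @quad n W (fun=> 0%N) = 0.
Proof. by apply: big1 => j _; apply: big1 => l _; rewrite mul0r. Qed.

Lemma gen_prod0 M : gen_prod b M (fun=> 0%N) = 1.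
Proof. by apply: big1 => u _; exact: qbin_bar0. Qed.

Lemma coef_generic0 M : coef_generic a b M (fun=> 0%N) = 1.
Proof. by rewrite /coef_generic gen_exp0 gen_prod0 expr0z mul1r. Qed.

Lemma coef_upper0 M : coef_upper a b M (fun=> 0%N) = 1.
Proof.
by rewrite /coef_upper gen_exp0 gen_prod0 /exp_upper quad0 big1 // mulr1.
Qed.

Lemma coef_lower0 M : coef_lower a b M (fun=> 0%N) = 1.
Proof.
rewrite /coef_lower gen_exp0 /exp_lower quad0 /weight big1 // big1 //.
have -> : mid_prod b M (fun=> 0%N) = 1.
  rewrite /mid_prod big_geq // mulr1 !big1; first exact: mul1r.
    by move=> u _; exact: qbin_bar0.
  by move=> u _; exact: qbin_bar0.
by rewrite mulr1.
Qed.

End ZeroMoves.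

Lemma K_to_KQ_mulK A C : K_to_KQ (mulK (K_basis C) (K_basis A)) = mulKQ << C >> << A >>.
Proof. by rewrite K_to_KQ_mul !K_to_KQ_basis. Qed.

(** The admissibility conditions of the formulas are necessary for the resulting matrix to lie in
    the index set; the terms they exclude are already 0 by the default value of [KQ_basis]. *)
Lemma sum_adm R (adm : pred (tvec n R)) (k k' : tvec n R -> Qv) (M M' : tvec n R -> 'M[int]_N) :
  (forall t, M t = M' t) -> (forall t, tsum t -> k t = k' t) ->
  (forall t, in_Xit (M t) -> adm t) ->
  \sum_(t | tsum t) k t *: KQ_basis (M t) = \sum_(t | tsum t && adm t) k' t *: KQ_basis (M' t).
Proof.
move=> MM kk inadm; rewrite (bigID adm) /= [X in _ + X]big1 ?addr0 => [|t /andP[_ nadm]].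
  by apply: eq_bigr => t /andP[st _]; rewrite kk // MM.
by rewrite KQ_basis0 ?scaler0 //; apply: contra nadm; exact: inadm.
Qed.

Lemma move_rows_tdiff A h R (t : tvec n R) :
  move_rows (val A) (row_h h) (row_h1 h) (fun u => t u : nat) = val A - tdiff h t.
Proof.
rewrite /move_rows /tdiff -sumrN; congr (_ + _); apply: eq_bigr => u _.
by rewrite -mulNrn opprB.
Qed.

Lemma in_Xit_adm2 A h R (t : tvec n R) :
  in_Xit (move_rows (val A) (row_h h) (row_h1 h) (fun u => t u : nat)) -> adm2 (val A) h t.
Proof.
case/in_XitP=> pos _ _; apply/forallP=> u; apply/implyP=> uh.
have := pos (row_h h) u; rewrite eq_sym uh => /(_ isT).
rewrite (row_a (rows_succ h)) row_hE.
have -> : (h == n :> nat) = false by have := ltn_ord h; lia.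
by rewrite mul0r subr0 subr_ge0.
Qed.

Lemma gen_exp_beta2 M h R (t : tvec n R) :
  gen_exp (row_h h) (row_h1 h) M (fun u => t u : nat) = beta2 M h t.
Proof.
rewrite /gen_exp /beta2 /lin /quad; congr (_ - _ + _).
  by apply: eq_bigr => j _; rewrite mulr_suml.
by apply: eq_bigr => j _; rewrite mulr_suml.
Qed.

Lemma mulK_formula2 : formula2 mulK.
Proof.
move=> A C h R hn roA dC; rewrite K_to_KQ_mulK.
have an : row_h h != n :> nat by rewrite row_hE; lia.
have bn : row_h1 h != n :> nat by rewrite row_h1E; lia.
rewrite (mulKQ_generator g_spec (rows_succ h) (c := coef_generic (row_h h) (row_h1 h)) _ _ (leqnn R) dC (esym roA)).
- apply: sum_adm => [t|t _|t]; [exact: move_rows_tdiff | | exact: in_Xit_adm2].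
  by rewrite /coef_generic gen_exp_beta2.
- by move=> M _; exact: coef_generic0.
- by move=> M f u _; exact: coef_generic_step (rows_succ h) _ _ _ an bn.
Qed.

Lemma mulK_formula3 : formula3 mulK.
Proof.
move=> A C h R hn roA dC; rewrite K_to_KQ_mulK.
have bn : row_h1 h = n :> nat by rewrite row_h1E.
rewrite (mulKQ_generator g_spec (rows_succ h) (c := coef_lower (row_h h) (row_h1 h)) _ _ (leqnn R) dC (esym roA)).
- apply: sum_adm => [t|t /eqP st|t]; [exact: move_rows_tdiff | | exact: in_Xit_adm2].
  rewrite /coef_lower gen_exp_beta2 /coef3 /mid_prod !mulrA; congr (v ^ _ * _ * _ * _).
  by rewrite /beta3 /exp_lower /weight st opprB opprD /quad; ring.
- by move=> M _; exact: coef_lower0.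
- by move=> M f u cM; exact: coef_lower_step (rows_succ h) _ _ _ bn cM.
Qed.

Lemma sum2_rev (W : nat -> nat -> bool) (X : 'I_N -> 'I_N -> int) :
  \sum_(j < N) \sum_(l < N | W j l) X (rev_ord j) (rev_ord l)
  = \sum_(j < N) \sum_(l < N | W (rev_ord j) (rev_ord l)) X j l.
Proof.
rewrite [RHS](reindex_inj rev_ord_inj); apply: eq_bigr => j _.
by rewrite [RHS](reindex_inj rev_ord_inj); apply: eq_bigl => l; rewrite !rev_ordK.
Qed.

(* Formula (1) moves entries from row h+1 up to row h, that is, by centrosymmetry,
   from row N-h down to row N+1-h with the columns reversed. *)
Definition trev R (t : tvec n R) : tvec n R := [ffun u => t (rev_ord u)].

Lemma trevK R : involutive (@trev R).
Proof. by move=> t; apply/ffunP=> u; rewrite !ffunE rev_ordK. Qed.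

Lemma trevE R (t : tvec n R) : (fun u => trev t u : nat) = (fun u => t (rev_ord u) : nat).
Proof. by apply/funext => u; rewrite ffunE. Qed.

Lemma tsum_trev R (t : tvec n R) : tsum (trev t) = tsum t.
Proof.
rewrite /tsum [in RHS](reindex_inj rev_ord_inj); congr (_ == _).
by apply: eq_bigr => u _; rewrite ffunE.
Qed.

Lemma Etheta_rev (x y : 'I_N) : Etheta (rev_ord x) (rev_ord y) = Etheta x y.
Proof. by rewrite /Etheta !rev_ordK addrC. Qed.

Lemma move_rows_trev A h R (t : tvec n R) :
  move_rows (val A) (rev_ord (row_h1 h)) (rev_ord (row_h h)) (fun u => trev t u : nat)
  = val A + tdiff h t.
Proof.
rewrite trevE /move_rows /tdiff (reindex_inj rev_ord_inj); congr (_ + _).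
by apply: eq_bigr => u _; rewrite !Etheta_rev rev_ordK.
Qed.

Lemma in_Xit_adm1 A h R (t : tvec n R) :
  in_Xit (move_rows (val A) (rev_ord (row_h1 h)) (rev_ord (row_h h)) (fun u => trev t u : nat)) ->
  adm1 (val A) h t.
Proof.
have hn := ltn_ord h; rewrite trevE; case/in_XitP=> pos _ _.
have pos' u : u != row_h1 h ->
    0 <= val A (row_h1 h) u - (t u : nat)%:Z - (h.+1 == n)%:R * (t (rev_ord u) : nat)%:Z.
  move=> uh; have := pos (rev_ord (row_h1 h)) (rev_ord u).
  rewrite (inj_eq rev_ord_inj) eq_sym uh => /(_ isT).
  rewrite (row_a (rev_rows_succ h)) -centrosymmetricE ?Xit_sym // rev_ordK.
  have -> : (rev_ord (row_h1 h) == n :> nat) = (h.+1 == n) by rewrite /= row_h1E; lia.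
  by rewrite !rev_ordK.

rewrite /adm1; case: ifP => hn'; apply/forallP=> u; apply/implyP => /pos'.
  by rewrite (ltn_eqF hn') mul0r subr0 subr_ge0.
have -> : h.+1 == n by lia.
by rewrite mul1r -addrA -opprD subr_ge0.
Qed.

Lemma gen_prod_trev M h R (t : tvec n R) : centrosymmetric M ->
  gen_prod (rev_ord (row_h h)) M (fun u => trev t u : nat)
  = \prod_u qbin_bar (M (row_h h) u + (t u : nat)%:Z) (t u).
Proof.
move=> cM; rewrite /gen_prod (reindex_inj rev_ord_inj); apply: eq_bigr => u _.
by rewrite ffunE rev_ordK (centrosymmetricE _ _ cM).
Qed.

Lemma gen_exp_trev M h R (t : tvec n R) : centrosymmetric M ->
  gen_exp (rev_ord (row_h1 h)) (rev_ord (row_h h)) M (fun u => trev t u : nat)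
  = \sum_(j < N) \sum_(l < N | (j <= l)%N) M (row_h h) l * (t j : nat)%:Z
  - \sum_(j < N) \sum_(l < N | (j < l)%N) M (row_h1 h) l * (t j : nat)%:Z
  + \sum_(j < N) \sum_(l < N | (j < l)%N) (t j : nat)%:Z * (t l : nat)%:Z.
Proof.
move=> cM; rewrite trevE /gen_exp /lin /quad.
have Mrev (x y : 'I_N) : M (rev_ord x) y = M x (rev_ord y).
  by rewrite -[LHS](centrosymmetricE _ _ cM) rev_ordK.
have revle (j l : 'I_N) : (rev_ord l <= rev_ord j)%N = (j <= l)%N.
  by rewrite /=; have := ltn_ord j; have := ltn_ord l; lia.
have revlt (j l : 'I_N) : (rev_ord l < rev_ord j)%N = (j < l)%N.
  by rewrite /=; have := ltn_ord j; have := ltn_ord l; lia.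
congr (_ - _ + _).
- transitivity (\sum_(j < N) \sum_(l < N | (l <= j)%N)
     M (row_h h) (rev_ord l) * (t (rev_ord j) : nat)%:Z).
    by apply: eq_bigr => j _; rewrite mulr_suml; apply: eq_bigr => l _; rewrite Mrev.
  rewrite (sum2_rev (fun j l => (l <= j)%N) (fun j l => M (row_h h) l * (t j : nat)%:Z)).
  by apply: eq_bigr => j _; apply: eq_bigl => l; rewrite revle.
- transitivity (\sum_(j < N) \sum_(l < N | (l < j)%N)
     M (row_h1 h) (rev_ord l) * (t (rev_ord j) : nat)%:Z).
    by apply: eq_bigr => j _; rewrite mulr_suml; apply: eq_bigr => l _; rewrite Mrev.
  rewrite (sum2_rev (fun j l => (l < j)%N) (fun j l => M (row_h1 h) l * (t j : nat)%:Z)).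
  by apply: eq_bigr => j _; apply: eq_bigl => l; rewrite revlt.
- rewrite (sum2_rev (fun j l => (l < j)%N) (fun j l => (t j : nat)%:Z * (t l : nat)%:Z)).
  by apply: eq_bigr => j _; apply: eq_bigl => l; rewrite revlt.
Qed.

Lemma exp_upper_trev R (t : tvec n R) :
  exp_upper (fun u => trev t u : nat)
  = \sum_(j < N) \sum_(l < N | (j < l)%N && (j + l < n.*2)%N) (t j : nat)%:Z * (t l : nat)%:Z
  + \sum_(j < N | (j < n)%N) ((t j * (t j).+1)./2)%:Z.
Proof.
rewrite trevE /exp_upper /quad; congr (_ + _).
  rewrite (sum2_rev (fun j l => (l < j) && (n.*2 < j + l))%N (fun j l => (t j : nat)%:Z * (t l : nat)%:Z)).
  apply: eq_bigr => j _; apply: eq_bigl => l /=.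
  by have := ltn_ord j; have := ltn_ord l; lia.
rewrite (sum_rev (fun j : 'I_N => (n < j)%N) (fun u => ((t u * (t u).+1)./2)%:Z)).
by apply: eq_bigl => j /=; have := ltn_ord j; lia.
Qed.

Lemma mulK_formula1 : formula1 mulK.
Proof.
move=> A B h R roA dB; rewrite K_to_KQ_mulK; have hn := ltn_ord h.
rewrite -Etheta_rev in dB.
have reidx (k : ('I_N -> nat) -> Qv) :
    \sum_(t : {ffun 'I_N -> 'I_R.+1} | (\sum_u t u == R)%N) k (fun u => t u : nat)
       *: KQ_basis (move_rows (val A) (rev_ord (row_h1 h)) (rev_ord (row_h h)) (fun u => t u : nat))
  = \sum_(t : tvec n R | tsum t) k (fun u => trev t u : nat)
       *: KQ_basis (move_rows (val A) (rev_ord (row_h1 h)) (rev_ord (row_h h)) (fun u => trev t u : nat)).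
  rewrite (reindex_inj (inv_inj (@trevK R))); apply: eq_bigl => t; exact: (tsum_trev t).
have an : rev_ord (row_h1 h) = (n.*2 - h.+1)%N :> nat by rewrite /= row_h1E; lia.
have bn : rev_ord (row_h h) != n :> nat by rewrite /= row_hE; lia.
have [hn'|hn'] := boolP (h.+1 == n).
- rewrite (mulKQ_generator g_spec (rev_rows_succ h)
    (c := coef_upper (rev_ord (row_h1 h)) (rev_ord (row_h h))) _ _ (leqnn R) dB (esym roA)).
  + apply: (etrans (reidx (coef_upper _ _ (val A)))); apply: sum_adm => [t|t _|t]; [exact: move_rows_trev | | exact: in_Xit_adm1].
    rewrite /coef_upper gen_prod_trev ?Xit_sym // gen_exp_trev ?Xit_sym // exp_upper_trev.
    by rewrite /coef1 /beta1 hn'.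
  + by move=> M _; exact: coef_upper0.
  + move=> M f u _; apply: coef_upper_step; first exact: rev_rows_succ.
    by rewrite an; lia.
- rewrite (mulKQ_generator g_spec (rev_rows_succ h)
    (c := coef_generic (rev_ord (row_h1 h)) (rev_ord (row_h h))) _ _ (leqnn R) dB (esym roA)).
  + apply: (etrans (reidx (coef_generic _ _ (val A)))); apply: sum_adm => [t|t _|t]; [exact: move_rows_trev | | exact: in_Xit_adm1].
    rewrite /coef_generic gen_prod_trev ?Xit_sym // gen_exp_trev ?Xit_sym //.
    by rewrite /coef1 /beta1 (negbTE hn') addr0.
  + by move=> M _; exact: coef_generic0.
  + move=> M f u _; apply: coef_generic_step; [exact: rev_rows_succ | | exact: bn].
    by rewrite an; lia.
Qed.

Lemma mulK_formulas : multiplication_formulas mulK.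
Proof.
split; [|exact: mulK_formula1|exact: mulK_formula2|exact: mulK_formula3].
by move=> A B /eqP; exact: mulK_basis_eq0.
Qed.

End Formulas.

(** * Uniqueness *)

Section Uniqueness.
Variable n : nat.
Local Notation N := (n.*2.+1).
Hypothesis n_ge1 : (1 <= n)%N.
Implicit Types (A B C Z : Xit n).

Section Agreement.
Variables m m' : K n -> K n -> K n.
Hypotheses (fm : multiplication_formulas m) (fm' : multiplication_formulas m').

(** A diagonal C is the case R = 0 of formula (1), for which n >= 1 supplies an h. *)
Lemma agree_diag A C : is_diag_mx (val C) -> m (K_basis C) (K_basis A) = m' (K_basis C) (K_basis A).
Proof.
have [[f0 f1 _ _] [f0' f1' _ _]] := (fm, fm') => dC.
have [coC|/eqP coC] := eqVneq (co (val C)) (ro (val A)); last first.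
  by rewrite f0 // f0'.
have dC0 : is_diag_mx (val C - Etheta (row_h (Ordinal n_ge1)) (row_h1 (Ordinal n_ge1)) *+ 0).
  by rewrite mulr0n subr0.
by apply: K_to_KQ_inj; rewrite (f1 _ _ _ _ (esym coC) dC0) (f1' _ _ _ _ (esym coC) dC0).
Qed.

(** A generator with b <= n is covered by formula (2) or, when b = n, by formula (3). For b > n its
    mirror description puts it under formula (1). *)
Lemma agree_generator A C (a b : 'I_N) : b = a.+1 :> nat -> is_diag_mx (val C - Etheta b a) ->
  m (K_basis C) (K_basis A) = m' (K_basis C) (K_basis A).
Proof.
have [[f0 f1 f2 f3] [f0' f1' f2' f3']] := (fm, fm') => ab dC.
have [coC|/eqP coC] := eqVneq (co (val C)) (ro (val A)); last first.
  by rewrite f0 // f0'.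
have roA := esym coC; have bN := ltn_ord b.
have [bn|bn] := leqP b n.
  have an : (a < n)%N by rewrite -ab.
  pose h := Ordinal an.
  have ha : row_h h = a by apply: val_inj; rewrite /= row_hE.
  have hb : row_h1 h = b by apply: val_inj; rewrite /= row_h1E.
  have dC1 : is_diag_mx (val C - Etheta (row_h1 h) (row_h h) *+ 1) by rewrite ha hb mulr1n.
  apply: K_to_KQ_inj; have [hn|hn] := boolP (h.+1 < n)%N.
    by rewrite (f2 _ _ _ _ hn roA dC1) (f2' _ _ _ _ hn roA dC1).
  have hn' : h.+1 = n by apply/eqP; rewrite eqn_leq -ab bn leqNgt ab.
  by rewrite (f3 _ _ _ _ hn' roA dC1) (f3' _ _ _ _ hn' roA dC1).
have hn : (rev_ord b < n)%N by rewrite /=; lia.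
pose h := Ordinal hn.
have hb : row_h h = rev_ord b by apply: val_inj; rewrite /= row_hE.
have ha : row_h1 h = rev_ord a by apply: val_inj; rewrite /= row_h1E /=; lia.
have dC1 : is_diag_mx (val C - Etheta (row_h h) (row_h1 h) *+ 1).
  by rewrite ha hb Etheta_rev mulr1n.
by apply: K_to_KQ_inj; rewrite (f1 _ _ _ _ roA dC1) (f1' _ _ _ _ roA dC1).
Qed.

End Agreement.

Section LinearMaps.
Variables k k' : K n -> K n.
Hypothesis kL : forall (c : laurent) x y, k (c *: x + y) = c *: k x + k y.
Hypothesis kL' : forall (c : laurent) x y, k' (c *: x + y) = c *: k' x + k' y.

Lemma linear_agree_sum (s : seq (Xit n)) (P : pred (Xit n)) (c : Xit n -> laurent) :
  (forall Z, Z \in s -> P Z -> k (K_basis Z) = k' (K_basis Z)) ->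
  k (\sum_(Z <- s | P Z) c Z *: K_basis Z) = k' (\sum_(Z <- s | P Z) c Z *: K_basis Z).
Proof.
have zero (f : K n -> K n) : (forall (c : laurent) x y, f (c *: x + y) = c *: f x + f y) -> f 0 = 0.
  move=> fL; have := fL 1 0 0; rewrite !scale1r addr0 => e.
  by apply: (@addrI _ (f 0)); rewrite -e addr0.
elim: s => [|Z s IH] h; first by rewrite !big_nil (zero k kL) (zero k' kL').
have {}IH := IH (fun B Bs => h B (mem_behead (s := Z :: s) Bs)).
rewrite !big_cons; case: (boolP (P Z)) => PZ; last exact: IH.
by rewrite kL kL' IH (h Z (mem_head _ _) PZ).
Qed.

Lemma linear_ext : (forall Z, k (K_basis Z) = k' (K_basis Z)) -> forall x, k x = k' x.
Proof.
move=> e x; have -> : x = \sum_(Z <- dom x | true) coeff Z x *: K_basis Z.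
  rewrite -{1}(freeg_sumE x); apply: eq_bigr => Z _.
  by rewrite /K_basis freeg_scale mulr1.
by apply: linear_agree_sum => Z _ _.
Qed.

End LinearMaps.

(** Leading coefficients need not be invertible in Z[v,v^-1]; cancelling them is enough here. *)
Lemma K_torsion_free (c : laurent) (x y : K n) : laurent_val c != 0 -> c *: x = c *: y -> x = y.
Proof.
move=> c0 e; apply: K_to_KQ_inj.
have := congr1 (@K_to_KQ n) e; rewrite !K_to_KQZ.
by move: (K_to_KQ x) (K_to_KQ y) c0 => X Y c0 E; rewrite -[X](scalerK c0) E (scalerK c0).
Qed.

Lemma coeff_KQ_basis Z (M : 'M[int]_N) : coeff Z (KQ_basis M) = (M == val Z)%:R.
Proof.
rewrite /KQ_basis; case: insubP => [B _ BE|notM]; first by rewrite coeffU mul1r -BE.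
rewrite coeff0; case: eqP => // e; case/negP: notM; rewrite e; exact: valP.
Qed.

Variables (g : forall d, Xi n d -> Xi n d -> Xi n d -> {poly int}).
Hypothesis g_spec : structure_polynomials g.
Local Notation mulK := (mulK g_spec).

Variable m : K n -> K n -> K n.
Hypotheses (am : is_associative_algebra m) (fm : multiplication_formulas m).

Lemma coeff_chevalley A C Z (a b : 'I_N) : b = a.+1 :> nat ->
  is_diag_mx (val C - Etheta b a) -> co (val C) = ro (val A) ->
  laurent_val (coeff Z (mulK (K_basis C) (K_basis A))) =
  \sum_u chev (val A) a b u * (val A + (Etheta b u - Etheta a u) == val Z)%:R.
Proof.
move=> ab dC coC.
have -> : laurent_val (coeff Z (mulK (K_basis C) (K_basis A)))
    = coeff Z (K_to_KQ (mulK (K_basis C) (K_basis A))).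
  by rewrite K_to_KQE coeff_freeg_map.
rewrite K_to_KQ_mulK (mulKQ_chevalley g_spec ab dC coC).
rewrite (big_morph _ (@coeffD _ _ Z) (coeff0 _ Z)).
by apply: eq_bigr => u _; rewrite coeffZ coeff_KQ_basis.
Qed.

(** For z = [C][A'] associativity of both products gives the same left multiplication by z, since
    those by C and A' agree. All terms of z except the leading multiple of [A] are covered by
    induction, so they can be subtracted and the leading coefficient cancelled. *)
Lemma mulK_unique_basis A : forall y, m (K_basis A) y = mulK (K_basis A) y.
Proof.
have fK := mulK_formulas g_spec.
have [lm rm assm] := am; have [lK rK assK] := mulK_algebra g_spec.
apply: (Xit_ind (P := fun A => forall y, m (K_basis A) y = mulK (K_basis A) y)) => {A}.
  by move=> A dA; apply: linear_ext => [c x y|c x y|B]; [exact: rm | exact: rK | exact: agree_diag].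
move=> A A' C a b u ab ub dC coC AE A'bu IHA' IHZ y.
have eC : forall y, m (K_basis C) y = mulK (K_basis C) y.
  apply: linear_ext => [c x x'|c x x'|B]; [exact: rm | exact: rK |].
  exact: agree_generator fm fK B C a b ab dC.
pose z := mulK (K_basis C) (K_basis A').
have mz : m z y = mulK z y by rewrite /z -{1}eC -assm IHA' eC assK.
have coef_upper : laurent_val (coeff A z) = chev (val A') a b u.
  rewrite /z (coeff_chevalley _ ab dC coC) (bigD1 u isT) AE eqxx big1 /=; first by rewrite mulr1 addr0.
  move=> w wu; case: eqP => [|_]; last by rewrite mulr0.
  by move/(@addrI _ (val A'))/(Etheta_diff_inj ab) => e; rewrite e eqxx in wu.
have lower Z : Z \in dom z -> Z != A -> forall y, m (K_basis Z) y = mulK (K_basis Z) y.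
  move=> Zz ZA; have [/existsP[w /eqP ZE]|/existsPn no] :=
    boolP [exists w, val Z == val A' + (Etheta b w - Etheta a w)].
    apply: (IHZ Z w ZE); apply: contra ZA => /eqP wu.
    by apply/eqP/val_inj; rewrite ZE wu AE.
  move: Zz; rewrite mem_dom => /eqP[]; apply: laurent_val_inj.
  rewrite /z (coeff_chevalley _ ab dC coC) big1 // => w _.
  by rewrite eq_sym (negbTE (no w)) mulr0.
apply: (K_torsion_free (c := coeff A z)).
  rewrite coef_upper; apply: mulf_neq0; first exact: vexp_neq0.
  by apply: qint_bar_neq0; lia.
have zE : z = coeff A z *: K_basis A + \sum_(Z <- dom z | Z != A) coeff Z z *: K_basis Z.
  have e Z : coeff Z z *: K_basis Z = << coeff Z z *g Z >>.
    by rewrite /K_basis freeg_scale mulr1.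
  rewrite -{1}(freeg_sumE z); under [in RHS]eq_bigr => Z _ do rewrite e.
  have Az : A \in dom z.
    rewrite mem_dom; apply/eqP=> c0; move: coef_upper; rewrite c0 => /esym/eqP.
    by rewrite mulf_eq0 (negbTE (vexp_neq0 _)); apply/negP/qint_bar_neq0; lia.
  by rewrite (bigD1_seq A Az (uniq_dom z)) /= e.
have lower_sum : m (\sum_(Z <- dom z | Z != A) coeff Z z *: K_basis Z) y
    = mulK (\sum_(Z <- dom z | Z != A) coeff Z z *: K_basis Z) y.
  apply: (linear_agree_sum (k := m^~ y) (k' := mulK^~ y)) => [c x x'|c x x'|Z Zz ZA].
  - exact: lm.
  - exact: lK.
  - exact: lower.
rewrite zE lm lK lower_sum in mz; exact: addIr mz.
Qed.

Lemma mulK_unique x y : m x y = mulK x y.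
Proof.
have [lm _ _] := am; have [lK _ _] := mulK_algebra g_spec.
apply: (linear_ext (k := m^~ y) (k' := mulK^~ y)) => [c a b|c a b|A].
- exact: lm.
- exact: lK.
- exact: mulK_unique_basis.
Qed.

End Uniqueness.

Theorem proposition4p1 (n : nat) (n_ge1 : (1 <= n)%N)
    (g : forall d : nat, Xi n d -> Xi n d -> Xi n d -> {poly int})
    (g_spec : structure_polynomials g) :
  exists mul : K n -> K n -> K n,
    [/\ is_associative_algebra mul,
        given_by_stabilization g mul,
        multiplication_formulas mul &
        forall mul' : K n -> K n -> K n,
          is_associative_algebra mul' -> multiplication_formulas mul' ->
          forall x y : K n, mul' x y = mul x y].
Proof.
exists (mulK g_spec); split; [exact: mulK_algebra | exact: mulK_given_by_stabilization
  | exact: mulK_formulas | move=> mul' am fm; exact: mulK_unique].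
Qed.
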